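(* Let $\kappa>0$, $q:=e^{-2\kappa}$ and $\gamma_n:=\tanh(\kappa n)$, $n\in\mathbb{N}$. Consider the problem of finding $r_{m,n}(t)$, $m,n\in\mathbb{N}$, $t\ge0$, such that \[ \dot r_{m,n}(t)=-2r_{m,n}(t)+\frac{\gamma_m}{2}\bigl(r_{m+1,n}(t)+r_{m-1,n}(t)\bigr)+\frac{\gamma_n}{2}\bigl(r_{m,n+1}(t)+r_{m,n-1}(t)\bigr)\quad (m\neq n), \] with $r_{m,0}=r_{0,n}=0$, together with $r_{m,m}(t)=1$ and $r_{m,n}(t)=r_{n,m}(t)$ for all $m,n\in\mathbb{N}$, $t>0$, and with prescribed initial data $r_{m,n}(0)\in[-1,1]$ satisfying $r_{m,n}(0)=r_{n,m}(0)$ and $r_{m,m}(0)=1$. This problem has a unique solution, given by \[ r_{m,n}(t)=\rho_{m,n}+\sum_{k>\ell}r_{m,n}^{(k,\ell)}(t)\bigl(r_{k,\ell}(0)-\rho_{k,\ell}\bigr),\qquad m,n\in\mathbb{N}, \] where the sum runs over $k,\ell\in\mathbb{N}$ with $k>\ell$, $\rho$ is the stationary solution, and for $k>\ell$, $r^{(k,\ell)}_{m,n}(t)$ is the solution of the differential equations above (for $m\ne n$, with $r^{(k,\ell)}_{m,0}=r^{(k,\ell)}_{0,n}=0$), of the symmetry condition $r^{(k,\ell)}_{m,n}=r^{(k,\ell)}_{n,m}$, and of $r^{(k,\ell)}_{m,m}(t)=0$ for all $m$, with initial condition $r^{(k,\ell)}_{m,n}(0)=\delta_{m,k}\delta_{n,\ell}$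 for $m> n$. Furthermore, for $m\ge n$, \[ r_{m,n}^{(k,\ell)}(t)=\frac{3}{\pi\gamma_1^2}\,\frac{(q;q)_\infty^8}{(-q;q)_\infty^8}\sqrt{\frac{\gamma_m\gamma_n}{\gamma_k\gamma_\ell}}\,\frac{R_{k,\ell}R_{m,n}}{t^5}+O\!\left(t^{-6}\right),\qquad t\to+\infty, \] where $R_{m,n}:=P_m(0)P_n''(0)-P_m''(0)P_n(0)$.
   Context: $(a;q)_n:=\prod_{j=0}^{n-1}(1-aq^j)$ for $n\in\mathbb{N}_0\cup\{\infty\}$. For $n\in\mathbb{N}$ and $\theta\in\mathbb{R}$, \[ P_n(\theta):=\sqrt{\frac{\gamma_1}{\gamma_n}}\sum_{k=0}^{n-1}\frac{(-q;q)_k(-q;q)_{n-1-k}}{(q;q)_k(q;q)_{n-1-k}}\cos\bigl((2k-n+1)\theta\bigr), \] and $P_n''$ denotes the second derivative in $\theta$. The stationary solution $\rho=(\rho_{m,n})_{m,n\in\mathbb{N}}$ is the (unique) bounded array satisfying $-2\rho_{m,n}+\frac{\gamma_m}{2}(\rho_{m+1,n}+\rho_{m-1,n})+\frac{\gamma_n}{2}(\rho_{m,n+1}+\rho_{m,n-1})=0$ for $m\ne n$, $\rho_{m,m}=1$, and $\rho_{m,0}=\rho_{0,n}=0$. (The quantities $r_{m,n}(t)$ are two-spin correlations of a kinetic Ising chain.)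
   Formalization: Solutions r and r^(k,l) are required to be right-continuous at t=0 and bounded uniformly in m,n on each interval [0,T]; without such a growth condition uniqueness fails (e.g. add the solution with zero initial data generated by d_{2,1}(t)=e^{-1/t}). *)

(* Defs.v *)
From Stdlib Require Import Reals Lra.
From Coquelicot Require Import Coquelicot.
Open Scope R_scope.

Fixpoint sumR (f : nat -> R) (n : nat) : R :=
  match n with O => 0 | S n' => sumR f n' + f n' end.

Fixpoint qpoch (a q : R) (n : nat) : R :=
  match n with O => 1 | S n' => qpoch a q n' * (1 - a * q ^ n') end.

Definition qpoch_inf (a q : R) : R := real (Lim_seq (fun n => qpoch a q n)).

Definition tanh (x : R) : R := (exp x - exp (- x)) / (exp x + exp (- x)).

Definition qpar (kappa : R) : R := exp (- 2 * kappa).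
Definition gam (kappa : R) (n : nat) : R := tanh (kappa * INR n).

Definition Ppoly (kappa : R) (n : nat) (theta : R) : R :=
  let q := qpar kappa in
  sqrt (gam kappa 1 / gam kappa n) *
  sumR (fun k => qpoch (- q) q k * qpoch (- q) q (n - 1 - k)
                 / (qpoch q q k * qpoch q q (n - 1 - k))
                 * cos ((2 * INR k - INR n + 1) * theta)) n.

Definition Rmn (kappa : R) (m n : nat) : R :=
  Ppoly kappa m 0 * Derive_n (Ppoly kappa n) 2 0
  - Derive_n (Ppoly kappa m) 2 0 * Ppoly kappa n 0.

(* right-hand side of the evolution equation (arrays indexed by nat, index 0 = boundary) *)
Definition rhs (kappa : R) (a : nat -> nat -> R) (m n : nat) : R :=
  -2 * a m n + gam kappa m / 2 * (a (S m) n + a (pred m) n)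
             + gam kappa n / 2 * (a m (S n) + a m (pred n)).

Definition stationary (kappa : R) (rho : nat -> nat -> R) : Prop :=
  (exists M, forall m n, Rabs (rho m n) <= M) /\
  (forall m n, (1 <= m)%nat -> (1 <= n)%nat -> m <> n -> rhs kappa rho m n = 0) /\
  (forall m, (1 <= m)%nat -> rho m m = 1) /\
  (forall m, rho m O = 0) /\ (forall n, rho O n = 0).

Definition regular (r : nat -> nat -> R -> R) : Prop :=
  (forall m n, filterlim (r m n) (at_right 0) (locally (r m n 0))) /\
  (forall T, 0 <= T -> exists M, forall m n t, 0 <= t <= T -> Rabs (r m n t) <= M).

Definition lattice_eq (kappa : R) (r : nat -> nat -> R -> R) : Prop :=
  regular r /\
  (forall m n t, (1 <= m)%nat -> (1 <= n)%nat -> m <> n -> 0 < t ->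
     is_derive (r m n) t (rhs kappa (fun i j => r i j t) m n)) /\
  (forall m t, 0 <= t -> r m O t = 0) /\ (forall n t, 0 <= t -> r O n t = 0) /\
  (forall m n t, 0 <= t -> r m n t = r n m t).

Definition init_data (r0 : nat -> nat -> R) : Prop :=
  (forall m n, (1 <= m)%nat -> (1 <= n)%nat -> -1 <= r0 m n <= 1) /\
  (forall m n, (1 <= m)%nat -> (1 <= n)%nat -> r0 m n = r0 n m) /\
  (forall m, (1 <= m)%nat -> r0 m m = 1).

Definition solves (kappa : R) (r0 : nat -> nat -> R) (r : nat -> nat -> R -> R) : Prop :=
  lattice_eq kappa r /\
  (forall m t, (1 <= m)%nat -> 0 < t -> r m m t = 1) /\
  (forall m n, (1 <= m)%nat -> (1 <= n)%nat -> r m n 0 = r0 m n).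

Definition solves_kl (kappa : R) (k l : nat) (f : nat -> nat -> R -> R) : Prop :=
  lattice_eq kappa f /\
  (forall m t, 0 <= t -> f m m t = 0) /\
  (forall m n, (1 <= n)%nat -> (n < m)%nat ->
     f m n 0 = if (Nat.eqb m k && Nat.eqb n l)%bool then 1 else 0).

(* Main.v *)
(**
  Uniqueness holds because Picard iteration of the bounded lattice operator converges even among
  arrays of linear growth in each index. An antisymmetric array automatically vanishes on the
  diagonal, so for [m > n] the solution [r^(k,l)] is the 2 x 2 determinant of one-particle heat
  kernels [heat m k], where [heat] is generated by [a_m -> - a_m + gam_m / 2 (a_{m+1} + a_{m-1})].
  The Rogers polynomials [c_n] with parameter [- q] are the eigenvectors of this operator with
  eigenvalue [cos x - 1]. They are orthogonal for the weight
  [w x = gam_1 + sum_{j >= 1} (-1)^j (gam_{j+1} - gam_{j-1}) cos (2 j x)],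
  since the pairing of [c_n] with [w] is a q-Gosper summable sum. Hence
  [heat m k t = 1 / (pi gam_k) int_0^pi exp (- t (1 - cos x)) c_m c_k w dx].
  Near 0 one has [w x = C x^2 + O(x^4)], where
  [C = 2 sum_{k in Z} (-1)^k / cosh^2 (kappa k) = 2 ((q;q)_oo / (-q;q)_oo)^4]
  is Jacobi's formula for the fourth power of a theta constant, obtained as the limit of a finite
  identity proved by the WZ method. In the determinant the orders t^-3 and t^-4 cancel, and the
  Gaussian moments give the coefficient of t^-5.
*)

Require Import Defs.
From Stdlib Require Import Reals Lra Lia Arith Bool FunctionalExtensionality.
From Coquelicot Require Import Coquelicot.
Open Scope R_scope.

(** The determinant is antisymmetric while [r^(k,l)] is symmetric, so the two are compared only
    where [m >= n]; the common zero diagonal makes this region closed under the dynamics. The sum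
    over [k > l] is controlled not by decay of the kernels but by uniqueness: a finite superposition
    equals the exponential series of the generator applied to truncated data, with a bound
    independent of the truncation.

    The power of [t] can be read off by writing the determinant of integrals as half a double
    integral of [det (c_m, c_n)(x, y) det (c_k, c_l)(x, y)]. Each determinant vanishes like
    [x^2 - y^2]; with the weights [x^2 y^2] and the measure [dx dy] this has degree ten in a length
    of size [t^(-1/2)]. The constant is [3 PI / 4], coming from a Hankel determinant of Gaussian
    moments, times [C^2], divided by the norms [PI^2 gam_k gam_l]; the factor [gam_1^2] compensates
    the normalization of [P_n]. *)

Notation RV := R_NormedModule (only parsing).
Notation RCV := R_CompleteNormedModule (only parsing).

Ltac smooth :=
  apply (ex_derive_continuous (V := RV)); auto_derive; trivial.

(** * Elementary bounds for [q] and [gam] *)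

Lemma exp_monotone (x y : R) : x <= y -> exp x <= exp y.
Proof. intros [H| ->]; [left; apply exp_increasing, H|right; reflexivity]. Qed.

Lemma exp_pow_INR (x : R) (n : nat) : exp x ^ n = exp (INR n * x).
Proof.
  induction n as [|n IH].
  - simpl; rewrite Rmult_0_l, exp_0; reflexivity.
  - rewrite S_INR; simpl; rewrite IH, <- exp_plus; f_equal; ring.
Qed.

Lemma qpar_bounds (kappa : R) : 0 < kappa -> 0 < qpar kappa < 1.
Proof.
  intros hk; unfold qpar; split; [apply exp_pos|].
  rewrite <- exp_0; apply exp_increasing; lra.
Qed.

Lemma gam_qpar (kappa : R) (n : nat) :
  gam kappa n = (1 - qpar kappa ^ n) / (1 + qpar kappa ^ n).
Proof.
  unfold gam, Defs.tanh, qpar; rewrite exp_pow_INR.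
  replace (INR n * (-2 * kappa)) with (- (kappa * INR n) + - (kappa * INR n)) by ring.
  rewrite exp_plus, exp_Ropp.
  pose proof (exp_pos (kappa * INR n)) as He.
  field; repeat split; nra.
Qed.

Lemma pow_bounds_01 (q : R) (n : nat) : 0 < q < 1 -> 0 < q ^ n <= 1.
Proof.
  intros Hq; split; [apply pow_lt; lra|].
  rewrite <- (pow1 n); apply pow_incr; lra.
Qed.

Lemma pow_lt_1 (q : R) (n : nat) : 0 < q < 1 -> (1 <= n)%nat -> q ^ n < 1.
Proof.
  intros Hq Hn; destruct n as [|n]; [lia|].
  pose proof (pow_bounds_01 q n Hq); simpl; nra.
Qed.

Lemma gam_bounds (kappa : R) (n : nat) : 0 < kappa -> 0 <= gam kappa n < 1.
Proof.
  intros hk; rewrite gam_qpar.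
  pose proof (pow_bounds_01 _ n (qpar_bounds _ hk)).
  split; [apply Rdiv_le_0_compat; lra|].
  apply (Rmult_lt_reg_r (1 + qpar kappa ^ n)); [lra|].
  unfold Rdiv; rewrite Rmult_assoc, Rinv_l by lra; lra.
Qed.

Lemma gam_pos (kappa : R) (n : nat) : 0 < kappa -> (1 <= n)%nat -> 0 < gam kappa n.
Proof.
  intros hk Hn; rewrite gam_qpar.
  pose proof (pow_bounds_01 _ n (qpar_bounds _ hk)).
  pose proof (pow_lt_1 _ n (qpar_bounds _ hk) Hn).
  apply Rdiv_lt_0_compat; lra.
Qed.

(** * Uniqueness *)

Lemma boundary_dec (m n : nat) :
  {m = O \/ n = O \/ m = n} + {(1 <= m)%nat /\ (1 <= n)%nat /\ m <> n}.
Proof.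
  destruct (Nat.eq_dec m 0), (Nat.eq_dec n 0), (Nat.eq_dec m n); (left; lia) || (right; lia).
Qed.

(** Affine in each index, so that the mean over two opposite neighbours is the value at the centre;
    the shift by one keeps it at least 1 on the axes as well. *)
Definition weight (m n : nat) : R := (1 + INR m) * (1 + INR n).

Lemma weight_ge_1 (m n : nat) : 1 <= weight m n.
Proof. unfold weight; pose proof (pos_INR m); pose proof (pos_INR n); nra. Qed.

(* The homogeneous problem, in the class of arrays of at most linear growth in each index: the
   spectral solution is not a priori bounded. *)
Definition growth_flow (kappa : R) (d : nat -> nat -> R -> R) : Prop :=
  (forall m n, filterlim (d m n) (at_right 0) (locally (d m n 0))) /\
  (forall m n t, (1 <= m)%nat -> (1 <= n)%nat -> m <> n -> 0 < t ->
     is_derive (d m n) t (rhs kappa (fun i j => d i j t) m n)) /\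
  (forall m n t, m = O \/ n = O \/ m = n -> 0 <= t -> d m n t = 0) /\
  (forall T, 0 <= T -> exists M, forall m n t, 0 <= t <= T ->
     Rabs (d m n t) <= M * weight m n).

(** The derivative is known only for positive times and at 0 there is only right continuity, so the
    mean value theorem is applied away from 0 and the initial piece is absorbed in the supposed
    excess [e]. *)
Lemma le_of_deriv_le_pow (f f' : R -> R) (C t : R) (j : nat) :
  0 <= C -> 0 <= t -> f 0 = 0 -> filterlim f (at_right 0) (locally (f 0)) ->
  (forall s, 0 < s <= t -> is_derive f s (f' s)) ->
  (forall s, 0 < s <= t -> f' s <= C * s ^ j) ->
  f t <= C * t ^ S j / INR (S j).
Proof.
  intros HC Ht Hf0 Hlim Hder Hle.
  assert (Hj : 0 < INR (S j)) by (apply lt_0_INR; lia).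
  assert (Hpos : forall s, 0 <= s -> 0 <= C * s ^ S j / INR (S j)).
  { intros s Hs; apply Rdiv_le_0_compat; [|exact Hj].
    apply Rmult_le_pos; [exact HC|apply pow_le; exact Hs]. }
  destruct (Req_dec t 0) as [->|Ht0].
  { rewrite Hf0; apply Hpos; lra. }
  apply Rnot_lt_le; intros Hlt.
  set (e := f t - C * t ^ S j / INR (S j)).
  assert (He : 0 < e) by (unfold e; lra).
  destruct (proj1 (filterlim_locally f (f 0)) Hlim (mkposreal e He)) as [del Hdel].
  (* A starting point so close to 0 that [f x < e]: since [g] does not increase on [[x, t]], this
     forces [e = g t <= g x < e]. *)
  set (x := Rmin (del / 2) (t / 2)).
  assert (Hx0 : 0 < x) by (unfold x; apply Rmin_pos; [apply is_pos_div_2|lra]).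
  assert (Hxd : x <= del / 2) by apply Rmin_l.
  assert (Hxt : x <= t / 2) by apply Rmin_r.
  assert (Hb : Rabs (f x - f 0) < e).
  { apply Hdel; [|exact Hx0].
    change (Rabs (x - 0) < del); rewrite Rminus_0_r, Rabs_pos_eq by lra.
    pose proof (cond_pos del); lra. }
  set (g := fun s => f s - C * s ^ S j / INR (S j)).
  assert (Hg : forall s, 0 < s <= t -> is_derive g s (f' s - C * s ^ j)).
  { intros s Hs; unfold g.
    apply (is_derive_minus f (fun s => C * s ^ S j / INR (S j))); [apply Hder, Hs|].
    auto_derive; [trivial|].
    change (match j with O => 1 | S _ => INR j + 1 end) with (INR (S j)); simpl pred; field; lra. }
  destruct (MVT_gen g x t (fun s => f' s - C * s ^ j)) as [c [Hc Heq]].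
  - intros s Hs; rewrite Rmin_left, Rmax_right in Hs by lra; apply Hg; lra.
  - intros s Hs; rewrite Rmin_left, Rmax_right in Hs by lra.
    apply continuity_pt_filterlim.
    apply (ex_derive_continuous (V := RV)).
    eexists; apply Hg; lra.
  - rewrite Rmin_left, Rmax_right in Hc by lra.
    assert (f' c - C * c ^ j <= 0) by (specialize (Hle c ltac:(lra)); lra).
    assert (g t <= g x) by nra.
    apply Rabs_def2 in Hb; rewrite Hf0, Rminus_0_r in Hb.
    specialize (Hpos x ltac:(lra)); unfold g, e in *; lra.
Qed.

Lemma abs_le_of_deriv_le_pow (f f' : R -> R) (C t : R) (j : nat) :
  0 <= C -> 0 <= t -> f 0 = 0 -> filterlim f (at_right 0) (locally (f 0)) ->
  (forall s, 0 < s <= t -> is_derive f s (f' s)) ->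
  (forall s, 0 < s <= t -> Rabs (f' s) <= C * s ^ j) ->
  Rabs (f t) <= C * t ^ S j / INR (S j).
Proof.
  intros HC Ht Hf0 Hlim Hder Hle; apply Rabs_le; split.
  - apply Ropp_le_cancel; rewrite Ropp_involutive.
    apply (le_of_deriv_le_pow (fun s => - f s) (fun s => - f' s)); auto.
    + lra.
    + apply (filterlim_comp _ _ _ f Ropp _ _ _ Hlim), (filterlim_opp (f 0)).
    + intros s Hs; apply (is_derive_opp f), Hder, Hs.
    + intros s Hs; specialize (Hle s Hs).
      apply Rle_trans with (2 := Hle); rewrite <- Rabs_Ropp; apply Rle_abs.
  - apply (le_of_deriv_le_pow f f'); auto.
    intros s Hs; apply Rle_trans with (2 := Hle s Hs), Rle_abs.
Qed.

(** Two opposite neighbours contribute at most [2 B weight m n] because the weight is affine; with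
    [gam < 1] the three terms add up to [2 + 1 + 1]. The bound is asked only next to [(m, n)], which
    is what lets a box shrink by one site per iteration. *)
Lemma rhs_abs_le (kappa : R) (a : nat -> nat -> R) (B : R) (m n : nat) :
  0 < kappa -> (1 <= m)%nat -> (1 <= n)%nat -> 0 <= B ->
  (forall i j, (pred m <= i <= S m)%nat -> (pred n <= j <= S n)%nat ->
     Rabs (a i j) <= B * weight i j) ->
  Rabs (rhs kappa a m n) <= 4 * B * weight m n.
Proof.
  intros hk Hm Hn HB H.
  pose proof (gam_bounds kappa m hk) as Gm; pose proof (gam_bounds kappa n hk) as Gn.
  destruct m as [|m]; [lia|]; destruct n as [|n]; [lia|].
  assert (H0 := H (S m) (S n) ltac:(lia) ltac:(lia)).
  assert (H1 := H (S (S m)) (S n) ltac:(lia) ltac:(lia)).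
  assert (H2 := H m (S n) ltac:(lia) ltac:(lia)).
  assert (H3 := H (S m) (S (S n)) ltac:(lia) ltac:(lia)).
  assert (H4 := H (S m) n ltac:(lia) ltac:(lia)).
  unfold rhs, weight in *; simpl pred in *; repeat rewrite S_INR in *.
  apply Rabs_le_between in H0, H1, H2, H3, H4.
  set (x := INR m) in *; set (y := INR n) in *.
  set (gm := gam kappa (S m)) in *; set (gn := gam kappa (S n)) in *.
  set (w := (1 + (x + 1)) * (1 + (y + 1))) in *.
  assert (Hw : 0 <= B * w).
  { apply Rmult_le_pos; [exact HB|].
    pose proof (pos_INR m); pose proof (pos_INR n); unfold w, x, y; nra. }
  assert (E1 : - (2 * (B * w)) <= a (S (S m)) (S n) + a m (S n) <= 2 * (B * w))
    by (unfold w in *; split; lra).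
  assert (E2 : - (2 * (B * w)) <= a (S m) (S (S n)) + a (S m) n <= 2 * (B * w))
    by (unfold w in *; split; lra).
  set (u := a (S (S m)) (S n) + a m (S n)) in *.
  set (v := a (S m) (S (S n)) + a (S m) n) in *.
  assert (gm / 2 * u <= B * w) by nra.
  assert (- (B * w) <= gm / 2 * u) by nra.
  assert (gn / 2 * v <= B * w) by nra.
  assert (- (B * w) <= gn / 2 * v) by nra.
  apply Rabs_le; split; lra.
Qed.

(* Influence propagates at most one site per Picard iteration, so data vanishing on a box of
   side [N] stays of order [(4 t)^j / j!] at distance [j] from the outside of the box. *)
Lemma growth_flow_local_bound (kappa : R) (d : nat -> nat -> R -> R) (T M : R) (N : nat) :
  0 < kappa -> growth_flow kappa d -> 0 <= T -> 0 <= M ->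
  (forall m n t, 0 <= t <= T -> Rabs (d m n t) <= M * weight m n) ->
  (forall m n, (m < N)%nat -> (n < N)%nat -> d m n 0 = 0) ->
  forall j m n t, (m + j < N)%nat -> (n + j < N)%nat -> 0 <= t <= T ->
    Rabs (d m n t) <= M * ((4 * t) ^ j / INR (fact j)) * weight m n.
Proof.
  intros hk [Hlim [Hder [Hbd _]]] HT HM HB H0 j.
  induction j as [|j IH]; intros m n t Hm Hn Ht.
  { simpl; replace (M * (1 / 1)) with M by field; apply HB, Ht. }
  assert (Hf : 0 < INR (fact j)) by apply INR_fact_lt_0.
  assert (Hj : 0 < INR (S j)) by (apply lt_0_INR; lia).
  assert (Hw : 0 < weight m n) by (pose proof (weight_ge_1 m n); lra).
  destruct (boundary_dec m n) as [Hmn|Hmn].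
  { rewrite Hbd, Rabs_R0 by (auto; lra); apply Rmult_le_pos; [apply Rmult_le_pos, Rdiv_le_0_compat|]; try lra;
      [apply pow_le; lra|apply INR_fact_lt_0]. }
  replace (M * ((4 * t) ^ S j / INR (fact (S j))) * weight m n)
    with ((4 ^ S j * M / INR (fact j) * weight m n) * t ^ S j / INR (S j)).
  2:{ rewrite Rpow_mult_distr, fact_simpl, mult_INR; field; lra. }
  apply (abs_le_of_deriv_le_pow (d m n) (fun s => rhs kappa (fun i j => d i j s) m n)).
  - apply Rmult_le_pos; [apply Rdiv_le_0_compat; [apply Rmult_le_pos|]|]; try lra.
    apply pow_le; lra.
  - lra.
  - apply H0; lia.
  - apply Hlim.
  - intros s Hs; apply Hder; try lia; lra.
  - intros s Hs.
    replace (4 ^ S j * M / INR (fact j) * weight m n * s ^ j)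
      with (4 * (M * ((4 * s) ^ j / INR (fact j))) * weight m n)
      by (rewrite Rpow_mult_distr; simpl; field; lra).
    apply rhs_abs_le; try lia; try assumption.
    + apply Rmult_le_pos; [lra|]; apply Rdiv_le_0_compat; [apply pow_le; lra|lra].
    + intros i k Hi Hk; apply IH; try lia; lra.
Qed.

Lemma pow_div_fact_lim (x : R) : is_lim_seq (fun j => x ^ j / INR (fact j)) 0.
Proof. apply is_lim_seq_Reals, cv_speed_pow_fact. Qed.

Lemma is_lim_seq_abs_le_0 (u v : nat -> R) :
  (forall n, Rabs (u n) <= v n) -> is_lim_seq v 0 -> is_lim_seq u 0.
Proof.
  intros H Hv; apply is_lim_seq_abs_0.
  apply (is_lim_seq_le_le (fun _ => 0) _ v); [|apply is_lim_seq_const|exact Hv].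
  intros n; split; [apply Rabs_pos|apply H].
Qed.

(** Data vanishing everywhere vanish on every box. The box of side [m + n + j + 1] leaves room for
    [j] iterations from [(m, n)], and [(4 t)^j / j!] tends to 0. *)
Lemma growth_flow_zero (kappa : R) (d : nat -> nat -> R -> R) :
  0 < kappa -> growth_flow kappa d -> (forall m n, d m n 0 = 0) ->
  forall m n t, 0 <= t -> d m n t = 0.
Proof.
  intros hk Hd H0 m n t Ht.
  destruct (proj2 (proj2 (proj2 Hd)) t Ht) as [M HM].
  assert (HB : forall m n s, 0 <= s <= t -> Rabs (d m n s) <= Rmax M 0 * weight m n).
  { intros i j s Hs; apply Rle_trans with (1 := HM i j s Hs).
    apply Rmult_le_compat_r; [pose proof (weight_ge_1 i j); lra|apply Rmax_l]. }
  assert (Hj : forall j, Rabs (d m n t) <= (4 * t) ^ j / INR (fact j) * (Rmax M 0 * weight m n)).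
  { intros j.
    pose proof (growth_flow_local_bound kappa d t (Rmax M 0) (m + n + j + 1) hk Hd Ht
      (Rmax_r _ _) HB (fun m n _ _ => H0 m n) j m n t ltac:(lia) ltac:(lia) ltac:(lra)).
    lra. }
  assert (Hl : is_lim_seq (fun j => (4 * t) ^ j / INR (fact j) * (Rmax M 0 * weight m n))
                 (0 * (Rmax M 0 * weight m n))).
  { apply (is_lim_seq_scal_r _ _ 0), pow_div_fact_lim. }
  rewrite Rmult_0_l in Hl.
  apply Rabs_eq_0, Rle_antisym; [|apply Rabs_pos].
  apply (is_lim_seq_le (fun _ => Rabs (d m n t)) _ (Rabs (d m n t)) 0 Hj
    (is_lim_seq_const _) Hl).
Qed.

(** * Linear structure of the homogeneous problem *)

Lemma at_right_minus (f g : R -> R) :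
  filterlim f (at_right 0) (locally (f 0)) -> filterlim g (at_right 0) (locally (g 0)) ->
  filterlim (fun t => f t - g t) (at_right 0) (locally (f 0 - g 0)).
Proof.
  intros Hf Hg; eapply (filterlim_comp_2 f (fun t => - g t) Rplus).
  - exact Hf.
  - apply (filterlim_comp _ _ _ g Ropp _ _ _ Hg), (filterlim_opp (g 0)).
  - apply (filterlim_plus (f 0) (- g 0)).
Qed.

Lemma rhs_minus (kappa : R) (a b : nat -> nat -> R) (m n : nat) :
  rhs kappa (fun i j => a i j - b i j) m n = rhs kappa a m n - rhs kappa b m n.
Proof. unfold rhs; ring. Qed.

Lemma growth_flow_minus (kappa : R) (d e : nat -> nat -> R -> R) :
  growth_flow kappa d -> growth_flow kappa e ->
  growth_flow kappa (fun m n t => d m n t - e m n t).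
Proof.
  intros [L1 [D1 [B1 G1]]] [L2 [D2 [B2 G2]]]; refine (conj _ (conj _ (conj _ _))).
  - intros m n; apply at_right_minus; [apply L1|apply L2].
  - intros m n t Hm Hn Hmn Ht.
    rewrite rhs_minus.
    apply (is_derive_minus (d m n) (e m n)); [apply D1|apply D2]; auto.
  - intros m n t H Ht; rewrite B1, B2 by auto; ring.
  - intros T HT; destruct (G1 T HT) as [M1 H1]; destruct (G2 T HT) as [M2 H2].
    exists (M1 + M2); intros m n t Ht; specialize (H1 m n t Ht); specialize (H2 m n t Ht).
    unfold Rminus; apply Rle_trans with (1 := Rabs_triang _ _); rewrite Rabs_Ropp; lra.
Qed.

Lemma growth_flow_scal (kappa c : R) (d : nat -> nat -> R -> R) :
  growth_flow kappa d -> growth_flow kappa (fun m n t => d m n t * c).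
Proof.
  intros [L1 [D1 [B1 G1]]]; refine (conj _ (conj _ (conj _ _))).
  - intros m n.
    apply (filterlim_comp _ _ _ (d m n) (fun x => x * c) _ _ _ (L1 m n)).
    apply (filterlim_scal_l (V := RV) (d m n 0) c).
  - intros m n t Hm Hn Hmn Ht.
    replace (rhs kappa (fun i j => d i j t * c) m n)
      with (rhs kappa (fun i j => d i j t) m n * c) by (unfold rhs; ring).
    apply (is_derive_ext (fun s => scal c (d m n s)));
      [intros s; apply Rmult_comm|].
    rewrite Rmult_comm; apply is_derive_scal, D1; auto.
  - intros m n t H Ht; rewrite B1 by auto; ring.
  - intros T HT; destruct (G1 T HT) as [M1 H1].
    exists (M1 * Rabs c); intros m n t Ht; specialize (H1 m n t Ht).
    rewrite Rabs_mult; pose proof (Rabs_pos c); nra.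
Qed.

Lemma growth_flow_0 (kappa : R) : growth_flow kappa (fun _ _ _ => 0).
Proof.
  refine (conj _ (conj _ (conj _ _))).
  - intros; apply filterlim_const.
  - intros m n t _ _ _ _; replace (rhs kappa (fun _ _ => 0) m n) with 0
      by (unfold rhs; ring).
    apply (is_derive_const (K := R_AbsRing) (V := RV) 0).
  - reflexivity.
  - intros T _; exists 0; intros; rewrite Rabs_R0; lra.
Qed.

Lemma growth_flow_sumR (kappa : R) (d : nat -> nat -> nat -> R -> R) (N : nat) :
  (forall k, (k < N)%nat -> growth_flow kappa (d k)) ->
  growth_flow kappa (fun m n t => sumR (fun k => d k m n t) N).
Proof.
  induction N as [|N IH]; intros H; [apply growth_flow_0|].
  (* The new summand is added by subtracting its multiple by [-1]. *)
  assert (H1 := growth_flow_minus _ _ _ (IH (fun k Hk => H k ltac:(lia)))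
    (growth_flow_scal kappa (-1) (d N) (H N ltac:(lia)))).
  replace (fun m n t => sumR (fun k => d k m n t) (S N))
    with (fun m n t => sumR (fun k => d k m n t) N - d N m n t * -1); [exact H1|].
  apply functional_extensionality; intros m; apply functional_extensionality; intros n.
  apply functional_extensionality; intros t; simpl; ring.
Qed.

Lemma lattice_eq_growth_flow (kappa : R) (d : nat -> nat -> R -> R) :
  lattice_eq kappa d -> (forall m t, 0 <= t -> d m m t = 0) -> growth_flow kappa d.
Proof.
  intros [[L G] [D [B1 [B2 _]]]] Hd; refine (conj _ (conj _ (conj _ _))).
  - exact L.
  - exact D.
  - intros m n t [-> | [-> | ->]] Ht; auto.
  - intros T HT; destruct (G T HT) as [M HM]; exists M; intros m n t Ht.
    specialize (HM m n t Ht); pose proof (weight_ge_1 m n).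
    pose proof (Rabs_pos (d m n t)); nra.
Qed.

(** * The semigroup and the stationary solution *)

(** Setting the axes and the diagonal to 0 builds the side conditions into a bounded operator, so
    that its exponential preserves them. *)
Definition step (kappa : R) (a : nat -> nat -> R) (m n : nat) : R :=
  if (Nat.eqb m 0 || Nat.eqb n 0 || Nat.eqb m n)%bool then 0 else rhs kappa a m n.

Fixpoint iter_step (kappa : R) (a : nat -> nat -> R) (j : nat) : nat -> nat -> R :=
  match j with O => a | S i => step kappa (iter_step kappa a i) end.

(** The exponential of [t] times [step], taken entry by entry as a power series in [t], so that
    smoothness in time comes from the theory of power series. *)
Definition semigroup (kappa : R) (a : nat -> nat -> R) (m n : nat) (t : R) : R :=
  PSeries (fun j => iter_step kappa a j m n / INR (fact j)) t.

Definition off_boundary (a : nat -> nat -> R) : Prop :=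
  forall m n, m = O \/ n = O \/ m = n -> a m n = 0.

Lemma step_boundary (kappa : R) (a : nat -> nat -> R) : off_boundary (step kappa a).
Proof.
  intros m n H; unfold step.
  replace (Nat.eqb m 0 || Nat.eqb n 0 || Nat.eqb m n)%bool with true; [reflexivity|].
  destruct H as [H|[H|H]]; apply Nat.eqb_eq in H; rewrite H; simpl;
    repeat rewrite orb_true_r; reflexivity.
Qed.

Lemma step_interior (kappa : R) (a : nat -> nat -> R) (m n : nat) :
  (1 <= m)%nat -> (1 <= n)%nat -> m <> n -> step kappa a m n = rhs kappa a m n.
Proof.
  intros Hm Hn Hmn; unfold step.
  replace (Nat.eqb m 0) with false by (symmetry; apply Nat.eqb_neq; lia).
  replace (Nat.eqb n 0) with false by (symmetry; apply Nat.eqb_neq; lia).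
  replace (Nat.eqb m n) with false by (symmetry; apply Nat.eqb_neq; lia).
  reflexivity.
Qed.

Lemma rhs_abs_le_const (kappa : R) (a : nat -> nat -> R) (B : R) (m n : nat) :
  0 < kappa -> (forall i j, Rabs (a i j) <= B) -> Rabs (rhs kappa a m n) <= 4 * B.
Proof.
  intros hk H.
  pose proof (gam_bounds kappa m hk) as Gm; pose proof (gam_bounds kappa n hk) as Gn.
  assert (H0 := H m n); assert (H1 := H (S m) n); assert (H2 := H (pred m) n).
  assert (H3 := H m (S n)); assert (H4 := H m (pred n)).
  apply Rabs_le_between in H0, H1, H2, H3, H4; unfold rhs.
  set (u := a (S m) n + a (pred m) n).
  set (v := a m (S n) + a m (pred n)).
  assert (- (2 * B) <= u <= 2 * B) by (unfold u; lra).
  assert (- (2 * B) <= v <= 2 * B) by (unfold v; lra).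
  assert (- B <= gam kappa m / 2 * u <= B) by (split; nra).
  assert (- B <= gam kappa n / 2 * v <= B) by (split; nra).
  apply Rabs_le; split; lra.
Qed.

Lemma iter_step_abs_le (kappa : R) (a : nat -> nat -> R) (M : R) (j m n : nat) :
  0 < kappa -> (forall m n, Rabs (a m n) <= M) ->
  Rabs (iter_step kappa a j m n) <= M * 4 ^ j.
Proof.
  intros hk HM; revert m n; induction j as [|j IH]; intros m n.
  { simpl; rewrite Rmult_1_r; apply HM. }
  assert (0 <= M * 4 ^ j) by (apply Rle_trans with (2 := IH O O), Rabs_pos).
  simpl; unfold step.
  destruct (Nat.eqb m 0 || Nat.eqb n 0 || Nat.eqb m n)%bool.
  - rewrite Rabs_R0; lra.
  - apply Rle_trans with (1 := rhs_abs_le_const kappa _ _ m n hk IH); lra.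
Qed.

Lemma iter_step_boundary (kappa : R) (a : nat -> nat -> R) (j : nat) :
  off_boundary a -> off_boundary (iter_step kappa a j).
Proof. intros Ha; destruct j; [exact Ha|apply step_boundary]. Qed.

Lemma iter_step_sym (kappa : R) (a : nat -> nat -> R) (j : nat) :
  (forall m n, a m n = a n m) ->
  forall m n, iter_step kappa a j m n = iter_step kappa a j n m.
Proof.
  intros Ha; induction j as [|j IH]; intros m n; [apply Ha|].
  simpl; unfold step; rewrite (Nat.eqb_sym m n).
  replace (Nat.eqb m 0 || Nat.eqb n 0)%bool with (Nat.eqb n 0 || Nat.eqb m 0)%bool
    by apply orb_comm.
  destruct (_ || _)%bool; [reflexivity|].
  unfold rhs; rewrite (IH n m), (IH (S n) m), (IH (pred n) m), (IH n (S m)), (IH n (pred m)).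
  ring.
Qed.

Lemma is_series_exp (x : R) : is_series (fun n => x ^ n / INR (fact n)) (exp x).
Proof.
  apply (is_series_ext (fun n => scal (pow_n x n) (/ INR (fact n))));
    [|exact (is_exp_Reals x)].
  intros n; rewrite pow_n_pow; reflexivity.
Qed.

(** One term of a series of nonnegative terms. It serves the convergence radius here and, inverted,
    the comparison of exponential with polynomial decay in the Gaussian moments. *)
Lemma pow_div_fact_le_exp (x : R) (n : nat) : 0 <= x -> x ^ n / INR (fact n) <= exp x.
Proof.
  intros Hx.
  assert (Hp : forall k, 0 <= x ^ k / INR (fact k)).
  { intros k; apply Rdiv_le_0_compat; [apply pow_le, Hx|apply INR_fact_lt_0]. }
  assert (Hs : forall k, 0 <= sum_n (fun n => x ^ n / INR (fact n)) k).
  { induction k as [|k IH]; [rewrite sum_O|rewrite sum_Sn]; [apply Hp|].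
    apply Rplus_le_le_0_compat; [exact IH|apply Hp]. }
  apply Rle_trans with (sum_n (fun n => x ^ n / INR (fact n)) n).
  - destruct n as [|n]; [rewrite sum_O; lra|rewrite sum_Sn].
    change plus with Rplus; specialize (Hs n); lra.
  - apply (is_lim_seq_incr_compare (sum_n (fun n => x ^ n / INR (fact n))));
      [exact (is_series_exp x)|].
    intros k; rewrite sum_Sn; change plus with Rplus; specialize (Hp (S k)); lra.
Qed.

(** The iterates grow at most like [4 ^ j] against [j!], so the terms of the series stay bounded at
    the radius [Rabs x + 1]. *)
Lemma semigroup_CV_radius (kappa : R) (a : nat -> nat -> R) (M x : R) (m n : nat) :
  0 < kappa -> (forall m n, Rabs (a m n) <= M) ->
  Rbar_lt (Rabs x) (CV_radius (fun j => iter_step kappa a j m n / INR (fact j))).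
Proof.
  intros hk HM.
  apply Rbar_lt_le_trans with (Rabs x + 1); [simpl; lra|].
  apply (proj1 (CV_radius_bounded _)).
  exists (M * exp (4 * (Rabs x + 1))); intros j.
  pose proof (Rabs_pos x); pose proof (INR_fact_lt_0 j).
  unfold Rdiv; rewrite !Rabs_mult, (Rabs_pos_eq (/ _)), (Rabs_pos_eq (_ ^ j)).
  2: apply pow_le; lra.
  2: apply Rlt_le, Rinv_0_lt_compat; lra.
  pose proof (iter_step_abs_le kappa a M j m n hk HM) as HI.
  pose proof (pow_div_fact_le_exp (4 * (Rabs x + 1)) j ltac:(lra)) as HE.
  assert (0 <= M) by (apply Rle_trans with (2 := HM O O), Rabs_pos).
  apply Rle_trans with (M * ((4 * (Rabs x + 1)) ^ j / INR (fact j))).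
  - rewrite Rpow_mult_distr; unfold Rdiv.
    apply Rle_trans with ((M * 4 ^ j) * / INR (fact j) * (Rabs x + 1) ^ j); [|right; ring].
    apply Rmult_le_compat_r; [apply pow_le; lra|].
    apply Rmult_le_compat_r; [apply Rlt_le, Rinv_0_lt_compat; lra|exact HI].
  - apply Rmult_le_compat_l; assumption.
Qed.

Lemma semigroup_is_series (kappa : R) (a : nat -> nat -> R) (M t : R) (m n : nat) :
  0 < kappa -> (forall m n, Rabs (a m n) <= M) ->
  is_series (fun j => iter_step kappa a j m n * (t ^ j / INR (fact j)))
    (semigroup kappa a m n t).
Proof.
  intros hk HM.
  pose proof (PSeries_correct _ _ (CV_radius_inside _ _
    (semigroup_CV_radius kappa a M t m n hk HM))) as H.
  eapply is_series_ext; [|exact H].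
  intros j; simpl; rewrite pow_n_pow; unfold scal; simpl; unfold mult; simpl.
  field; apply INR_fact_neq_0.
Qed.

(** Termwise domination by the exponential series. What matters later is that the bound depends on
    the data only through [M], hence not on where the data are truncated. *)
Lemma semigroup_abs_le (kappa : R) (a : nat -> nat -> R) (M t : R) (m n : nat) :
  0 < kappa -> (forall m n, Rabs (a m n) <= M) -> 0 <= t ->
  Rabs (semigroup kappa a m n t) <= M * exp (4 * t).
Proof.
  intros hk HM Ht.
  rewrite <- (is_series_unique _ _ (semigroup_is_series kappa a M t m n hk HM)).
  assert (Hx : is_series (fun j => M * ((4 * t) ^ j / INR (fact j))) (M * exp (4 * t)))
    by exact (is_series_scal M _ _ (is_series_exp (4 * t))).
  rewrite <- (is_series_unique _ _ Hx).
  assert (Hle : forall j, 0 <= Rabs (iter_step kappa a j m n * (t ^ j / INR (fact j)))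
                   <= M * ((4 * t) ^ j / INR (fact j))).
  { intros j; split; [apply Rabs_pos|].
    assert (Hp : 0 <= t ^ j / INR (fact j))
      by (apply Rdiv_le_0_compat; [apply pow_le, Ht|apply INR_fact_lt_0]).
    rewrite Rabs_mult, (Rabs_pos_eq _ Hp), Rpow_mult_distr.
    apply Rle_trans with (M * 4 ^ j * (t ^ j / INR (fact j))); [|right; unfold Rdiv; ring].
    apply Rmult_le_compat_r; [exact Hp|]; apply iter_step_abs_le; assumption. }
  apply Rle_trans with (1 := Series_Rabs _ (ex_series_le
    (V := RCV)
    (fun j => Rabs (iter_step kappa a j m n * (t ^ j / INR (fact j)))) _
    (fun j => Rle_trans _ _ _ (Req_le _ _ (Rabs_Rabsolu _)) (proj2 (Hle j)))
    (ex_intro _ _ Hx))).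
  apply Series_le; [exact Hle|eexists; exact Hx].
Qed.

(** Differentiating the power series shifts the iterates by one, and [rhs] involves only five
    entries, so it commutes with the sum. *)
Lemma semigroup_derive (kappa : R) (a : nat -> nat -> R) (M t : R) (m n : nat) :
  0 < kappa -> (forall m n, Rabs (a m n) <= M) ->
  (1 <= m)%nat -> (1 <= n)%nat -> m <> n ->
  is_derive (semigroup kappa a m n) t (rhs kappa (fun i j => semigroup kappa a i j t) m n).
Proof.
  intros hk HM Hm Hn Hmn.
  pose proof (is_derive_PSeries _ _ (semigroup_CV_radius kappa a M t m n hk HM)) as H.
  match type of H with is_derive _ _ ?l =>
    replace (rhs kappa (fun i j => semigroup kappa a i j t) m n) with l; [exact H|] end.
  apply is_series_unique.
  assert (HS := fun i j => semigroup_is_series kappa a M t i j hk HM).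
  pose proof (is_series_plus _ _ _ _ (is_series_plus _ _ _ _
    (is_series_scal (-2) _ _ (HS m n))
    (is_series_scal (gam kappa m / 2) _ _ (is_series_plus _ _ _ _ (HS (S m) n) (HS (pred m) n))))
    (is_series_scal (gam kappa n / 2) _ _ (is_series_plus _ _ _ _ (HS m (S n)) (HS m (pred n)))))
    as HT.
  eapply is_series_ext; [|exact HT].
  intros j; unfold PS_derive; simpl iter_step; rewrite step_interior by assumption.
  unfold rhs, plus, scal; simpl AbelianMonoid.sort; simpl.
  unfold plus, scal, mult; simpl; unfold mult; simpl.
  change (match j with O => 1 | S _ => INR j + 1 end) with (INR (S j)).
  change (fact j + j * fact j)%nat with (fact (S j)).
  rewrite fact_simpl, mult_INR; field.
  split; [apply INR_fact_neq_0|apply not_0_INR; lia].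
Qed.

Lemma semigroup_0 (kappa : R) (a : nat -> nat -> R) (m n : nat) :
  semigroup kappa a m n 0 = a m n.
Proof. unfold semigroup; rewrite PSeries_0; simpl; field. Qed.

Lemma semigroup_boundary (kappa : R) (a : nat -> nat -> R) (m n : nat) (t : R) :
  off_boundary a -> m = O \/ n = O \/ m = n -> semigroup kappa a m n t = 0.
Proof.
  intros Ha H; unfold semigroup.
  rewrite (PSeries_ext _ (fun _ => 0)); [apply PSeries_const_0|].
  intros j; rewrite (iter_step_boundary kappa a j Ha m n H); unfold Rdiv; ring.
Qed.

Lemma semigroup_continuous (kappa : R) (a : nat -> nat -> R) (M : R) (m n : nat) :
  0 < kappa -> (forall m n, Rabs (a m n) <= M) ->
  filterlim (semigroup kappa a m n) (at_right 0) (locally (semigroup kappa a m n 0)).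
Proof.
  intros hk HM; eapply filterlim_filter_le_1; [apply filter_le_within|].
  apply (ex_derive_continuous (V := RV)).
  eexists; apply (is_derive_PSeries _ _ (semigroup_CV_radius kappa a M 0 m n hk HM)).
Qed.

Lemma semigroup_lattice_eq (kappa : R) (a : nat -> nat -> R) (M : R) :
  0 < kappa -> (forall m n, Rabs (a m n) <= M) -> off_boundary a ->
  (forall m n, a m n = a n m) -> lattice_eq kappa (semigroup kappa a).
Proof.
  intros hk HM Ha Hs; refine (conj (conj _ _) (conj _ (conj _ (conj _ _)))).
  - intros m n; apply (semigroup_continuous kappa a M); assumption.
  - intros T HT; exists (M * exp (4 * T)); intros m n t Ht.
    apply Rle_trans with (1 := semigroup_abs_le kappa a M t m n hk HM (proj1 Ht)).
    apply Rmult_le_compat_l; [apply Rle_trans with (2 := HM O O), Rabs_pos|].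
    apply exp_monotone; lra.
  - intros; apply (semigroup_derive kappa a M); assumption.
  - intros; apply semigroup_boundary; auto.
  - intros; apply semigroup_boundary; auto.
  - intros m n t _; unfold semigroup; apply PSeries_ext; intros j.
    rewrite (iter_step_sym kappa a j Hs m n); reflexivity.
Qed.

(** * A maximum principle for stationary arrays *)

Lemma gam_incr (kappa : R) (m n : nat) :
  0 < kappa -> (m <= n)%nat -> gam kappa m <= gam kappa n.
Proof.
  intros hk Hmn; rewrite !gam_qpar.
  pose proof (qpar_bounds _ hk) as Hq.
  pose proof (pow_bounds_01 _ m Hq); pose proof (pow_bounds_01 _ n Hq).
  assert (qpar kappa ^ n <= qpar kappa ^ m).
  { replace n with (m + (n - m))%nat by lia; rewrite pow_add.
    pose proof (pow_bounds_01 _ (n - m) Hq); nra. }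
  apply (Rmult_le_reg_r ((1 + qpar kappa ^ m) * (1 + qpar kappa ^ n))); [nra|].
  field_simplify; nra.
Qed.

(* Comparison with the barrier [eps (m + n)]: linear functions are superharmonic because
   [gam < 1]. On the box where the barrier is below the bound, the equation contracts by
   [gam kappa K < 1]. *)
Lemma bounded_harmonic_nonpos (kappa : R) (d : nat -> nat -> R) (B : R) :
  0 < kappa -> (forall m n, Rabs (d m n) <= B) -> off_boundary d ->
  (forall m n, (1 <= m)%nat -> (1 <= n)%nat -> m <> n -> rhs kappa d m n = 0) ->
  forall m n, d m n <= 0.
Proof.
  intros hk HB Hd Hh.
  assert (HB0 : 0 <= B) by (apply Rle_trans with (2 := HB O O), Rabs_pos).
  assert (Heps : forall eps, 0 < eps -> forall m n, d m n <= eps * (INR m + INR n)).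
  { intros eps Heps.
    (* As soon as one index exceeds [K], the barrier [eps (m + n)] exceeds [B] and the claim is
       immediate. *)
    destruct (nfloor_ex (B / eps)) as [K0 [_ HK]]; [apply Rdiv_le_0_compat; lra|].
    rewrite <- S_INR in HK; set (K := S K0) in *.
    apply (Rmult_lt_compat_r eps) in HK; [|lra].
    unfold Rdiv in HK; rewrite Rmult_assoc, Rinv_l, Rmult_1_r in HK by lra.
    pose proof (gam_bounds kappa K hk) as HgK.
    assert (Hj : forall j m n, d m n - eps * (INR m + INR n) <= gam kappa K ^ j * B).
    { induction j as [|j IH]; intros m n;
        pose proof (pos_INR m) as Pm; pose proof (pos_INR n) as Pn.
      - simpl; pose proof (proj1 (Rabs_le_between _ _) (HB m n)); nra.
      - assert (HC : 0 <= gam kappa K ^ j * B)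
          by (apply Rmult_le_pos; [apply pow_le|]; lra).
        assert (HC' : 0 <= gam kappa K ^ S j * B)
          by (apply Rmult_le_pos; [apply pow_le|]; lra).
        destruct (boundary_dec m n) as [Hmn|Hmn]; [rewrite Hd by exact Hmn; nra|].
        destruct (le_lt_dec m K) as [HmK|HmK]; [destruct (le_lt_dec n K) as [HnK|HnK]|].
        2: pose proof (proj1 (Rabs_le_between _ _) (HB m n)); apply lt_INR in HnK; nra.
        2: pose proof (proj1 (Rabs_le_between _ _) (HB m n)); apply lt_INR in HmK; nra.
        specialize (Hh m n ltac:(lia) ltac:(lia) ltac:(lia)); unfold rhs in Hh.
        destruct m as [|m]; [lia|]; destruct n as [|n]; [lia|].
        pose proof (IH (S (S m)) (S n)) as I1; pose proof (IH m (S n)) as I2.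
        pose proof (IH (S m) (S (S n))) as I3; pose proof (IH (S m) n) as I4.
        pose proof (gam_incr kappa _ _ hk HmK) as GmK.
        pose proof (gam_incr kappa _ _ hk HnK) as GnK.
        pose proof (gam_bounds kappa (S m) hk) as Gm.
        pose proof (gam_bounds kappa (S n) hk) as Gn.
        simpl pred in Hh; rewrite ?S_INR in *; simpl pow.
        set (C := gam kappa K ^ j * B) in *.
        replace (gam kappa K * gam kappa K ^ j * B) with (gam kappa K * C)
          by (unfold C; ring).
        set (u := d (S (S m)) (S n) + d m (S n)) in *.
        set (v := d (S m) (S (S n)) + d (S m) n) in *.
        set (z := eps * (INR m + 1 + (INR n + 1))) in *.
        assert (Hz : 0 <= z) by (unfold z; nra).
        assert (Hu : u <= 2 * (C + z)) by (unfold u, z; lra).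
        assert (Hv : v <= 2 * (C + z)) by (unfold v, z; lra).
        assert (gam kappa (S m) / 2 * u <= gam kappa (S m) * (C + z)) by nra.
        assert (gam kappa (S n) / 2 * v <= gam kappa (S n) * (C + z)) by nra.
        assert (gam kappa (S m) * z <= z) by nra.
        assert (gam kappa (S n) * z <= z) by nra.
        assert (gam kappa (S m) * C <= gam kappa K * C) by nra.
        assert (gam kappa (S n) * C <= gam kappa K * C) by nra.
        lra. }
    intros m n.
    assert (Hl : is_lim_seq (fun j => gam kappa K ^ j * B) (0 * B)).
    { apply (is_lim_seq_scal_r _ B 0), is_lim_seq_geom; rewrite Rabs_pos_eq; lra. }
    rewrite Rmult_0_l in Hl.
    pose proof (is_lim_seq_le _ _ (d m n - eps * (INR m + INR n)) 0 (fun j => Hj j m n)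
      (is_lim_seq_const _) Hl) as H.
    simpl in H; lra. }
  intros m n; apply Rnot_lt_le; intros Hlt.
  pose proof (pos_INR m); pose proof (pos_INR n).
  (* With this [eps] the bound reads [d m n <= d m n (m + n) / (2 (m + n + 1))], impossible for a
     positive value. *)
  specialize (Heps (d m n / (2 * (INR m + INR n + 1)))
    ltac:(apply Rdiv_lt_0_compat; lra) m n).
  apply (Rmult_le_compat_r (2 * (INR m + INR n + 1))) in Heps; [|lra].
  replace (d m n / (2 * (INR m + INR n + 1)) * (INR m + INR n) * (2 * (INR m + INR n + 1)))
    with (d m n * (INR m + INR n)) in Heps by (field; lra).
  nra.
Qed.

(** The difference of [rho] and its transpose is bounded, stationary and zero on the axes and the
    diagonal, hence nonpositive; exchanging the indices gives equality. This makes [rho] admissible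
    for [lattice_eq], which demands symmetry. *)
Lemma stationary_sym (kappa : R) (rho : nat -> nat -> R) :
  0 < kappa -> stationary kappa rho -> forall m n, rho m n = rho n m.
Proof.
  intros hk [[M HM] [Hh [H1 [H2 H3]]]].
  assert (Hle : forall m n, rho m n - rho n m <= 0).
  { apply (bounded_harmonic_nonpos kappa (fun m n => rho m n - rho n m) (M + M) hk).
    - intros m n; unfold Rminus; apply Rle_trans with (1 := Rabs_triang _ _).
      rewrite Rabs_Ropp; apply Rplus_le_compat; apply HM.
    - intros m n [-> | [-> | ->]]; rewrite ?H2, ?H3; ring.
    - intros m n Hm Hn Hmn.
      pose proof (Hh m n Hm Hn Hmn) as E1; pose proof (Hh n m Hn Hm (not_eq_sym Hmn)) as E2.
      unfold rhs in *; lra. }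
  intros m n; apply Rle_antisym; [specialize (Hle m n)|specialize (Hle n m)]; lra.
Qed.

(** * Superposition *)

Lemma sumR_ext (f g : nat -> R) (N : nat) :
  (forall k, (k < N)%nat -> f k = g k) -> sumR f N = sumR g N.
Proof.
  induction N as [|N IH]; intros H; [reflexivity|].
  simpl; rewrite IH by (intros; apply H; lia); rewrite H by lia; reflexivity.
Qed.

Lemma sumR_zero (f : nat -> R) (N : nat) :
  (forall k, (k < N)%nat -> f k = 0) -> sumR f N = 0.
Proof.
  induction N as [|N IH]; intros H; [reflexivity|].
  simpl; rewrite IH, H by (intros; try apply H; lia); ring.
Qed.

Lemma sumR_single (f : nat -> R) (i N : nat) :
  (i < N)%nat -> (forall k, (k < N)%nat -> k <> i -> f k = 0) -> sumR f N = f i.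
Proof.
  induction N as [|N IH]; intros Hi H; [lia|]; simpl.
  destruct (Nat.eq_dec i N) as [->|].
  - rewrite sumR_zero by (intros; apply H; lia); ring.
  - rewrite IH, (H N) by (try intros; try apply H; lia); ring.
Qed.

Lemma sum_n_sumR (f : nat -> R) (N : nat) : sum_n f N = sumR f (S N).
Proof.
  induction N as [|N IH]; [rewrite sum_O; simpl; ring|].
  rewrite sum_Sn, IH; reflexivity.
Qed.

Lemma is_series_sumR (f : nat -> R) (l : R) :
  is_lim_seq (sumR f) l -> is_series f l.
Proof.
  intros H; apply (is_lim_seq_ext (fun N => sumR f (S N)) (sum_n f) l).
  - intros N; symmetry; apply sum_n_sumR.
  - apply (is_lim_seq_incr_1 (sumR f)), H.
Qed.

(** The pairs are [k < N] and [l = S j] with [j < k - 1], that is [1 <= l < k]; truncated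
    subtraction leaves nothing for [k = 0] and [k = 1]. *)
Definition kl_sum (F : nat -> nat -> nat -> nat -> R -> R) (b : nat -> nat -> R)
  (N m n : nat) (t : R) : R :=
  sumR (fun k => sumR (fun j => F k (S j) m n t * b k (S j)) (k - 1)) N.

(** The symmetric extension of the entries of [b] below the diagonal, cut off at index [N]: these
    are the initial values of [kl_sum]. *)
Definition truncate (b : nat -> nat -> R) (N m n : nat) : R :=
  if (Nat.eqb m 0 || Nat.eqb n 0 || Nat.eqb m n || Nat.leb N (Nat.max m n))%bool then 0
  else b (Nat.max m n) (Nat.min m n).

Lemma truncate_abs_le (b : nat -> nat -> R) (M : R) (N m n : nat) :
  0 <= M -> (forall k l, (1 <= l)%nat -> (l < k)%nat -> Rabs (b k l) <= M) ->
  Rabs (truncate b N m n) <= M.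
Proof.
  intros HM Hb; unfold truncate.
  destruct (Nat.eqb_spec m 0); [simpl; rewrite Rabs_R0; exact HM|].
  destruct (Nat.eqb_spec n 0); [simpl; rewrite Rabs_R0; exact HM|].
  destruct (Nat.eqb_spec m n); [simpl; rewrite Rabs_R0; exact HM|].
  destruct (Nat.leb_spec N (Nat.max m n)); simpl; [rewrite Rabs_R0; exact HM|].
  apply Hb; lia.
Qed.

Lemma truncate_boundary (b : nat -> nat -> R) (N : nat) : off_boundary (truncate b N).
Proof.
  intros m n H; unfold truncate.
  destruct (Nat.eqb_spec m 0); [reflexivity|].
  destruct (Nat.eqb_spec n 0); [reflexivity|].
  destruct (Nat.eqb_spec m n); [reflexivity|lia].
Qed.

Lemma truncate_sym (b : nat -> nat -> R) (N m n : nat) : truncate b N m n = truncate b N n m.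
Proof.
  unfold truncate; rewrite Nat.max_comm, Nat.min_comm, (Nat.eqb_sym m n).
  rewrite (orb_comm (Nat.eqb m 0)); reflexivity.
Qed.

Lemma solves_kl_flow (kappa : R) (k l : nat) (f : nat -> nat -> R -> R) :
  solves_kl kappa k l f -> growth_flow kappa f.
Proof. intros [H1 [H2 _]]; apply lattice_eq_growth_flow; assumption. Qed.

Lemma kl_sum_flow (kappa : R) (F : nat -> nat -> nat -> nat -> R -> R)
  (b : nat -> nat -> R) (N : nat) :
  (forall k l, (1 <= l)%nat -> (l < k)%nat -> solves_kl kappa k l (F k l)) ->
  growth_flow kappa (kl_sum F b N).
Proof.
  intros HF.
  apply (growth_flow_sumR kappa
    (fun k m n t => sumR (fun j => F k (S j) m n t * b k (S j)) (k - 1))).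
  intros k _.
  apply (growth_flow_sumR kappa (fun j m n t => F k (S j) m n t * b k (S j))).
  intros j Hj; apply growth_flow_scal, (solves_kl_flow kappa k (S j)), HF; lia.
Qed.

(** For [m > n] the kernels start as delta functions, so both sums collapse to one term; the other
    half follows from the symmetry of each kernel. *)
Lemma kl_sum_initial (kappa : R) (F : nat -> nat -> nat -> nat -> R -> R)
  (b : nat -> nat -> R) (N m n : nat) :
  (forall k l, (1 <= l)%nat -> (l < k)%nat -> solves_kl kappa k l (F k l)) ->
  kl_sum F b N m n 0 = truncate b N m n.
Proof.
  intros HF.
  assert (Hlow : forall m n, (1 <= n)%nat -> (n < m)%nat ->
    kl_sum F b N m n 0 = truncate b N m n).
  { clear m n; intros m n Hn Hm.
    assert (HF0 : forall k j, (j < k - 1)%nat -> F k (S j) m n 0 =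
      if (Nat.eqb m k && Nat.eqb n (S j))%bool then 1 else 0).
    { intros k j Hj; apply (HF k (S j)); lia. }
    assert (Hz : forall k, k <> m ->
      sumR (fun j => F k (S j) m n 0 * b k (S j)) (k - 1) = 0).
    { intros k Hk; apply sumR_zero; intros j Hj; rewrite HF0 by exact Hj.
      destruct (Nat.eqb_spec m k); [lia|simpl; ring]. }
    unfold truncate, kl_sum; rewrite Nat.max_l, Nat.min_r by lia.
    destruct (Nat.eqb_spec m 0); [lia|]; destruct (Nat.eqb_spec n 0); [lia|].
    destruct (Nat.eqb_spec m n); [lia|]; simpl orb.
    destruct (Nat.leb_spec N m) as [HN|HN].
    - apply sumR_zero; intros k Hk; apply Hz; lia.
    - rewrite (sumR_single _ m N HN) by (intros; apply Hz; lia).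
      rewrite (sumR_single _ (n - 1) (m - 1)); [|lia|].
      2:{ intros j Hj Hjn; rewrite HF0 by exact Hj.
          destruct (Nat.eqb_spec n (S j)); [lia|rewrite andb_false_r; ring]. }
      rewrite HF0 by lia; replace (S (n - 1)) with n by lia.
      rewrite !Nat.eqb_refl; simpl; ring. }
  destruct (boundary_dec m n) as [Hmn|Hmn].
  { rewrite truncate_boundary by exact Hmn; apply (kl_sum_flow kappa F b N HF); auto; lra. }
  destruct (lt_dec n m) as [H|H]; [apply Hlow; lia|].
  rewrite truncate_sym, <- Hlow by lia.
  apply sumR_ext; intros k Hk; apply sumR_ext; intros j Hj; f_equal.
  destruct (HF k (S j) ltac:(lia) ltac:(lia)) as [[_ [_ [_ [_ Hs]]]] _].
  apply Hs; lra.
Qed.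

(** By uniqueness the finite superposition is the semigroup applied to the truncated data, whose
    bound does not involve [N]. *)
Lemma kl_sum_abs_le (kappa : R) (F : nat -> nat -> nat -> nat -> R -> R)
  (b : nat -> nat -> R) (M : R) (N m n : nat) (t : R) :
  0 < kappa -> 0 <= M -> 0 <= t ->
  (forall k l, (1 <= l)%nat -> (l < k)%nat -> Rabs (b k l) <= M) ->
  (forall k l, (1 <= l)%nat -> (l < k)%nat -> solves_kl kappa k l (F k l)) ->
  Rabs (kl_sum F b N m n t) <= M * exp (4 * t).
Proof.
  intros hk HM Ht Hb HF.
  assert (HbN := fun m n => truncate_abs_le b M N m n HM Hb).
  assert (HE : growth_flow kappa (semigroup kappa (truncate b N))).
  { apply lattice_eq_growth_flow.
    - apply (semigroup_lattice_eq kappa _ M); auto using truncate_boundary, truncate_sym.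
    - intros; apply semigroup_boundary; auto using truncate_boundary. }
  pose proof (growth_flow_zero kappa _ hk
    (growth_flow_minus kappa _ _ (kl_sum_flow kappa F b N HF) HE)) as H0.
  replace (kl_sum F b N m n t) with (semigroup kappa (truncate b N) m n t).
  - apply semigroup_abs_le; assumption.
  - symmetry; apply Rminus_diag_uniq, H0; [|exact Ht].
    intros i j; rewrite (kl_sum_initial kappa), semigroup_0 by exact HF; ring.
Qed.

(** The preceding bound holds for all data of size at most [M], so at fixed [m], [n], [t] one may
    choose their signs: the partial sums of absolute values are themselves superpositions bounded by
    [M exp (4 t)]. *)
Lemma kl_series_abs_conv (kappa : R) (F : nat -> nat -> nat -> nat -> R -> R)
  (b : nat -> nat -> R) (M : R) (m n : nat) (t : R) :
  0 < kappa -> 0 <= M -> 0 <= t ->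
  (forall k l, (1 <= l)%nat -> (l < k)%nat -> Rabs (b k l) <= M) ->
  (forall k l, (1 <= l)%nat -> (l < k)%nat -> solves_kl kappa k l (F k l)) ->
  ex_series (fun k => sumR (fun j => Rabs (F k (S j) m n t * b k (S j))) (k - 1)).
Proof.
  intros hk HM Ht Hb HF.
  (* flip the sign of the data so that every term becomes nonnegative *)
  set (b' := fun k l => (if Rle_dec 0 (F k l m n t * b k l) then 1 else -1) * b k l).
  assert (Hb' : forall k l, (1 <= l)%nat -> (l < k)%nat -> Rabs (b' k l) <= M).
  { intros k l Hl Hk; apply Rle_trans with (2 := Hb k l Hl Hk); unfold b'; right.
    destruct (Rle_dec 0 _); rewrite Rabs_mult; [rewrite Rabs_R1|rewrite Rabs_m1]; ring. }
  assert (Heq : forall k j, Rabs (F k (S j) m n t * b k (S j)) = F k (S j) m n t * b' k (S j)).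
  { intros k j; unfold b'; destruct (Rle_dec 0 _);
      [rewrite Rabs_pos_eq by assumption|rewrite Rabs_left by lra]; ring. }
  assert (Hex : ex_finite_lim_seq
    (sumR (fun k => sumR (fun j => Rabs (F k (S j) m n t * b k (S j))) (k - 1)))).
  { apply (ex_finite_lim_seq_incr _ (M * exp (4 * t))).
    - intros N; simpl.
      assert (0 <= sumR (fun j => Rabs (F N (S j) m n t * b N (S j))) (N - 1)).
      { generalize (N - 1)%nat; induction n0 as [|p IH]; simpl; [lra|].
        pose proof (Rabs_pos (F N (S p) m n t * b N (S p))); lra. }
      lra.
    - intros N.
      apply Rle_trans with (2 := kl_sum_abs_le kappa F b' M N m n t hk HM Ht Hb' HF).
      apply Rle_trans with (2 := Rle_abs _); right; unfold kl_sum.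
      apply sumR_ext; intros k _; apply sumR_ext; intros j _; apply Heq. }
  destruct Hex as [l Hl]; exists l; apply is_series_sumR, Hl.
Qed.

(** The solution minus a partial sum vanishes initially on a large box, so finite propagation makes
    it factorially small at any fixed site. *)
Lemma kl_series_solution (kappa : R) (F : nat -> nat -> nat -> nat -> R -> R)
  (b : nat -> nat -> R) (d : nat -> nat -> R -> R) (M : R) (m n : nat) (t : R) :
  0 < kappa -> 0 <= M -> 0 <= t ->
  (forall k l, (1 <= l)%nat -> (l < k)%nat -> Rabs (b k l) <= M) ->
  (forall k l, (1 <= l)%nat -> (l < k)%nat -> solves_kl kappa k l (F k l)) ->
  growth_flow kappa d -> (forall m n t, 0 <= t -> d m n t = d n m t) ->
  (forall k l, (1 <= l)%nat -> (l < k)%nat -> d k l 0 = b k l) ->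
  is_series (fun k => sumR (fun j => F k (S j) m n t * b k (S j)) (k - 1)) (d m n t).
Proof.
  intros hk HM Ht Hb HF Hd Hsym Hinit.
  apply is_series_sumR; change (is_lim_seq (fun N => kl_sum F b N m n t) (d m n t)).
  destruct (proj2 (proj2 (proj2 Hd)) t Ht) as [M1 HM1].
  set (M2 := Rmax M1 0 + M * exp (4 * t)).
  assert (HM2 : 0 <= M2).
  { unfold M2; pose proof (Rmax_r M1 0).
    pose proof (Rmult_le_pos _ _ HM (Rlt_le _ _ (exp_pos (4 * t)))); lra. }
  assert (Hdiff : forall N,
    Rabs (d m n t - kl_sum F b (N + (m + n + 1)) m n t)
    <= M2 * ((4 * t) ^ N / INR (fact N)) * weight m n).
  (* This side leaves at least [N] steps between [(m, n)] and the outside of the box. *)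
  { intros N; set (N' := (N + (m + n + 1))%nat).
    apply (growth_flow_local_bound kappa (fun m n t => d m n t - kl_sum F b N' m n t) t M2 N');
      try assumption; try (unfold N'; lia); try lra.
    - apply growth_flow_minus, kl_sum_flow; assumption.
    - intros i j s Hs; pose proof (weight_ge_1 i j) as Hw.
      apply Rle_trans with (Rabs (d i j s) + Rabs (kl_sum F b N' i j s)).
      { unfold Rminus; apply Rle_trans with (1 := Rabs_triang _ _).
        rewrite Rabs_Ropp; lra. }
      pose proof (HM1 i j s Hs) as H1.
      pose proof (kl_sum_abs_le kappa F b M N' i j s hk HM (proj1 Hs) Hb HF) as H2.
      assert (H3 : exp (4 * s) <= exp (4 * t)) by (apply exp_monotone; lra).
      pose proof (Rmult_le_compat_l M _ _ HM H3) as H4.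
      pose proof (Rmult_le_pos _ _ HM (Rlt_le _ _ (exp_pos (4 * t)))) as H5.
      pose proof (Rmax_l M1 0); pose proof (Rmax_r M1 0).
      assert (M1 * weight i j <= Rmax M1 0 * weight i j) by nra.
      assert (M * exp (4 * t) <= M * exp (4 * t) * weight i j) by nra.
      unfold M2; lra.
    - intros i j Hi Hj; rewrite (kl_sum_initial kappa) by exact HF.
      destruct (boundary_dec i j) as [Hij|Hij].
      { rewrite truncate_boundary, (proj1 (proj2 (proj2 Hd))) by (auto; lra); ring. }
      unfold truncate.
      destruct (Nat.eqb_spec i 0), (Nat.eqb_spec j 0), (Nat.eqb_spec i j); try lia.
      destruct (Nat.leb_spec N' (Nat.max i j)); [lia|simpl].
      destruct (lt_dec j i).
      + rewrite Nat.max_l, Nat.min_r, Hinit by lia; ring.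
      + rewrite Nat.max_r, Nat.min_l, Hsym, Hinit by (lia || lra); ring. }
  apply (is_lim_seq_incr_n _ (m + n + 1)).
  assert (Hl : is_lim_seq (fun N => (4 * t) ^ N / INR (fact N) * (M2 * weight m n))
                 (0 * (M2 * weight m n))) by apply (is_lim_seq_scal_r _ _ 0), pow_div_fact_lim.
  rewrite Rmult_0_l in Hl.
  apply (is_lim_seq_ext (fun N => d m n t - (d m n t - kl_sum F b (N + (m + n + 1)) m n t)));
    [intros; ring|].
  replace (Finite (d m n t)) with (Finite (d m n t - 0)) by (f_equal; ring).
  apply is_lim_seq_minus'; [apply is_lim_seq_const|].
  apply is_lim_seq_abs_le_0 with (2 := Hl).
  intros N; specialize (Hdiff N); lra.
Qed.

(** * The Rogers polynomials *)

(** The values [gam kappa n] in terms of [q] alone, so that the identities below become rational in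
    powers of [q]. *)
Definition gq (q : R) (n : nat) : R := (1 - q ^ n) / (1 + q ^ n).

(** By the q-binomial theorem, the Taylor coefficients of [(- q z; q)_oo / (z; q)_oo]. *)
Definition acoef (q : R) (k : nat) : R := qpoch (- q) q k / qpoch q q k.

(* Continuous q-ultraspherical polynomials with parameter [- q], shifted by one in the index so
   that [rogers q 0 = 0] encodes the boundary condition. *)
Definition rogers (q : R) (n : nat) (x : R) : R :=
  sumR (fun k => acoef q k * acoef q (n - 1 - k) * cos ((2 * INR k - INR n + 1) * x)) n.

Lemma gq_pos (q : R) (n : nat) : 0 < q < 1 -> (1 <= n)%nat -> 0 < gq q n.
Proof.
  intros Hq Hn; pose proof (pow_bounds_01 q n Hq); pose proof (pow_lt_1 q n Hq Hn).
  apply Rdiv_lt_0_compat; lra.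
Qed.

Lemma qpoch_q_pos (q : R) (n : nat) : 0 < q < 1 -> 0 < qpoch q q n.
Proof.
  intros Hq; induction n as [|n IH]; simpl; [lra|].
  apply Rmult_lt_0_compat; [exact IH|].
  pose proof (pow_lt_1 q (S n) Hq ltac:(lia)); simpl in *; lra.
Qed.

Lemma qpoch_mq_pos (q : R) (n : nat) : 0 < q < 1 -> 0 < qpoch (- q) q n.
Proof.
  intros Hq; induction n as [|n IH]; simpl; [lra|].
  apply Rmult_lt_0_compat; [exact IH|].
  pose proof (pow_bounds_01 q n Hq); nra.
Qed.

Lemma acoef_pos (q : R) (n : nat) : 0 < q < 1 -> 0 < acoef q n.
Proof.
  intros Hq; apply Rdiv_lt_0_compat; [apply qpoch_mq_pos|apply qpoch_q_pos]; exact Hq.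
Qed.

Lemma acoef_0 (q : R) : acoef q 0 = 1.
Proof. unfold acoef; simpl; field. Qed.

Lemma acoef_S (q : R) (n : nat) :
  0 < q < 1 -> acoef q (S n) = acoef q n * ((1 + q * q ^ n) / (1 - q * q ^ n)).
Proof.
  intros Hq; unfold acoef; simpl.
  pose proof (qpoch_q_pos q n Hq); pose proof (pow_lt_1 q (S n) Hq ltac:(lia)).
  simpl in *; field; split; lra.
Qed.

Lemma acoef_ge_1 (q : R) (n : nat) : 0 < q < 1 -> 1 <= acoef q n.
Proof.
  intros Hq; induction n as [|n IH]; [rewrite acoef_0; lra|].
  rewrite acoef_S by exact Hq.
  pose proof (pow_lt_1 q (S n) Hq ltac:(lia)) as H1; pose proof (pow_bounds_01 q (S n) Hq) as H2.
  simpl in H1, H2; set (x := q * q ^ n) in *.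
  assert (1 <= (1 + x) / (1 - x)).
  { apply (Rmult_le_reg_r (1 - x)); [lra|]; unfold Rdiv; rewrite Rmult_assoc, Rinv_l; lra. }
  nra.
Qed.

Lemma sumR_S_l (f : nat -> R) (n : nat) : sumR f (S n) = f O + sumR (fun k => f (S k)) n.
Proof.
  induction n as [|n IH]; [simpl; ring|].
  change (sumR f (S (S n))) with (sumR f (S n) + f (S n)); rewrite IH; simpl; ring.
Qed.

Lemma sumR_plus (f g : nat -> R) (n : nat) :
  sumR (fun k => f k + g k) n = sumR f n + sumR g n.
Proof. induction n as [|n IH]; simpl; [|rewrite IH]; ring. Qed.

Lemma sumR_scal_l (c : R) (f : nat -> R) (n : nat) :
  sumR (fun k => c * f k) n = c * sumR f n.
Proof. induction n as [|n IH]; simpl; [|rewrite IH]; ring. Qed.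

(* The addition formula of the hyperbolic tangent, in disguise. *)
Lemma acoef_addition (q : R) (i j : nat) : 0 < q < 1 ->
  gq q (S (S (i + j))) * (acoef q (S i) * acoef q (S j) + acoef q i * acoef q j)
  = acoef q i * acoef q (S j) + acoef q (S i) * acoef q j.
Proof.
  intros Hq; rewrite !acoef_S by exact Hq; unfold gq.
  pose proof (pow_lt_1 q (S i) Hq ltac:(lia)); pose proof (pow_lt_1 q (S j) Hq ltac:(lia)).
  pose proof (pow_bounds_01 q i Hq); pose proof (pow_bounds_01 q j Hq).
  replace (q ^ S (S (i + j))) with (q * q ^ i * (q * q ^ j))
    by (simpl; rewrite pow_add; ring).
  simpl in *; field; repeat split; try lra.
  assert (0 < q * q ^ i * (q * q ^ j)) by (repeat apply Rmult_lt_0_compat; lra); lra.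
Qed.

Lemma acoef_gq (q : R) (n : nat) : 0 < q < 1 -> gq q (S n) * acoef q (S n) = acoef q n.
Proof.
  intros Hq; rewrite acoef_S by exact Hq; unfold gq.
  pose proof (pow_lt_1 q (S n) Hq ltac:(lia)); pose proof (pow_bounds_01 q (S n) Hq).
  simpl in *; field; lra.
Qed.

(** Compare coefficients of the cosines: the interior ones agree by [acoef_addition], the two
    extreme ones by [acoef_gq]. *)
Lemma rogers_recurrence (q : R) (n : nat) (x : R) : 0 < q < 1 ->
  gq q (S n) * (rogers q (S (S n)) x + rogers q n x) = 2 * cos x * rogers q (S n) x.
Proof.
  intros Hq.
  (* The frequencies of level [S (S n)]. Level [n] uses them shifted by one, and [2 cos x] times
     level [S n] is the sum of a shifted and an unshifted copy. *)
  set (c := fun k => cos ((2 * INR k - INR n - 1) * x)).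
  assert (E2 : rogers q (S (S n)) x =
    sumR (fun k => acoef q k * acoef q (S n - k) * c k) (S (S n))).
  { apply sumR_ext; intros k Hk; unfold c; f_equal.
    f_equal; rewrite !S_INR; ring. }
  assert (E0 : rogers q n x =
    sumR (fun k => acoef q k * acoef q (n - 1 - k) * c (S k)) n).
  { apply sumR_ext; intros k Hk; unfold c; f_equal.
    f_equal; rewrite !S_INR; ring. }
  assert (E1 : 2 * cos x * rogers q (S n) x =
    sumR (fun k => acoef q k * acoef q (n - k) * c (S k)) (S n)
    + sumR (fun k => acoef q k * acoef q (n - k) * c k) (S n)).
  { unfold rogers; rewrite <- sumR_scal_l, <- sumR_plus; apply sumR_ext; intros k Hk.
    replace (S n - 1 - k)%nat with (n - k)%nat by lia.
    replace (c (S k)) with (cos ((2 * INR k - INR n) * x + x))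
      by (unfold c; f_equal; rewrite S_INR; ring).
    replace (c k) with (cos ((2 * INR k - INR n) * x - x)) by (unfold c; f_equal; ring).
    replace (2 * INR k - INR (S n) + 1) with (2 * INR k - INR n) by (rewrite S_INR; ring).
    rewrite cos_plus, cos_minus; ring. }
  rewrite E0, E1, E2.
  rewrite (sumR_S_l _ (S n)), (sumR_S_l (fun k => acoef q k * acoef q (n - k) * c k) n).
  change (sumR ?f (S n)) with (sumR f n + f n); cbv beta.
  replace (S n - 0)%nat with (S n) by lia; replace (n - 0)%nat with n by lia.
  replace (S n - S n)%nat with O by lia; replace (n - n)%nat with O by lia.
  assert (Hmid : gq q (S n) * (sumR (fun k => acoef q (S k) * acoef q (S n - S k) * c (S k)) n
      + sumR (fun k => acoef q k * acoef q (n - 1 - k) * c (S k)) n)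
    = sumR (fun k => acoef q k * acoef q (n - k) * c (S k)) n
      + sumR (fun k => acoef q (S k) * acoef q (n - S k) * c (S k)) n).
  { rewrite <- !sumR_plus, <- sumR_scal_l; apply sumR_ext; intros k Hk.
    pose proof (acoef_addition q k (n - 1 - k) Hq) as H.
    replace (S (S (k + (n - 1 - k)))) with (S n) in H by lia.
    replace (S (n - 1 - k)) with (n - k)%nat in H by lia.
    replace (S n - S k)%nat with (n - k)%nat by lia.
    replace (n - S k)%nat with (n - 1 - k)%nat by lia.
    transitivity (gq q (S n) * (acoef q (S k) * acoef q (n - k) + acoef q k * acoef q (n - 1 - k))
      * c (S k)); [ring|rewrite H; ring]. }
  pose proof (acoef_gq q n Hq) as Ha; rewrite acoef_0.
  transitivity ((gq q (S n) * acoef q (S n)) * c O + (gq q (S n) * acoef q (S n)) * c (S n)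
    + gq q (S n) * (sumR (fun k => acoef q (S k) * acoef q (S n - S k) * c (S k)) n
      + sumR (fun k => acoef q k * acoef q (n - 1 - k) * c (S k)) n)); [ring|].
  rewrite Hmid, Ha; ring.
Qed.

Lemma rogers_1 (q x : R) : rogers q 1 x = 1.
Proof.
  unfold rogers; simpl; rewrite acoef_0.
  replace ((2 * 0 - 1 + 1) * x) with 0 by ring; rewrite cos_0; ring.
Qed.

Lemma continuous_sumR (f : nat -> R -> R) (n : nat) (x : R) :
  (forall k, continuous (f k) x) -> continuous (fun y => sumR (fun k => f k y) n) x.
Proof.
  intros H; induction n as [|n IH]; simpl; [apply continuous_const|].
  apply (continuous_plus (fun y => sumR (fun k => f k y) n) (f n)); [exact IH|apply H].
Qed.

Lemma continuous_cos_scal (c x : R) : continuous (fun y => cos (c * y)) x.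
Proof.
  smooth.
Qed.

Lemma continuous_rogers (q : R) (n : nat) (x : R) : continuous (rogers q n) x.
Proof.
  apply (continuous_sumR (fun k y =>
    acoef q k * acoef q (n - 1 - k) * cos ((2 * INR k - INR n + 1) * y))).
  intros k; apply (continuous_scal_r (V := RV)
    (acoef q k * acoef q (n - 1 - k))), continuous_cos_scal.
Qed.

(** The relative increments are geometrically small; both the boundedness of the sequence and its
    rate of convergence rest on this. *)
Lemma acoef_increment (q : R) (n : nat) : 0 < q < 1 ->
  0 <= acoef q (S n) - acoef q n <= acoef q n * (2 / (1 - q) * q ^ n).
Proof.
  intros Hq; rewrite acoef_S by exact Hq.
  pose proof (pow_lt_1 q (S n) Hq ltac:(lia)) as H1.
  pose proof (pow_bounds_01 q n Hq) as H2; pose proof (acoef_pos q n Hq) as Ha.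
  simpl in H1; set (y := q ^ n) in *.
  replace (acoef q n * ((1 + q * y) / (1 - q * y)) - acoef q n)
    with (acoef q n * (2 * (q * y) * / (1 - q * y))) by (field; lra).
  assert (Hi : 0 < / (1 - q * y)) by (apply Rinv_0_lt_compat; lra).
  assert (Hi2 : / (1 - q * y) <= / (1 - q)) by (apply Rinv_le_contravar; nra).
  assert (0 < q * y) by nra.
  split.
  - apply Rmult_le_pos; [lra|]; apply Rmult_le_pos; lra.
  - apply Rmult_le_compat_l; [lra|].
    apply Rle_trans with (2 * (q * y) * / (1 - q)); [apply Rmult_le_compat_l; lra|].
    unfold Rdiv; assert (0 < / (1 - q)) by (apply Rinv_0_lt_compat; lra).
    assert (q * y <= y) by nra; nra.
Qed.

Lemma acoef_bounded (q : R) : 0 < q < 1 -> exists A, forall n, acoef q n <= A.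
Proof.
  intros Hq; set (c := 2 / (1 - q)).
  assert (Hc : 0 < c) by (apply Rdiv_lt_0_compat; lra).
  exists (exp (c / (1 - q))); intros n.
  (* The induction carries the partial geometric sum in the exponent, since the factors are at most
     [1 + c q ^ n <= exp (c q ^ n)]. *)
  apply Rle_trans with (exp (c * (1 - q ^ n) / (1 - q))).
  - induction n as [|n IH].
    + rewrite acoef_0; simpl; replace (c * (1 - 1) / (1 - q)) with 0 by (field; lra).
      rewrite exp_0; lra.
    + pose proof (acoef_increment q n Hq) as H; fold c in H.
      pose proof (acoef_pos q n Hq).
      pose proof (exp_ineq1_le (c * q ^ n)).
      replace (c * (1 - q ^ S n) / (1 - q)) with (c * (1 - q ^ n) / (1 - q) + c * q ^ n)
        by (simpl; field; lra).
      rewrite exp_plus.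
      apply Rle_trans with (acoef q n * (1 + c * q ^ n)); [lra|].
      pose proof (pow_bounds_01 q n Hq).
      apply Rmult_le_compat; nra.
  - pose proof (pow_bounds_01 q n Hq).
    apply exp_monotone, Rmult_le_compat_r; [apply Rlt_le, Rinv_0_lt_compat; lra|nra].
Qed.

Lemma sumR_abs_le (f : nat -> R) (B : R) (n : nat) :
  (forall k, (k < n)%nat -> Rabs (f k) <= B) -> Rabs (sumR f n) <= INR n * B.
Proof.
  induction n as [|n IH]; intros H; [simpl; rewrite Rabs_R0; lra|].
  rewrite S_INR; simpl; apply Rle_trans with (1 := Rabs_triang _ _).
  specialize (IH (fun k Hk => H k ltac:(lia))); specialize (H n ltac:(lia)); lra.
Qed.

(** There are [n] summands with uniformly bounded coefficients. This linear growth is the origin of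
    [weight]. *)
Lemma rogers_abs_le (q : R) : 0 < q < 1 ->
  exists A, 0 <= A /\ forall n x, Rabs (rogers q n x) <= A * INR n.
Proof.
  intros Hq; destruct (acoef_bounded q Hq) as [A HA].
  exists (A * A); split; [nra|]; intros n x; rewrite Rmult_comm.
  apply sumR_abs_le; intros k Hk; rewrite !Rabs_mult.
  pose proof (acoef_pos q k Hq); pose proof (acoef_pos q (n - 1 - k) Hq).
  rewrite (Rabs_pos_eq (acoef q k)), (Rabs_pos_eq (acoef q (n - 1 - k))) by lra.
  pose proof (HA k); pose proof (HA (n - 1 - k)%nat).
  assert (Rabs (cos ((2 * INR k - INR n + 1) * x)) <= 1)
    by (apply Rabs_le, COS_bound).
  pose proof (Rabs_pos (cos ((2 * INR k - INR n + 1) * x))).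
  rewrite <- (Rmult_1_r (A * A)); apply Rmult_le_compat; nra.
Qed.

(** * The orthogonality weight *)

(** Up to a constant factor these are the Fourier coefficients of the classical weight [|(e^(2ix);
    q)_oo / (- q e^(2ix); q)_oo|^2]. Taking the weight by its Fourier series makes the pairing with
    cosines explicit. *)
Definition wcoef (q : R) (j : nat) : R :=
  match j with O => gq q 1 | S i => (-1) ^ j * (gq q (S j) - gq q i) end.

Definition wt (q x : R) : R := Series (fun j => wcoef q j * cos (2 * INR j * x)).

Lemma wcoef_abs_le (q : R) (j : nat) : 0 < q < 1 -> Rabs (wcoef q j) <= 2 / q * q ^ j.
Proof.
  intros Hq; unfold wcoef, gq.
  assert (H2q : 2 / q > 2).
  { apply (Rmult_lt_reg_r q); [lra|]; unfold Rdiv; rewrite Rmult_assoc, Rinv_l; lra. }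
  destruct j as [|i].
  - simpl; rewrite Rmult_1_r, Rabs_pos_eq.
    + apply (Rmult_le_reg_r (1 + q)); [lra|].
      unfold Rdiv; rewrite Rmult_assoc, Rinv_l by lra; nra.
    + apply Rdiv_le_0_compat; lra.
  - rewrite Rabs_mult, pow_1_abs, Rmult_1_l.
    pose proof (pow_bounds_01 q i Hq) as Hi; simpl pow; set (y := q ^ i) in *.
    replace ((1 - q * (q * y)) / (1 + q * (q * y)) - (1 - y) / (1 + y))
      with (2 * y * ((1 - q * q) / ((1 + q * (q * y)) * (1 + y)))).
    2:{ field; split; nra. }
    assert (Hq2 : 0 < q * q < 1) by nra.
    assert (Hd : 1 <= (1 + q * (q * y)) * (1 + y)) by nra.
    assert (Hf : 0 <= (1 - q * q) / ((1 + q * (q * y)) * (1 + y)) <= 1).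
    { split; [apply Rdiv_le_0_compat; lra|].
      apply (Rmult_le_reg_r ((1 + q * (q * y)) * (1 + y))); [lra|].
      unfold Rdiv; rewrite Rmult_assoc, Rinv_l by lra; lra. }
    rewrite Rabs_pos_eq by nra.
    replace (2 / q * (q * y)) with (2 * y) by (field; lra); nra.
Qed.

(** The ratio test asks for nonzero terms, hence [S n] instead of [n] in the polynomial factor. *)
Lemma ex_series_poly_geom (q : R) (p : nat) :
  0 < q < 1 -> ex_series (fun n => INR (S n) ^ p * q ^ n).
Proof.
  intros Hq.
  assert (Hpos : forall n, 0 < INR (S n) ^ p * q ^ n).
  { intros n; apply Rmult_lt_0_compat; apply pow_lt; [apply lt_0_INR; lia|lra]. }
  apply (ex_series_ext (fun n => Rabs (INR (S n) ^ p * q ^ n)));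
    [intros n; apply Rabs_pos_eq, Rlt_le, Hpos|].
  apply (ex_series_DAlembert _ q); [lra|intros n; apply Rgt_not_eq, Hpos|].
  assert (H1 : is_lim_seq (fun n => (1 + / INR (S n))) (1 + 0)).
  { apply is_lim_seq_plus'; [apply is_lim_seq_const|].
    apply (is_lim_seq_incr_1 (fun n => / INR n)).
    replace (Finite 0) with (Rbar_inv p_infty) by reflexivity.
    apply is_lim_seq_inv; [apply is_lim_seq_INR|discriminate]. }
  rewrite Rplus_0_r in H1.
  assert (H2 : is_lim_seq (fun n => (1 + / INR (S n)) ^ p) (1 ^ p)).
  { induction p as [|p IH]; simpl; [apply is_lim_seq_const|].
    apply is_lim_seq_mult'; [exact H1|].
    apply IH; intros n; apply Rmult_lt_0_compat; apply pow_lt; [apply lt_0_INR; lia|lra]. }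
  rewrite pow1 in H2.
  apply (is_lim_seq_ext (fun n => (1 + / INR (S n)) ^ p * q)).
  - intros n.
    rewrite Rabs_pos_eq by (apply Rlt_le, Rdiv_lt_0_compat; apply Hpos).
    assert (Hn : 0 < INR (S n)) by (apply lt_0_INR; lia).
    replace (1 + / INR (S n)) with (INR (S (S n)) * / INR (S n))
      by (rewrite (S_INR (S n)); field; lra).
    rewrite Rpow_mult_distr, pow_inv; simpl (q ^ S n).
    field; split; [apply pow_nonzero; lra|apply pow_nonzero; lra].
  - replace (Finite q) with (Finite (1 * q)) by (f_equal; ring).
    apply is_lim_seq_mult'; [exact H2|apply is_lim_seq_const].
Qed.

Lemma ex_series_wcoef (q : R) (p : nat) :
  0 < q < 1 -> ex_series (fun j => INR (S j) ^ p * Rabs (wcoef q j)).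
Proof.
  intros Hq.
  apply (ex_series_le (V := RCV) _
    (fun j => 2 / q * (INR (S j) ^ p * q ^ j))).
  - intros j; pose proof (wcoef_abs_le q j Hq).
    assert (0 <= INR (S j) ^ p) by (apply pow_le, pos_INR).
    change (Rabs (INR (S j) ^ p * Rabs (wcoef q j)) <= 2 / q * (INR (S j) ^ p * q ^ j)).
    rewrite Rabs_mult, Rabs_Rabsolu, (Rabs_pos_eq (_ ^ p)) by assumption.
    apply Rle_trans with (INR (S j) ^ p * (2 / q * q ^ j)); [|right; ring].
    apply Rmult_le_compat_l; assumption.
  - apply (ex_series_scal (2 / q) (fun j => INR (S j) ^ p * q ^ j)), ex_series_poly_geom, Hq.
Qed.

Lemma ex_series_abs_le (a b : nat -> R) :
  (forall n, Rabs (a n) <= b n) -> ex_series b -> ex_series a.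
Proof. intros H; apply (ex_series_le (V := RCV) a b H). Qed.

Lemma Series_abs_le (a b : nat -> R) :
  (forall n, Rabs (a n) <= b n) -> ex_series b -> Rabs (Series a) <= Series b.
Proof.
  intros H Hb.
  assert (Ha : ex_series (fun n => Rabs (a n))).
  { apply (ex_series_abs_le _ b); [intros n; rewrite Rabs_Rabsolu; apply H|exact Hb]. }
  apply Rle_trans with (1 := Series_Rabs a Ha).
  apply Series_le; [|exact Hb]; intros n; split; [apply Rabs_pos|apply H].
Qed.

Lemma ex_series_wcoef_abs (q : R) : 0 < q < 1 -> ex_series (fun j => Rabs (wcoef q j)).
Proof.
  intros Hq; apply (ex_series_ext (fun j => INR (S j) ^ 0 * Rabs (wcoef q j)));
    [intros j; simpl; ring|apply ex_series_wcoef, Hq].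
Qed.

Lemma Rabs_mult_cos_le (w y : R) : Rabs (w * cos y) <= Rabs w.
Proof.
  rewrite Rabs_mult.
  assert (Rabs (cos y) <= 1) by (apply Rabs_le, COS_bound).
  pose proof (Rabs_pos w); pose proof (Rabs_pos (cos y)); nra.
Qed.

Lemma ex_series_wt (q x : R) :
  0 < q < 1 -> ex_series (fun j => wcoef q j * cos (2 * INR j * x)).
Proof.
  intros Hq; apply (ex_series_abs_le _ (fun j => Rabs (wcoef q j)));
    [intros j; apply Rabs_mult_cos_le|apply ex_series_wcoef_abs, Hq].
Qed.

Lemma wt_abs_le (q : R) : 0 < q < 1 -> exists B, 0 <= B /\ forall x, Rabs (wt q x) <= B.
Proof.
  intros Hq; exists (Series (fun j => Rabs (wcoef q j))).
  assert (H : forall x, Rabs (wt q x) <= Series (fun j => Rabs (wcoef q j))).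
  { intros x; apply Series_abs_le; [intros j; apply Rabs_mult_cos_le|].
    apply ex_series_wcoef_abs, Hq. }
  split; [apply Rle_trans with (2 := H 0), Rabs_pos|exact H].
Qed.

Lemma cos_lipschitz (x y : R) : Rabs (cos x - cos y) <= Rabs (x - y).
Proof.
  destruct (MVT_gen cos y x (fun z => - sin z)) as [c [_ Hc]].
  - intros z _; apply is_derive_cos.
  - intros z _; apply continuity_pt_filterlim, continuous_cos.
  - rewrite Hc, Rabs_mult, Rabs_Ropp.
    assert (Rabs (sin c) <= 1) by (apply Rabs_le, SIN_bound).
    pose proof (Rabs_pos (x - y)); nra.
Qed.

Lemma continuous_wt (q x : R) : 0 < q < 1 -> continuous (wt q) x.
Proof.
  intros Hq.
  (* A Lipschitz constant from the first absolute moment of the coefficients; the added 1 makes it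
     positive, so that [eps / L] is an admissible radius. *)
  set (L := Series (fun j => 2 * (INR (S j) ^ 1 * Rabs (wcoef q j))) + 1).
  assert (Hex : ex_series (fun j => 2 * (INR (S j) ^ 1 * Rabs (wcoef q j))))
    by apply (ex_series_scal 2 (fun j => INR (S j) ^ 1 * Rabs (wcoef q j))),
         ex_series_wcoef, Hq.
  assert (HL : forall y, Rabs (wt q y - wt q x) <= (L - 1) * Rabs (y - x)).
  { intros y; unfold wt; rewrite <- Series_minus by apply ex_series_wt, Hq.
    replace ((L - 1) * Rabs (y - x)) with
      (Series (fun j => Rabs (y - x) * (2 * (INR (S j) ^ 1 * Rabs (wcoef q j)))))
      by (rewrite Series_scal_l; unfold L; ring).
    apply Series_abs_le.
    - intros j; rewrite <- Rmult_minus_distr_l, Rabs_mult.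
      pose proof (cos_lipschitz (2 * INR j * y) (2 * INR j * x)) as H.
      replace (2 * INR j * y - 2 * INR j * x) with (2 * INR j * (y - x)) in H by ring.
      rewrite Rabs_mult, (Rabs_pos_eq (2 * INR j)) in H by (pose proof (pos_INR j); lra).
      apply Rle_trans with (Rabs (wcoef q j) * (2 * INR j * Rabs (y - x))).
      { apply Rmult_le_compat_l; [apply Rabs_pos|exact H]. }
      rewrite S_INR, pow_1; pose proof (Rabs_pos (y - x)); pose proof (Rabs_pos (wcoef q j)).
      assert (0 <= Rabs (wcoef q j) * Rabs (y - x)) by nra; nra.
    - apply (ex_series_scal (Rabs (y - x)) (fun j => 2 * (INR (S j) ^ 1 * Rabs (wcoef q j)))),
        Hex. }
  assert (HL0 : 0 < L).
  { assert (0 <= L - 1); [|lra].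
    unfold L; ring_simplify (Series (fun j => 2 * (INR (S j) ^ 1 * Rabs (wcoef q j))) + 1 - 1).
    apply Rle_trans with (2 := Series_abs_le _ _ (fun j => Req_le _ _ (Rabs_pos_eq
      (2 * (INR (S j) ^ 1 * Rabs (wcoef q j))) (Rmult_le_pos _ _ (Rlt_le _ _ Rlt_0_2)
        (Rmult_le_pos _ _ (pow_le _ _ (pos_INR _)) (Rabs_pos _))))) Hex), Rabs_pos. }
  apply filterlim_locally; intros eps.
  exists (mkposreal (eps / L) (Rdiv_lt_0_compat _ _ (cond_pos eps) HL0)); intros y Hy.
  change (Rabs (y - x) < eps / L) in Hy; change (Rabs (wt q y - wt q x) < eps).
  apply (Rmult_lt_compat_r L) in Hy; [|lra].
  unfold Rdiv in Hy; rewrite Rmult_assoc, Rinv_l, Rmult_1_r in Hy by lra.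
  specialize (HL y); pose proof (Rabs_pos (y - x)); nra.
Qed.

Lemma Series_tail_abs_le (a b : nat -> R) (N : nat) :
  (forall n, Rabs (a n) <= b n) -> ex_series b ->
  Rabs (Series a - sum_n a N) <= Series b - sum_n b N.
Proof.
  intros H Hb.
  assert (Ha : ex_series a) by (apply (ex_series_abs_le a b); assumption).
  rewrite (Series_incr_n a (S N)), (Series_incr_n b (S N)) by (lia || assumption).
  simpl pred; rewrite !sum_n_Reals.
  replace (sum_f_R0 a N + Series (fun k => a (S N + k)%nat) - sum_f_R0 a N)
    with (Series (fun k => a (S N + k)%nat)) by ring.
  replace (sum_f_R0 b N + Series (fun k => b (S N + k)%nat) - sum_f_R0 b N)
    with (Series (fun k => b (S N + k)%nat)) by ring.
  apply Series_abs_le; [intros n; apply H|].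
  apply (ex_series_incr_n b (S N)), Hb.
Qed.

Lemma is_RInt_sum_n (f : nat -> R -> R) (l : nat -> R) (a b : R) (N : nat) :
  (forall k, is_RInt (f k) a b (l k)) ->
  is_RInt (fun x => sum_n (fun k => f k x) N) a b (sum_n l N).
Proof.
  intros H; induction N as [|N IH].
  - rewrite sum_O; apply (is_RInt_ext (f O)); [intros x _; rewrite sum_O; reflexivity|apply H].
  - rewrite sum_Sn.
    apply (is_RInt_ext (fun x => plus (sum_n (fun k => f k x) N) (f (S N) x)));
      [intros x _; rewrite sum_Sn; reflexivity|].
    apply (is_RInt_plus (V := RV)); [exact IH|apply H].
Qed.

Definition cos_wt (q c : R) : R := RInt (fun x => cos (c * x) * wt q x) 0 PI.

Lemma ex_RInt_cont (f : R -> R) (a b : R) : (forall x, continuous f x) -> ex_RInt f a b.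
Proof. intros H; apply (ex_RInt_continuous (V := RCV)); auto. Qed.

Lemma is_RInt_cont (f : R -> R) (a b : R) :
  (forall x, continuous f x) -> is_RInt f a b (RInt f a b).
Proof.
  intros H; apply (RInt_correct (V := RCV)), ex_RInt_cont, H.
Qed.

(** The tail of the weight is bounded uniformly in [x] by the tail of the absolute series, so
    integrating a partial sum errs by at most [PI] times that tail. *)
Lemma cos_wt_series (q c : R) : 0 < q < 1 ->
  is_series (fun j => wcoef q j * RInt (fun x => cos (c * x) * cos (2 * INR j * x)) 0 PI)
    (cos_wt q c).
Proof.
  intros Hq; set (I := fun j => RInt (fun x => cos (c * x) * cos (2 * INR j * x)) 0 PI).
  assert (Hc : forall j x, continuous (fun x => cos (c * x) * cos (2 * INR j * x)) x).
  { intros j x; apply (continuous_mult (fun x => cos (c * x)) (fun x => cos (2 * INR j * x)));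
      apply continuous_cos_scal. }
  assert (Hw : forall x, continuous (fun x => cos (c * x) * wt q x) x).
  { intros x; apply (continuous_mult (fun x => cos (c * x)) (wt q));
      [apply continuous_cos_scal|apply continuous_wt, Hq]. }
  assert (Hsum : forall N, is_RInt
    (fun x => sum_n (fun j => wcoef q j * (cos (c * x) * cos (2 * INR j * x))) N) 0 PI
    (sum_n (fun j => wcoef q j * I j) N)).
  { intros N; apply is_RInt_sum_n; intros j.
    apply (is_RInt_scal (V := RV)), is_RInt_cont, Hc. }
  set (b := fun j => Rabs (wcoef q j)).
  assert (Hb : ex_series b) by apply ex_series_wcoef_abs, Hq.
  pose proof PI_RGT_0 as HPI.
  assert (Hdiff : forall N, Rabs (sum_n (fun j => wcoef q j * I j) N - cos_wt q c)
    <= (PI - 0) * (Series b - sum_n b N)).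
  { intros N.
    assert (HI : is_RInt (fun x => sum_n (fun j => wcoef q j * (cos (c * x) * cos (2 * INR j * x))) N
        - cos (c * x) * wt q x) 0 PI
      (sum_n (fun j => wcoef q j * I j) N
        - cos_wt q c))
      by exact (is_RInt_minus _ _ _ _ _ _ (Hsum N) (is_RInt_cont _ 0 PI Hw)).
    rewrite <- (is_RInt_unique _ _ _ _ HI).
    apply abs_RInt_le_const; [lra|eexists; exact HI|].
    intros x _; rewrite <- Rabs_Ropp, Ropp_minus_distr.
    replace (cos (c * x) * wt q x - sum_n (fun j => wcoef q j * (cos (c * x) * cos (2 * INR j * x))) N)
      with (cos (c * x) * (wt q x - sum_n (fun j => wcoef q j * cos (2 * INR j * x)) N)).
    2:{ rewrite Rmult_minus_distr_l; f_equal.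
        rewrite <- (sum_n_scal_l (K := R_Ring) (V := R_ModuleSpace)).
        apply sum_n_ext; intros j; unfold scal; simpl; unfold mult; simpl; ring. }
    rewrite Rmult_comm; apply Rle_trans with (1 := Rabs_mult_cos_le _ _).
    apply Series_tail_abs_le; [intros j; apply Rabs_mult_cos_le|exact Hb]. }
  assert (Hlim : is_lim_seq (fun N => PI * (Series b - sum_n b N)) (PI * 0)).
  { apply is_lim_seq_mult'; [apply is_lim_seq_const|].
    replace (Finite 0) with (Finite (Series b - Series b)) by (f_equal; ring).
    apply is_lim_seq_minus'; [apply is_lim_seq_const|apply (Series_correct b Hb)]. }
  rewrite Rmult_0_r in Hlim.
  change (is_lim_seq (sum_n (fun j => wcoef q j * I j)) (cos_wt q c)).
  apply (is_lim_seq_ext (fun N => (sum_n (fun j => wcoef q j * I j) N - cos_wt q c) + cos_wt q c));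
    [intros N; ring|].
  replace (Finite (cos_wt q c)) with (Finite (0 + cos_wt q c)) by (f_equal; ring).
  apply is_lim_seq_plus'; [|apply is_lim_seq_const].
  apply is_lim_seq_abs_le_0 with (2 := Hlim).
  intros N; specialize (Hdiff N); rewrite Rminus_0_r in Hdiff; exact Hdiff.
Qed.

(** * Orthogonality *)

(** Signed frequencies are allowed because the product-to-sum formula produces [i - j]. *)
Lemma is_RInt_cos_integer (k : Z) :
  is_RInt (fun x => cos (IZR k * x)) 0 PI (if Z.eq_dec k 0 then PI else 0).
Proof.
  destruct (Z.eq_dec k 0) as [->|Hk].
  - apply (is_RInt_ext (fun _ => 1)); [intros; rewrite Rmult_0_l, cos_0; reflexivity|].
    replace PI with (scal (PI - 0) 1) at 2
      by (unfold scal; simpl; unfold mult; simpl; ring).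
    apply (is_RInt_const (V := RV)).
  - assert (Hk' : IZR k <> 0) by (apply not_0_IZR, Hk).
    replace 0 with (minus (sin (IZR k * PI) / IZR k) (sin (IZR k * 0) / IZR k)) at 2.
    2:{ rewrite Rmult_0_r, sin_0, (sin_eq_0_1 (IZR k * PI)) by (exists k; reflexivity).
        unfold minus, plus, opp; simpl; field; exact Hk'. }
    apply (is_RInt_derive (fun x => sin (IZR k * x) / IZR k)).
    + intros x _; auto_derive; [trivial|field; exact Hk'].
    + intros x _; apply continuous_cos_scal.
Qed.

Lemma RInt_cos_cos (i j : nat) :
  RInt (fun x => cos (INR i * x) * cos (INR j * x)) 0 PI
  = if Nat.eq_dec i j then (if Nat.eq_dec i 0 then PI else PI / 2) else 0.
Proof.
  pose proof (is_RInt_scal (V := RV) _ _ _ (/ 2) _ (is_RInt_plus _ _ _ _ _ _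
    (is_RInt_cos_integer (Z.of_nat i + Z.of_nat j))
    (is_RInt_cos_integer (Z.of_nat i - Z.of_nat j)))) as H.
  assert (E : (if Nat.eq_dec i j then (if Nat.eq_dec i 0 then PI else PI / 2) else 0)
    = / 2 * ((if Z.eq_dec (Z.of_nat i + Z.of_nat j) 0 then PI else 0)
             + (if Z.eq_dec (Z.of_nat i - Z.of_nat j) 0 then PI else 0))).
  { destruct (Z.eq_dec _ 0), (Z.eq_dec _ 0), (Nat.eq_dec i j), (Nat.eq_dec i 0);
      try lia; field. }
  etransitivity; [|symmetry; exact E].
  apply is_RInt_unique; refine (is_RInt_ext _ _ _ _ _ _ H); intros x _.
  rewrite plus_IZR, minus_IZR, <- !INR_IZR_INZ.
  unfold scal, plus; simpl; unfold mult; simpl.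
  replace ((INR i + INR j) * x) with (INR i * x + INR j * x) by ring.
  replace ((INR i - INR j) * x) with (INR i * x - INR j * x) by ring.
  rewrite cos_plus, cos_minus; field.
Qed.

Lemma RInt_eq (f g : R -> R) (a b : R) : (forall x, f x = g x) -> RInt f a b = RInt g a b.
Proof. intros H; apply RInt_ext; intros x _; apply H. Qed.

Lemma cos_wt_opp (q c : R) : cos_wt q (- c) = cos_wt q c.
Proof.
  apply RInt_eq; intros x.
  rewrite <- cos_neg; do 2 f_equal; ring.
Qed.

Lemma cos_wt_odd (q : R) (i : nat) : 0 < q < 1 -> cos_wt q (INR (2 * i + 1)) = 0.
Proof.
  intros Hq.
  rewrite <- (is_series_unique _ _ (cos_wt_series q (INR (2 * i + 1)) Hq)).
  rewrite (Series_ext _ (fun _ => 0 * 0)).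
  - rewrite Series_scal_l; ring.
  - intros j.
    replace (2 * INR j) with (INR (2 * j)) by (rewrite mult_INR; reflexivity).
    rewrite RInt_cos_cos; destruct (Nat.eq_dec _ _); [lia|ring].
Qed.

(* The Fourier coefficient of [wt q] as a function of [y = q ^ j]; it is invariant under
   [y -> / y], so that it also serves negative frequencies. *)
Definition wfun (q y : R) : R := 2 * y * (1 - q ^ 2) / ((1 + q * y) * (q + y)).

(** Only the term of frequency [2 i] survives. One formula covers [i = 0] too: the integral there is
    [PI] instead of [PI / 2], and [wfun q 1] is twice [gq q 1]. *)
Lemma cos_wt_even (q : R) (i : nat) : 0 < q < 1 ->
  cos_wt q (INR (2 * i)) = PI / 2 * ((-1) ^ i * wfun q (q ^ i)).
Proof.
  intros Hq.
  rewrite <- (is_series_unique _ _ (cos_wt_series q (INR (2 * i)) Hq)).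
  set (v := wcoef q i * (if Nat.eq_dec i 0 then PI else PI / 2)).
  assert (HS : is_series (fun j => wcoef q j *
    RInt (fun x => cos (INR (2 * i) * x) * cos (2 * INR j * x)) 0 PI) v).
  { apply is_series_sumR.
    apply (is_lim_seq_incr_n _ (S i)).
    apply (is_lim_seq_ext (fun _ => v)); [|apply is_lim_seq_const].
    intros N; rewrite (sumR_single _ i); [| lia |].
    - unfold v; f_equal.
      replace (2 * INR i) with (INR (2 * i)) by (rewrite mult_INR; reflexivity).
      rewrite RInt_cos_cos; destruct (Nat.eq_dec (2 * i) (2 * i)); [|lia].
      destruct (Nat.eq_dec i 0), (Nat.eq_dec (2 * i) 0); try lia; reflexivity.
    - intros k _ Hk.
      replace (2 * INR k) with (INR (2 * k)) by (rewrite mult_INR; reflexivity).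
      rewrite RInt_cos_cos; destruct (Nat.eq_dec (2 * i) (2 * k)); [lia|ring]. }
  rewrite (is_series_unique _ _ HS); unfold v, wcoef, wfun, gq.
  destruct i as [|i].
  - simpl; field; lra.
  - destruct (Nat.eq_dec (S i) 0); [lia|].
    pose proof (pow_bounds_01 q i Hq).
    assert (0 < q * q ^ i) by (apply Rmult_lt_0_compat; lra).
    assert (0 < q * (q * q ^ i)) by (apply Rmult_lt_0_compat; lra).
    simpl; field; repeat split; lra.
Qed.

Lemma cos_wt_centered (q : R) (k N : nat) : 0 < q < 1 ->
  cos_wt q (2 * INR k - INR (2 * N + 1) + 1)
  = PI / 2 * ((-1) ^ (k + N) * wfun q (q ^ k / q ^ N)).
Proof.
  intros Hq; rewrite plus_INR, mult_INR; change (INR 2) with 2; change (INR 1) with 1.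
  assert (HN : forall n, q ^ n <> 0) by (intros n; apply pow_nonzero; lra).
  destruct (le_lt_dec N k) as [H|H].
  - replace (2 * INR k - (2 * INR N + 1) + 1) with (INR (2 * (k - N)))
      by (rewrite mult_INR, minus_INR by exact H; change (INR 2) with 2; ring).
    rewrite cos_wt_even by exact Hq; do 2 f_equal; [|f_equal].
    + replace (k + N)%nat with (k - N + 2 * N)%nat by lia.
      rewrite pow_add, pow_1_even; ring.
    + replace k with ((k - N) + N)%nat at 2 by lia; rewrite pow_add; field; apply HN.
  - replace (2 * INR k - (2 * INR N + 1) + 1) with (- INR (2 * (N - k)))
      by (rewrite mult_INR, minus_INR by lia; change (INR 2) with 2; ring).
    rewrite cos_wt_opp, cos_wt_even by exact Hq; do 2 f_equal.
    + replace (k + N)%nat with (N - k + 2 * k)%nat by lia.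
      rewrite pow_add, pow_1_even; ring.
    + replace N with (k + (N - k))%nat at 2 by lia; rewrite pow_add.
      pose proof (pow_bounds_01 q (N - k) Hq); pose proof (pow_bounds_01 q k Hq).
      unfold wfun; field; repeat split; nra.
Qed.

(* Indefinite (q-Gosper) summation of the coefficients against the weight. *)
Lemma gosper_partial_sum (q : R) (N K : nat) : 0 < q < 1 -> (1 <= N)%nat -> (K <= 2 * N)%nat ->
  sumR (fun k => (-1) ^ k * (acoef q k * acoef q (2 * N - k)) * wfun q (q ^ k / q ^ N)) (S K)
  = (-1) ^ K * (acoef q K * acoef q (2 * N - K)) *
    (2 * (q ^ K / q ^ N) * (1 - q ^ (2 * N - K)) * (1 + q * q ^ K) * (1 - q)
     / ((1 + q * (q ^ K / q ^ N)) * (1 + q ^ K / q ^ N) * (1 + q * q ^ N) * (1 - q ^ N))).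
Proof.
  intros Hq HN.
  pose proof (pow_bounds_01 q N Hq) as HY; pose proof (pow_lt_1 q N Hq HN) as HY1.
  induction K as [|K IH]; intros HK.
  - change (sumR ?f 1) with (0 + f O); cbv beta; replace (2 * N - 0)%nat with (N + N)%nat by lia.
    rewrite pow_add; unfold wfun; set (Y := q ^ N) in *.
    replace (q ^ 0 / Y) with (/ Y) by (simpl; field; lra).
    assert (0 < q * Y) by nra.
    rewrite acoef_0; simpl pow; field; repeat split; lra.
  - change (sumR ?f (S (S K))) with (sumR f (S K) + f (S K)); cbv beta.
    rewrite IH by lia.
    replace (2 * N - K)%nat with (S (2 * N - S K)) by lia.
    rewrite (acoef_S q (2 * N - S K) Hq), (acoef_S q K Hq).
    assert (HZ : q ^ S (2 * N - S K) = q ^ N * q ^ N / q ^ K).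
    { apply (Rmult_eq_reg_r (q ^ K)); [|apply pow_nonzero; lra].
      unfold Rdiv; rewrite Rmult_assoc, Rinv_l, Rmult_1_r by (apply pow_nonzero; lra).
      rewrite <- !pow_add; f_equal; lia. }
    pose proof (pow_lt_1 q (S (2 * N - S K)) Hq ltac:(lia)) as HZ1.
    rewrite HZ in *.
    assert (HZ' : q ^ (2 * N - S K) = q ^ N * q ^ N / q ^ K / q).
    { rewrite <- HZ; simpl; field; lra. }
    rewrite HZ'.
    pose proof (pow_bounds_01 q K Hq) as HX; pose proof (pow_lt_1 q (S K) Hq ltac:(lia)) as HX1.
    simpl in HX1; unfold wfun; simpl pow.
    set (X := q ^ K) in *; set (Y := q ^ N) in *.
    (* That is [q ^ K <> q ^ (2 N)], true because [K < 2 N]. *)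
    assert (HXY : X - Y * Y <> 0).
    { intros E; replace (Y * Y) with X in HZ1 by lra.
      unfold Rdiv in HZ1; rewrite Rinv_r in HZ1; lra. }
    assert (0 < q * X) by nra; assert (0 < q * Y) by nra.
    assert (0 < q * (q * X)) by (apply Rmult_lt_0_compat; lra).
    field; repeat split; try lra; nra.
Qed.

Lemma is_RInt_sumR_wt (q : R) (c f : nat -> R) (n : nat) : 0 < q < 1 ->
  is_RInt (fun x => sumR (fun k => c k * cos (f k * x)) n * wt q x) 0 PI
    (sumR (fun k => c k * cos_wt q (f k)) n).
Proof.
  intros Hq; induction n as [|n IH]; simpl.
  - replace 0 with (scal (PI - 0) 0) at 2
      by (unfold scal; simpl; unfold mult; simpl; ring).
    apply (is_RInt_ext (fun _ => 0)); [intros; simpl; ring|].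
    apply (is_RInt_const (V := RV)).
  - apply (is_RInt_ext (fun x => sumR (fun k => c k * cos (f k * x)) n * wt q x
      + c n * (cos (f n * x) * wt q x))); [intros; simpl; ring|].
    apply (is_RInt_plus (V := RV)); [exact IH|].
    apply (is_RInt_scal (V := RV)), is_RInt_cont.
    intros x; apply (continuous_mult (fun x => cos (f n * x)) (wt q));
      [apply continuous_cos_scal|apply continuous_wt, Hq].
Qed.

(** For even [n] the frequencies are odd, while the weight has only even ones. For odd [n] the
    frequencies are even and the pairing is the summable sum. *)
Lemma RInt_rogers_wt (q : R) (n : nat) : 0 < q < 1 ->
  RInt (fun x => rogers q n x * wt q x) 0 PI = if Nat.eq_dec n 1 then PI * gq q 1 else 0.
Proof.
  intros Hq.
  etransitivity; [apply is_RInt_unique, (is_RInt_sumR_wt q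
    (fun k => acoef q k * acoef q (n - 1 - k)) (fun k => 2 * INR k - INR n + 1) n Hq)|].
  cbv beta.
  destruct (Nat.Even_or_Odd n) as [[N ->]|[N ->]].
  - destruct (Nat.eq_dec _ 1); [lia|].
    apply sumR_zero; intros k Hk.
    replace (cos_wt q _) with 0; [ring|symmetry].
    destruct (le_lt_dec N k) as [H|H].
    + replace (2 * INR k - INR (2 * N) + 1) with (INR (2 * (k - N) + 1)).
      * apply cos_wt_odd, Hq.
      * rewrite plus_INR, !mult_INR, minus_INR by exact H; simpl; ring.
    + replace (2 * INR k - INR (2 * N) + 1) with (- INR (2 * (N - k - 1) + 1)).
      * rewrite cos_wt_opp; apply cos_wt_odd, Hq.
      * rewrite plus_INR, !mult_INR, !minus_INR by lia; simpl; ring.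
  - transitivity (PI / 2 * (-1) ^ N * sumR (fun k => (-1) ^ k *
      (acoef q k * acoef q (2 * N - k)) * wfun q (q ^ k / q ^ N)) (S (2 * N))).
    { rewrite <- sumR_scal_l; replace (2 * N + 1)%nat with (S (2 * N)) by lia.
      apply sumR_ext; intros k Hk.
      replace (S (2 * N) - 1 - k)%nat with (2 * N - k)%nat by lia.
      replace (S (2 * N)) with (2 * N + 1)%nat by lia.
      rewrite cos_wt_centered by exact Hq; rewrite pow_add; ring. }
    destruct (Nat.eq_dec _ 1) as [E|E].
    + assert (N = O) by lia; subst N.
      simpl; rewrite acoef_0; unfold wfun, gq; simpl; field; lra.
    (* At the upper end [K = 2 N] the factor [1 - q ^ (2 N - K)] is zero. *)
    + rewrite gosper_partial_sum by (exact Hq || lia).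
      rewrite Nat.sub_diag; simpl (q ^ 0); unfold Rdiv; simpl; ring.
Qed.

Lemma continuous_rogers_mul_wt (q : R) (m k : nat) (x : R) :
  0 < q < 1 -> continuous (fun x => rogers q m x * rogers q k x * wt q x) x.
Proof.
  intros Hq; apply (continuous_mult (fun x => rogers q m x * rogers q k x) (wt q));
    [|apply continuous_wt, Hq].
  apply (continuous_mult (rogers q m) (rogers q k)); apply continuous_rogers.
Qed.

Definition gram (q : R) (m k : nat) : R :=
  RInt (fun x => rogers q m x * rogers q k x * wt q x) 0 PI.

(** Multiplication by [2 cos x] is symmetric for the pairing, and the recurrence may be applied to
    either factor. *)
Lemma gram_exchange (q : R) (m k : nat) : 0 < q < 1 ->
  gq q (S m) * (gram q (S (S m)) (S k) + gram q m (S k))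
  = gq q (S k) * (gram q (S m) (S (S k)) + gram q (S m) k).
Proof.
  intros Hq.
  assert (HI := fun i j => is_RInt_cont _ 0 PI (fun x => continuous_rogers_mul_wt q i j x Hq)).
  assert (H1 := is_RInt_scal (V := RV) _ _ _ (gq q (S m)) _
    (is_RInt_plus _ _ _ _ _ _ (HI (S (S m)) (S k)) (HI m (S k)))).
  assert (H2 := is_RInt_scal (V := RV) _ _ _ (gq q (S k)) _
    (is_RInt_plus _ _ _ _ _ _ (HI (S m) (S (S k))) (HI (S m) k))).
  apply (is_RInt_unique (V := RCV)) in H1, H2.
  transitivity (RInt (fun x => gq q (S m) * (rogers q (S (S m)) x * rogers q (S k) x * wt q x
    + rogers q m x * rogers q (S k) x * wt q x)) 0 PI); [symmetry; exact H1|].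
  transitivity (RInt (fun x => gq q (S k) * (rogers q (S m) x * rogers q (S (S k)) x * wt q x
    + rogers q (S m) x * rogers q k x * wt q x)) 0 PI); [|exact H2].
  apply RInt_eq; intros x.
  pose proof (rogers_recurrence q m x Hq) as Em; pose proof (rogers_recurrence q k x Hq) as Ek.
  transitivity (gq q (S m) * (rogers q (S (S m)) x + rogers q m x) * rogers q (S k) x * wt q x);
    [ring|rewrite Em].
  transitivity (rogers q (S m) x * (gq q (S k) * (rogers q (S (S k)) x + rogers q k x)) * wt q x);
    [rewrite Ek|]; ring.
Qed.

Lemma gram_0_l (q : R) (k : nat) : gram q 0 k = 0.
Proof.
  transitivity (RInt (fun _ => 0) 0 PI).
  - apply RInt_eq; intros x; unfold rogers; simpl; ring.
  - rewrite RInt_const; unfold scal; simpl; unfold mult; simpl; ring.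
Qed.

Lemma gram_comm (q : R) (m k : nat) : gram q m k = gram q k m.
Proof. apply RInt_eq; intros x; ring. Qed.

(** The exchange relation computes column [k + 2] of the Gram matrix from columns [k] and [k + 1],
    so the induction carries two columns. Column 0 vanishes and column 1 is the pairing with the
    weight alone; the norms come out of the same relation. *)
Lemma rogers_orthogonal (q : R) (k m : nat) : 0 < q < 1 ->
  gram q m k = if Nat.eq_dec m k then PI * gq q k else 0.
Proof.
  intros Hq; revert m.
  enough (H : (forall m, gram q m k = if Nat.eq_dec m k then PI * gq q k else 0) /\
    (forall m, gram q m (S k) = if Nat.eq_dec m (S k) then PI * gq q (S k) else 0)) by apply H.
  induction k as [|k [IH0 IH1]]; split.
  - intros m; rewrite gram_comm, gram_0_l.
    destruct (Nat.eq_dec m 0); [unfold gq; simpl; field|reflexivity].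
  - intros m; etransitivity; [|apply (RInt_rogers_wt q m Hq)]; apply RInt_eq; intros x.
    rewrite rogers_1; ring.
  - exact IH1.
  - intros [|m].
    { rewrite gram_0_l; destruct (Nat.eq_dec _ _); [lia|reflexivity]. }
    pose proof (gram_exchange q m k Hq) as E.
    rewrite (IH1 (S (S m))), (IH1 m), (IH0 (S m)) in E.
    pose proof (gq_pos q (S k) Hq ltac:(lia)) as Hk.
    apply (Rmult_eq_reg_l (gq q (S k))); [|lra].
    destruct (Nat.eq_dec (S (S m)) (S k)), (Nat.eq_dec m (S k)), (Nat.eq_dec (S m) k),
      (Nat.eq_dec (S m) (S (S k))); try lia; subst; try lra.
Qed.

(** * The spectral solution *)

Lemma continuity_2d_pt_of_continuous_snd (f : R -> R) (u v : R) :
  continuous f v -> continuity_2d_pt (fun _ y => f y) u v.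
Proof.
  intros H; apply (continuity_1d_2d_pt_comp f (fun _ y => y)).
  - apply continuity_pt_filterlim, H.
  - apply continuity_2d_pt_id2.
Qed.

Notation hf t x := (exp (- t * (1 - cos x))) (only parsing).

Lemma continuous_heat_factor (t x : R) : continuous (fun x => hf t x) x.
Proof.
  smooth.
Qed.

Lemma is_derive_heat_integral (phi : R -> R) (t : R) : (forall x, continuous phi x) ->
  is_derive (fun t => RInt (fun x => hf t x * phi x) 0 PI) t
    (RInt (fun x => hf t x * ((cos x - 1) * phi x)) 0 PI).
Proof.
  intros Hphi.
  assert (Hd : forall x u, is_derive (fun u => hf u x * phi x) u
    (hf u x * ((cos x - 1) * phi x))).
  { intros x u; auto_derive; [trivial|ring]. }
  replace (RInt (fun x => hf t x * ((cos x - 1) * phi x)) 0 PI)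
    with (RInt (fun x => Derive (fun u => hf u x * phi x) t) 0 PI).
  2:{ apply RInt_eq; intros x; apply is_derive_unique, Hd. }
  apply (is_derive_RInt_param (fun u x => hf u x * phi x)).
  - exists (mkposreal 1 Rlt_0_1); intros u _ x _; eexists; apply Hd.
  - intros x _.
    apply (continuity_2d_pt_ext (fun u v => hf u v * ((cos v - 1) * phi v))).
    { intros u v; symmetry; apply is_derive_unique, Hd. }
    apply continuity_2d_pt_mult.
    + apply (continuity_1d_2d_pt_comp exp (fun u v => - u * (1 - cos v))).
      * apply continuity_pt_filterlim, continuous_exp.
      * apply (continuity_2d_pt_mult (fun u _ => - u) (fun _ v => 1 - cos v)).
        { apply continuity_2d_pt_opp, continuity_2d_pt_id1. }
        { apply (continuity_2d_pt_of_continuous_snd (fun v => 1 - cos v)).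
          smooth. }
    + apply (continuity_2d_pt_of_continuous_snd (fun v => (cos v - 1) * phi v)).
      apply (continuous_mult (fun v => cos v - 1) phi); [|apply Hphi].
      smooth.
  - exists (mkposreal 1 Rlt_0_1); intros u _; apply ex_RInt_cont; intros x.
    apply (continuous_mult (fun x => hf u x) phi);
      [apply continuous_heat_factor|apply Hphi].
Qed.

Definition heat (q : R) (m k : nat) (t : R) : R :=
  / (PI * gq q k) *
  RInt (fun x => hf t x * (rogers q m x * rogers q k x * wt q x)) 0 PI.

Lemma heat_boundary (q : R) (k : nat) (t : R) : heat q 0 k t = 0.
Proof.
  unfold heat; rewrite (RInt_eq _ (fun _ => 0)).
  - rewrite RInt_const; unfold scal; simpl; unfold mult; simpl; ring.
  - intros x; unfold rogers; simpl; ring.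
Qed.

Lemma heat_initial (q : R) (m k : nat) : 0 < q < 1 -> (1 <= k)%nat ->
  heat q m k 0 = if Nat.eq_dec m k then 1 else 0.
Proof.
  intros Hq Hk; unfold heat.
  rewrite (RInt_eq _ (fun x => rogers q m x * rogers q k x * wt q x)).
  2:{ intros x; rewrite Ropp_0, Rmult_0_l, exp_0; ring. }
  change (RInt (fun x => rogers q m x * rogers q k x * wt q x) 0 PI) with (gram q m k).
  rewrite rogers_orthogonal by exact Hq.
  pose proof (gq_pos q k Hq Hk); pose proof PI_RGT_0.
  destruct (Nat.eq_dec m k); field; lra.
Qed.

(** Differentiation in time inserts [cos x - 1], which the recurrence turns into the one-particle
    generator acting on the index [m]. *)
Lemma heat_derive (q : R) (m k : nat) (t : R) : 0 < q < 1 -> (1 <= m)%nat ->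
  is_derive (heat q m k) t
    (- heat q m k t + gq q m / 2 * (heat q (S m) k t + heat q (pred m) k t)).
Proof.
  intros Hq Hm; destruct m as [|m]; [lia|]; simpl pred.
  assert (Hc := fun i x => continuous_rogers_mul_wt q i k x Hq).
  assert (Hc' : forall i x, continuous (fun x => hf t x *
    (rogers q i x * rogers q k x * wt q x)) x).
  { intros i x; apply (continuous_mult (fun x => hf t x)
      (fun x => rogers q i x * rogers q k x * wt q x));
      [apply continuous_heat_factor|apply Hc]. }
  pose proof (is_derive_scal _ t (/ (PI * gq q k)) _
    (is_derive_heat_integral (fun x => rogers q (S m) x * rogers q k x * wt q x) t (Hc (S m)))) as H.
  replace (- heat q (S m) k t + gq q (S m) / 2 * (heat q (S (S m)) k t + heat q m k t))
    with (/ (PI * gq q k) * RInt (fun x => hf t x *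
      ((cos x - 1) * (rogers q (S m) x * rogers q k x * wt q x))) 0 PI); [exact H|].
  unfold heat.
  set (I := fun i => RInt (fun x => hf t x *
    (rogers q i x * rogers q k x * wt q x)) 0 PI).
  assert (HI := fun i => is_RInt_cont _ 0 PI (Hc' i)).
  assert (HJ : is_RInt (fun x => (-1) * (hf t x *
      (rogers q (S m) x * rogers q k x * wt q x))
    + gq q (S m) / 2 * (hf t x * (rogers q (S (S m)) x * rogers q k x * wt q x)
      + hf t x * (rogers q m x * rogers q k x * wt q x))) 0 PI
    ((-1) * I (S m) + gq q (S m) / 2 * (I (S (S m)) + I m)))
    by exact (is_RInt_plus (V := RV) _ _ _ _ _ _
      (is_RInt_scal (V := RV) _ _ _ (-1) _ (HI (S m)))
      (is_RInt_scal (V := RV) _ _ _ (gq q (S m) / 2) _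
        (is_RInt_plus (V := RV) _ _ _ _ _ _ (HI (S (S m))) (HI m)))).
  apply (is_RInt_unique (V := RCV)) in HJ.
  transitivity (/ (PI * gq q k) * ((-1) * I (S m) + gq q (S m) / 2 * (I (S (S m)) + I m)));
    [|unfold I; ring].
  f_equal; etransitivity; [|exact HJ]; apply RInt_eq; intros x.
  pose proof (rogers_recurrence q m x Hq) as E.
  transitivity (hf t x * (2 * cos x * rogers q (S m) x) / 2
      * rogers q k x * wt q x
    - hf t x * (rogers q (S m) x * rogers q k x * wt q x)); [field|].
  rewrite <- E; field.
Qed.

(** The heat factor is at most 1, so the growth in [m] is that of the polynomial. A product of two
    such bounds is what [weight] measures. *)
Lemma heat_abs_le (q : R) (k : nat) : 0 < q < 1 ->
  exists B, 0 <= B /\ forall m t, 0 <= t -> Rabs (heat q m k t) <= B * (1 + INR m).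
Proof.
  intros Hq.
  destruct (rogers_abs_le q Hq) as [A [HA0 HA]]; destruct (wt_abs_le q Hq) as [W [HW0 HW]].
  set (c := Rabs (/ (PI * gq q k))).
  assert (Hc : 0 <= c) by apply Rabs_pos.
  pose proof PI_RGT_0 as HPI; pose proof (pos_INR k) as Pk.
  assert (HB : 0 <= A * (A * INR k) * W)
    by (repeat apply Rmult_le_pos; assumption).
  exists (c * ((PI - 0) * (A * (A * INR k) * W))); split.
  { apply Rmult_le_pos; [exact Hc|apply Rmult_le_pos; lra]. }
  intros m t Ht; unfold heat; rewrite Rabs_mult; fold c.
  rewrite Rmult_assoc; apply Rmult_le_compat_l; [exact Hc|].
  rewrite Rmult_assoc; apply abs_RInt_le_const; [lra| |].
  - apply ex_RInt_cont; intros x.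
    apply (continuous_mult (fun x => hf t x)
      (fun x => rogers q m x * rogers q k x * wt q x));
      [apply continuous_heat_factor|apply continuous_rogers_mul_wt, Hq].
  - intros x _; rewrite !Rabs_mult.
    assert (He : Rabs (hf t x) <= 1).
    { rewrite Rabs_pos_eq by apply Rlt_le, exp_pos.
      apply Rle_trans with (exp 0); [|rewrite exp_0; lra].
      apply exp_monotone; pose proof (COS_bound x); nra. }
    specialize (HA m x) as H1; specialize (HA k x) as H2; specialize (HW x).
    pose proof (pos_INR m).
    apply Rle_trans with (1 * ((A * INR m) * (A * INR k) * W)).
    + repeat apply Rmult_le_compat; try apply Rabs_pos; try assumption.
      * apply Rmult_le_pos; [apply Rmult_le_pos|]; apply Rabs_pos.
      * apply Rmult_le_pos; apply Rabs_pos.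
    + replace (1 * (A * INR m * (A * INR k) * W)) with (A * (A * INR k) * W * INR m) by ring.
      apply Rmult_le_compat_l; [exact HB|lra].
Qed.

Definition heat_det (q : R) (k l m n : nat) (t : R) : R :=
  heat q m k t * heat q n l t - heat q m l t * heat q n k t.

Lemma gam_gq (kappa : R) (n : nat) : gam kappa n = gq (qpar kappa) n.
Proof. apply gam_qpar. Qed.

(** Two independent particles: products of one-particle solutions satisfy the two-particle equation,
    the term [-2] being the sum of two killing rates. This holds on the diagonal as well. *)
Lemma heat_det_derive (kappa : R) (k l m n : nat) (t : R) : 0 < kappa ->
  (1 <= m)%nat -> (1 <= n)%nat ->
  is_derive (heat_det (qpar kappa) k l m n) t
    (rhs kappa (fun i j => heat_det (qpar kappa) k l i j t) m n).
Proof.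
  intros hk Hm Hn; pose proof (qpar_bounds kappa hk) as Hq.
  assert (H := fun i j Hi => heat_derive (qpar kappa) i j t Hq Hi).
  pose proof (is_derive_minus _ _ t _ _
    (is_derive_mult _ _ t _ _ (H m k Hm) (H n l Hn) Rmult_comm)
    (is_derive_mult _ _ t _ _ (H m l Hm) (H n k Hn) Rmult_comm)) as HD.
  match type of HD with is_derive _ _ ?l' =>
    replace (rhs kappa _ m n) with l'; [exact HD|] end.
  unfold rhs, heat_det, minus, plus, opp, mult; simpl; rewrite !gam_gq.
  unfold plus, opp; simpl; ring.
Qed.

(** The difference of the two solutions is kept for [n < m] and replaced by 0 elsewhere. This is
    again a flow: a site with [n < m] has all its neighbours in [n <= m], and on the diagonal both
    solutions vanish. Uniqueness with linear growth then applies. *)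
Lemma solves_kl_heat_det (kappa : R) (k l : nat) (f : nat -> nat -> R -> R) :
  0 < kappa -> (1 <= l)%nat -> (l < k)%nat -> solves_kl kappa k l f ->
  forall m n t, (n <= m)%nat -> 0 <= t -> f m n t = heat_det (qpar kappa) k l m n t.
Proof.
  intros hk Hl Hk Hf.
  pose proof (qpar_bounds kappa hk) as Hq.
  destruct (solves_kl_flow kappa k l f Hf) as [Lf [Df [Bf Gf]]].
  set (D := heat_det (qpar kappa) k l).
  assert (BD : forall m n t, m = O \/ n = O \/ m = n -> D m n t = 0).
  { intros m n t [-> | [-> | ->]]; unfold D, heat_det; rewrite ?heat_boundary; ring. }
  set (d := fun m n t => if Nat.ltb n m then f m n t - D m n t else 0).
  assert (Hle : forall m n t, (n <= m)%nat -> 0 <= t -> d m n t = f m n t - D m n t).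
  { intros m n t Hmn Ht; unfold d; destruct (Nat.ltb_spec n m); [reflexivity|].
    rewrite Bf, BD by (auto; right; right; lia); ring. }
  assert (Hgt : forall m n t, (m <= n)%nat -> d m n t = 0).
  { intros m n t Hmn; unfold d; destruct (Nat.ltb_spec n m); [lia|reflexivity]. }
  assert (Hflow : growth_flow kappa d).
  { refine (conj _ (conj _ (conj _ _))).
    - intros m n; unfold d; destruct (Nat.ltb_spec n m) as [H|H];
        [|apply filterlim_const].
      destruct (Nat.eq_dec n 0) as [->|Hn].
      + apply filterlim_ext_loc with (fun _ => f m 0%nat 0 - D m 0%nat 0);
          [|apply filterlim_const].
        exists (mkposreal 1 Rlt_0_1); intros y _ Hy.
        rewrite !Bf, !BD by (auto; lra); ring.
      + apply at_right_minus; [apply Lf|].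
        eapply filterlim_filter_le_1; [apply filter_le_within|].
        apply (ex_derive_continuous (V := RV) (D m n)).
        eexists; apply heat_det_derive; (assumption || lia).
    - intros m n t Hm Hn Hmn Ht.
      destruct (lt_dec n m) as [H|H].
      + apply (is_derive_ext (fun t => f m n t - D m n t)).
        { intros s; unfold d; destruct (Nat.ltb_spec n m); [reflexivity|lia]. }
        replace (rhs kappa (fun i j => d i j t) m n)
          with (rhs kappa (fun i j => f i j t) m n - rhs kappa (fun i j => D i j t) m n).
        2:{ unfold rhs; rewrite !Hle by (lia || lra); ring. }
        apply (is_derive_minus (f m n) (D m n)); [apply Df; assumption|].
        apply heat_det_derive; assumption.
      + apply (is_derive_ext (fun _ => 0)); [intros s; rewrite Hgt by lia; reflexivity|].
        replace (rhs kappa (fun i j => d i j t) m n) with 0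
          by (unfold rhs; rewrite !Hgt by lia; ring).
        apply (is_derive_const (K := R_AbsRing) (V := RV) 0).
    - intros m n t H Ht; unfold d; destruct (Nat.ltb n m); [|reflexivity].
      rewrite Bf, BD by auto; ring.
    - intros T HT; destruct (Gf T HT) as [M HM].
      destruct (heat_abs_le (qpar kappa) k Hq) as [Bk [Bk0 HBk]].
      destruct (heat_abs_le (qpar kappa) l Hq) as [Bl [Bl0 HBl]].
      exists (Rabs M + 2 * (Bk * Bl)); intros m n t Ht.
      pose proof (weight_ge_1 m n) as Hw; pose proof (HM m n t Ht) as HF.
      assert (HM' : Rabs (f m n t) <= Rabs M * weight m n)
        by (pose proof (Rle_abs M); nra).
      assert (HBB : 0 <= Bk * Bl) by nra.
      unfold d; destruct (Nat.ltb n m).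
      2:{ rewrite Rabs_R0; pose proof (Rabs_pos M); nra. }
      assert (Hp : forall a b B1 B2, Rabs a <= B1 * (1 + INR m) -> Rabs b <= B2 * (1 + INR n) ->
        Rabs (a * b) <= B1 * B2 * weight m n).
      { intros a b B1 B2 Ha Hb; rewrite Rabs_mult; unfold weight.
        replace (B1 * B2 * ((1 + INR m) * (1 + INR n)))
          with (B1 * (1 + INR m) * (B2 * (1 + INR n))) by ring.
        apply Rmult_le_compat; try apply Rabs_pos; assumption. }
      pose proof (Hp _ _ _ _ (HBk m t (proj1 Ht)) (HBl n t (proj1 Ht))) as P1.
      pose proof (Hp _ _ _ _ (HBl m t (proj1 Ht)) (HBk n t (proj1 Ht))) as P2.
      unfold D, heat_det.
      apply Rabs_le_between in P1, P2, HM'.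
      apply Rabs_le; split; lra. }
  assert (H0 : forall m n, d m n 0 = 0).
  { intros m n; unfold d; destruct (Nat.ltb_spec n m) as [H|H]; [|reflexivity].
    destruct (Nat.eq_dec n 0) as [->|Hn].
    { rewrite Bf, BD by (auto; lra); ring. }
    destruct Hf as [_ [_ Hi]]; rewrite Hi by lia.
    (* The exchanged product would require [m = l] and [n = k], which contradicts [n < m] and
       [l < k]. *)
    unfold D, heat_det; rewrite !heat_initial by (assumption || lia).
    destruct (Nat.eqb_spec m k), (Nat.eqb_spec n l), (Nat.eq_dec m k), (Nat.eq_dec n l),
      (Nat.eq_dec m l), (Nat.eq_dec n k); simpl; try lia; ring. }
  intros m n t Hmn Ht.
  apply Rminus_diag_uniq; rewrite <- Hle by assumption.
  apply (growth_flow_zero kappa d hk Hflow H0 m n t Ht).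
Qed.

(** * The weight near the origin *)

Lemma nonneg_of_deriv_nonneg (f f' : R -> R) :
  (forall x, is_derive f x (f' x)) -> f 0 = 0 -> (forall x, 0 <= x -> 0 <= f' x) ->
  forall x, 0 <= x -> 0 <= f x.
Proof.
  intros Hd H0 Hp x Hx.
  destruct (MVT_gen f 0 x f') as [c [Hc E]].
  - intros y _; apply Hd.
  - intros y _; apply continuity_pt_filterlim, (ex_derive_continuous (V := RV)).
    eexists; apply Hd.
  - rewrite Rmin_left, Rmax_right in Hc by lra.
    specialize (Hp c (proj1 Hc)); rewrite H0 in E; nra.
Qed.

Ltac integrate H :=
  eapply nonneg_of_deriv_nonneg; [|rewrite ?sin_0, ?cos_0; field|exact H];
  intros; auto_derive; [trivial|simpl; field].

(** Starting from [cos <= 1], each one-sided bound for [sin] or [cos] on [x >= 0] is the integral of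
    the previous one; the claims for negative [x] follow by evenness. *)
Lemma cos_taylor_bounds (x : R) :
  1 - x ^ 2 / 2 <= cos x /\
  Rabs (cos x - (1 - x ^ 2 / 2)) <= x ^ 4 / 24 /\
  Rabs (cos x - (1 - x ^ 2 / 2 + x ^ 4 / 24)) <= x ^ 6 / 720.
Proof.
  assert (S1 : forall x, 0 <= x -> 0 <= x - sin x).
  { apply (nonneg_of_deriv_nonneg _ (fun x => 1 - cos x)).
    - intros y; auto_derive; [trivial|ring].
    - rewrite sin_0; ring.
    - intros y _; pose proof (COS_bound y); lra. }
  assert (C2 : forall x, 0 <= x -> 0 <= cos x - (1 - x ^ 2 / 2)) by integrate S1.
  assert (S3 : forall x, 0 <= x -> 0 <= sin x - (x - x ^ 3 / 6)) by integrate C2.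
  assert (C4 : forall x, 0 <= x -> 0 <= 1 - x ^ 2 / 2 + x ^ 4 / 24 - cos x) by integrate S3.
  assert (S5 : forall x, 0 <= x -> 0 <= x - x ^ 3 / 6 + x ^ 5 / 120 - sin x) by integrate C4.
  assert (C6 : forall x, 0 <= x -> 0 <= cos x - (1 - x ^ 2 / 2 + x ^ 4 / 24 - x ^ 6 / 720))
    by integrate S5.
  assert (Hsym : cos (Rabs x) = cos x).
  { unfold Rabs; destruct (Rcase_abs x); [apply cos_neg|reflexivity]. }
  pose proof (Rabs_pos x) as Hx.
  specialize (C2 _ Hx); specialize (C4 _ Hx); specialize (C6 _ Hx).
  replace (Rabs x ^ 4) with (x ^ 4) in *
    by (change 4%nat with (2 * 2)%nat; rewrite !pow_mult, pow2_abs; reflexivity).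
  replace (Rabs x ^ 6) with (x ^ 6) in *
    by (change 6%nat with (2 * 3)%nat; rewrite !pow_mult, pow2_abs; reflexivity).
  rewrite Hsym, pow2_abs in *.
  repeat split; try (apply Rabs_le; split); lra.
Qed.

(* Half the second derivative of [wt q] at 0. *)
Definition wcurv (q : R) : R := -2 * Series (fun j => INR j ^ 2 * wcoef q j).

(** Each coefficient is a difference over two steps, that is a sum of two consecutive differences,
    so the alternating signs make the sum telescope. *)
Lemma wcoef_partial_sum (q : R) (J : nat) :
  sumR (wcoef q) (S J) = (-1) ^ J * (gq q (S J) - gq q J).
Proof.
  induction J as [|J IH].
  - replace (gq q 0) with 0 by (unfold gq; simpl; field); simpl; ring.
  - change (sumR (wcoef q) (S (S J))) with (sumR (wcoef q) (S J) + wcoef q (S J)).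
    rewrite IH; unfold wcoef; simpl; ring.
Qed.

Lemma pow_lim_0 (q : R) : 0 < q < 1 -> is_lim_seq (fun n => q ^ n) 0.
Proof. intros Hq; apply is_lim_seq_geom; rewrite Rabs_pos_eq; lra. Qed.

Lemma gq_lim (q : R) : 0 < q < 1 -> is_lim_seq (gq q) 1.
Proof.
  intros Hq; pose proof (pow_lim_0 q Hq) as H.
  replace 1 with ((1 - 0) / (1 + 0)) by field.
  apply is_lim_seq_div'; [apply is_lim_seq_minus'|apply is_lim_seq_plus'|lra];
    try apply is_lim_seq_const; exact H.
Qed.

Lemma is_lim_seq_sign_mult (u : nat -> R) :
  is_lim_seq u 0 -> is_lim_seq (fun n => (-1) ^ n * u n) 0.
Proof.
  intros H; apply is_lim_seq_abs_0.
  apply (is_lim_seq_ext (fun n => Rabs (u n))).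
  - intros n; rewrite Rabs_mult, pow_1_abs; ring.
  - apply (is_lim_seq_abs_0 u), H.
Qed.

(** The weight thus vanishes at the origin; being even, it vanishes there to second order. *)
Lemma wcoef_sum_0 (q : R) : 0 < q < 1 -> is_series (wcoef q) 0.
Proof.
  intros Hq; apply is_series_sumR, is_lim_seq_incr_1.
  apply (is_lim_seq_ext (fun J => (-1) ^ J * (gq q (S J) - gq q J)));
    [intros J; symmetry; apply wcoef_partial_sum|].
  apply is_lim_seq_sign_mult.
  replace 0 with (1 - 1) by ring.
  apply is_lim_seq_minus'; [apply (is_lim_seq_incr_1 (gq q))|]; apply gq_lim, Hq.
Qed.

Lemma ex_series_wcoef_moment (q : R) (p : nat) :
  0 < q < 1 -> ex_series (fun j => INR j ^ p * wcoef q j).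
Proof.
  intros Hq; apply (ex_series_abs_le _ (fun j => INR (S j) ^ p * Rabs (wcoef q j)));
    [|apply ex_series_wcoef, Hq].
  intros j; rewrite Rabs_mult, (Rabs_pos_eq (INR j ^ p)) by (apply pow_le, pos_INR).
  apply Rmult_le_compat_r; [apply Rabs_pos|].
  apply pow_incr; split; [apply pos_INR|rewrite S_INR; lra].
Qed.

(** Taylor's bound for the cosine is applied in each term of the series; the fourth moments of the
    coefficients converge, and the constant term is [wcoef_sum_0]. *)
Lemma wt_expansion (q : R) : 0 < q < 1 ->
  exists K, 0 <= K /\ forall x, Rabs (wt q x - wcurv q * x ^ 2) <= K * x ^ 4.
Proof.
  intros Hq.
  set (K := Series (fun j => INR (S j) ^ 4 * Rabs (wcoef q j))).
  assert (H : forall x, Rabs (wt q x - wcurv q * x ^ 2) <= K * x ^ 4).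
  { intros x.
    pose proof (is_series_unique _ _ (wcoef_sum_0 q Hq)) as H0.
    assert (E : wt q x - wcurv q * x ^ 2 =
      Series (fun j => wcoef q j * (cos (2 * INR j * x) - (1 - (2 * INR j * x) ^ 2 / 2)))).
    { unfold wcurv, wt.
      transitivity (Series (fun j => wcoef q j * cos (2 * INR j * x)) - Series (wcoef q)
        + 2 * x ^ 2 * Series (fun j => INR j ^ 2 * wcoef q j)); [rewrite H0; ring|].
      rewrite <- Series_minus, <- Series_scal_l, <- Series_plus.
      - apply Series_ext; intros j; field.
      - apply (ex_series_minus (V := RV));
          [apply ex_series_wt, Hq|eexists; apply (wcoef_sum_0 q Hq)].
      - apply (ex_series_scal (2 * x ^ 2) (fun j => INR j ^ 2 * wcoef q j)),
          ex_series_wcoef_moment, Hq.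
      - apply ex_series_wt, Hq.
      - eexists; apply (wcoef_sum_0 q Hq). }
    rewrite E; unfold K; rewrite Rmult_comm, <- Series_scal_l.
    apply Series_abs_le.
    - intros j; rewrite Rabs_mult.
      pose proof (proj1 (proj2 (cos_taylor_bounds (2 * INR j * x)))) as Hc.
      apply Rle_trans with (Rabs (wcoef q j) * ((2 * INR j * x) ^ 4 / 24)).
      { apply Rmult_le_compat_l; [apply Rabs_pos|exact Hc]. }
      assert (Hp : 0 <= INR j ^ 4 <= INR (S j) ^ 4).
      { pose proof (pos_INR j); split; [apply pow_le|apply pow_incr; rewrite S_INR]; lra. }
      replace ((2 * INR j * x) ^ 4 / 24) with (2 / 3 * INR j ^ 4 * x ^ 4)
        by (rewrite !Rpow_mult_distr; field).
      assert (Hx : 0 <= x ^ 4) by (replace (x ^ 4) with ((x ^ 2) ^ 2) by ring; apply pow2_ge_0).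
      pose proof (Rabs_pos (wcoef q j)) as Hw.
      assert (0 <= x ^ 4 * Rabs (wcoef q j)) by (apply Rmult_le_pos; assumption).
      replace (Rabs (wcoef q j) * (2 / 3 * INR j ^ 4 * x ^ 4))
        with (x ^ 4 * Rabs (wcoef q j) * (2 / 3 * INR j ^ 4)) by ring.
      replace (x ^ 4 * (INR (S j) ^ 4 * Rabs (wcoef q j)))
        with (x ^ 4 * Rabs (wcoef q j) * INR (S j) ^ 4) by ring.
      apply Rmult_le_compat_l; lra.
    - apply (ex_series_scal (x ^ 4) (fun j => INR (S j) ^ 4 * Rabs (wcoef q j))),
        ex_series_wcoef, Hq. }
  exists K; split; [|exact H].
  specialize (H 1); rewrite !pow1, !Rmult_1_r in H.
  apply Rle_trans with (2 := H), Rabs_pos.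
Qed.

(** * Jacobi's product for the curvature *)

Lemma sum_n_abs_le (f g : nat -> R) (N : nat) :
  (forall n, Rabs (f n) <= g n) -> Rabs (sum_n f N) <= sum_n g N.
Proof.
  intros H; induction N as [|N IH]; [rewrite !sum_O; apply H|].
  rewrite !sum_Sn; apply Rle_trans with (1 := Rabs_triang _ _).
  apply Rplus_le_compat; [exact IH|apply H].
Qed.

(** Cutting every row at [N] costs at most the sum of [u] times the tail of [v]. *)
Lemma square_partial_sums_lim (a : nat -> nat -> R) (u v : nat -> R) :
  (forall n m, Rabs (a n m) <= u n * v m) -> ex_series u -> ex_series v ->
  is_lim_seq (fun N => sum_n (fun n => sum_n (a n) N) N) (Series (fun n => Series (a n))).
Proof.
  intros H Hu Hv.
  assert (Hrow : forall n, ex_series (fun m => u n * v m))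
    by (intros n; apply (ex_series_scal (u n) v), Hv).
  assert (Hex : ex_series (fun n => Series (a n))).
  { apply (ex_series_abs_le _ (fun n => u n * Series v)).
    - intros n; rewrite <- Series_scal_l; apply Series_abs_le; auto.
    - apply (ex_series_ext (fun n => Series v * u n)); [intros n; apply Rmult_comm|].
      apply (ex_series_scal (Series v) u), Hu. }
  apply (is_lim_seq_ext (fun N => sum_n (fun n => Series (a n)) N -
    sum_n (fun n => Series (a n) - sum_n (a n) N) N)).
  { intros N.
    assert (E : forall f g : nat -> R, forall M,
      sum_n f M - sum_n (fun n => f n - g n) M = sum_n g M).
    { intros f g M; induction M as [|M IH]; [rewrite !sum_O; ring|].
      rewrite !sum_Sn, <- IH; change plus with Rplus; ring. }
    apply E. }
  replace (Finite (Series (fun n => Series (a n))))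
    with (Finite (Series (fun n => Series (a n)) - 0)) by (f_equal; ring).
  apply is_lim_seq_minus'; [apply (Series_correct _ Hex)|].
  assert (Hlim : is_lim_seq (fun N => sum_n u N * (Series v - sum_n v N)) (Series u * 0)).
  { apply is_lim_seq_mult'; [apply (Series_correct u Hu)|].
    replace (Finite 0) with (Finite (Series v - Series v)) by (f_equal; ring).
    apply is_lim_seq_minus'; [apply is_lim_seq_const|apply (Series_correct v Hv)]. }
  rewrite Rmult_0_r in Hlim.
  apply is_lim_seq_abs_le_0 with (2 := Hlim); intros N.
  replace (sum_n u N * (Series v - sum_n v N))
    with (sum_n (fun n => u n * (Series v - sum_n v N)) N)
    by (apply (sum_n_mult_r (K := R_Ring) (Series v - sum_n v N) u)).
  apply sum_n_abs_le; intros n.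
  replace (u n * (Series v - sum_n v N))
    with (Series (fun m => u n * v m) - sum_n (fun m => u n * v m) N).
  - apply Series_tail_abs_le; auto.
  - rewrite Series_scal_l.
    replace (sum_n (fun m => u n * v m) N) with (u n * sum_n v N)
      by (symmetry; apply (sum_n_mult_l (K := R_Ring) (u n) v)).
    ring.
Qed.

(** Sums over squares are symmetric in the two indices, so both iterated sums are limits of one
    sequence. *)
Lemma Series_exchange (a : nat -> nat -> R) (u v : nat -> R) :
  (forall n m, Rabs (a n m) <= u n * v m) -> ex_series u -> ex_series v ->
  Series (fun n => Series (a n)) = Series (fun m => Series (fun n => a n m)).
Proof.
  intros H Hu Hv.
  pose proof (square_partial_sums_lim a u v H Hu Hv) as H1.
  pose proof (square_partial_sums_lim (fun m n => a n m) v u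
    (fun m n => Rle_trans _ _ _ (H n m) (Req_le _ _ (Rmult_comm _ _))) Hv Hu) as H2.
  apply (is_lim_seq_ext _ (fun N => sum_n (fun m => sum_n (fun n => a n m) N) N)) in H1;
    [|intros N; apply sum_n_switch].
  pose proof (is_lim_seq_unique _ _ H1) as E1; pose proof (is_lim_seq_unique _ _ H2) as E2.
  assert (E : Finite (Series (fun n => Series (a n)))
    = Finite (Series (fun m => Series (fun n => a n m)))) by (rewrite <- E1; exact E2).
  injection E; auto.
Qed.

Lemma is_series_arith_geom (z : R) : 0 < Rabs z < 1 ->
  is_series (fun n => INR (S n) * z ^ S n) (z / (1 - z) ^ 2).
Proof.
  intros Hz.
  assert (Hz1 : 1 - z <> 0) by (intros E; replace z with 1 in Hz by lra; rewrite Rabs_R1 in Hz; lra).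
  assert (L : is_lim_seq (fun n => INR (S n) * z ^ n) 0).
  { apply is_lim_seq_abs_0, (is_lim_seq_ext (fun n => INR (S n) ^ 1 * Rabs z ^ n)).
    - intros n; rewrite Rabs_mult, RPow_abs, pow_1, (Rabs_pos_eq (INR _)); [reflexivity|].
      apply pos_INR.
    - apply (ex_series_lim_0 _ (ex_series_poly_geom (Rabs z) 1 Hz)). }
  assert (L0 : is_lim_seq (fun n => z ^ n) 0) by (apply is_lim_seq_geom; lra).
  apply is_series_sumR.
  apply (is_lim_seq_ext (fun N => (z - z * (1 - z) * (INR (S N) * z ^ N) - z ^ 2 * z ^ N)
    / (1 - z) ^ 2)).
  - induction n as [|n IH].
    + simpl; field; exact Hz1.
    + change (sumR ?f (S n)) with (sumR f n + f n); rewrite <- IH.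
      rewrite (S_INR (S n)); simpl (z ^ S n); field; exact Hz1.
  - replace (z / (1 - z) ^ 2) with ((z - z * (1 - z) * 0 - z ^ 2 * 0) / (1 - z) ^ 2)
      by (field; exact Hz1).
    apply is_lim_seq_div'; [|apply is_lim_seq_const|apply pow_nonzero, Hz1].
    repeat apply is_lim_seq_minus'; try apply is_lim_seq_mult';
      try apply is_lim_seq_const; assumption.
Qed.

Lemma is_series_eq (f g : nat -> R) (l : R) :
  (forall n, f n = g n) -> is_series f l -> is_series g l.
Proof. intros H; apply is_series_ext, H. Qed.

(** Both sides are iterated sums of the double series [a]: its rows are geometric, its columns of
    the form [sum n z^n] with [z = - q ^ S m]. *)
Lemma lambert_exchange (q : R) : 0 < q < 1 ->
  Series (fun n => (-1) ^ S n * (INR (S n) * q ^ S n / (1 + q ^ S n)))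
  = Series (fun n => (-1) ^ S n * (q ^ S n / (1 + q ^ S n) ^ 2)).
Proof.
  intros Hq.
  set (a := fun n m => INR (S n) * (-1) ^ S n * (-1) ^ m * q ^ (S n * S m)).
  assert (Hpow : forall n m, (-1) ^ n * q ^ (n * m) = (- q ^ m) ^ n).
  { intros n m; rewrite Nat.mul_comm, pow_mult.
    replace (- q ^ m) with (-1 * q ^ m) by ring; rewrite Rpow_mult_distr; reflexivity. }
  assert (Hneg : forall n, 0 < Rabs (- q ^ S n) < 1).
  { intros n; rewrite Rabs_Ropp, Rabs_pos_eq by (apply pow_le; lra).
    split; [apply pow_lt; lra|apply pow_lt_1; [lra|lia]]. }
  transitivity (Series (fun n => Series (a n))).
  - apply Series_ext; intros n; symmetry; apply is_series_unique.
    pose proof (is_series_scal (INR (S n) * (-1) ^ S n * q ^ S n) _ _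
      (is_series_geom (- q ^ S n) ltac:(apply (Hneg n)))) as H.
    replace ((-1) ^ S n * (INR (S n) * q ^ S n / (1 + q ^ S n)))
      with (INR (S n) * (-1) ^ S n * q ^ S n * / (1 - - q ^ S n)).
    + apply (is_series_eq (fun m => INR (S n) * (-1) ^ S n * q ^ S n * (- q ^ S n) ^ m));
        [|exact H].
      intros m; unfold a; rewrite <- Hpow.
      replace (S n * S m)%nat with (S n + m * S n)%nat by lia.
      rewrite (pow_add q (S n)); ring.
    + pose proof (pow_bounds_01 q (S n) Hq); field; lra.
  - rewrite (Series_exchange a (fun n => INR (S n) ^ 1 * q ^ n) (fun m => q ^ m)).
    + apply Series_ext; intros m; apply is_series_unique.
      pose proof (is_series_scal ((-1) ^ m) _ _ (is_series_arith_geom (- q ^ S m) (Hneg m))) as H.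
      replace ((-1) ^ S m * (q ^ S m / (1 + q ^ S m) ^ 2))
        with ((-1) ^ m * (- q ^ S m / (1 - - q ^ S m) ^ 2)).
      * apply (is_series_eq (fun n => (-1) ^ m * (INR (S n) * (- q ^ S m) ^ S n)));
          [|exact H].
        intros n; unfold a; rewrite <- (Hpow (S n) (S m)); ring.
      * pose proof (pow_bounds_01 q (S m) Hq).
        replace ((-1) ^ S m) with (- (-1) ^ m) by (simpl; ring); field; lra.
    + intros n m; unfold a.
      rewrite !Rabs_mult, !pow_1_abs, (Rabs_pos_eq (INR _)) by apply pos_INR.
      rewrite Rabs_pos_eq by (apply pow_le; lra); rewrite pow_1.
      (* Dropping the last summand of the exponent leaves a product of a function of [n] and a
         function of [m], as [Series_exchange] requires. *)
      replace (S n * S m)%nat with (n + m + (n * m + 1))%nat by lia.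
      rewrite !pow_add.
      pose proof (pow_bounds_01 q n Hq); pose proof (pow_bounds_01 q m Hq).
      pose proof (pow_bounds_01 q (n * m) Hq); pose proof (pos_INR (S n)).
      assert (0 < q ^ (n * m) * q ^ 1 <= 1) by (simpl; nra).
      assert (0 <= INR (S n) * q ^ n * q ^ m) by (repeat apply Rmult_le_pos; lra).
      nra.
    + apply ex_series_poly_geom, Hq.
    + eexists; apply is_series_geom; rewrite Rabs_pos_eq; lra.
Qed.

(** Summation by parts with [gq q j = 1 - 2 h_j], [h_j = q ^ j / (1 + q ^ j)]. The coefficient of
    [h_i] contains [(i - 1)^2 - (i + 1)^2 = - 4 i]; the isolated 1 is [2 h_0], and the last line
    holds the boundary terms at [J]. *)
Lemma wcoef_second_moment_partial (q : R) (J : nat) : 0 < q < 1 ->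
  sumR (fun j => INR j ^ 2 * wcoef q j) (S J)
  = - (1 + 8 * sumR (fun i => (-1) ^ i * (INR i * q ^ i / (1 + q ^ i))) J)
    + (-1) ^ J * (2 * (INR J - 1) ^ 2 * (q ^ J / (1 + q ^ J))
                  - 2 * INR J ^ 2 * (q ^ S J / (1 + q ^ S J))).
Proof.
  intros Hq; induction J as [|J IH].
  - simpl; pose proof Hq; field; lra.
  - change (sumR ?f (S (S J))) with (sumR f (S J) + f (S J)); rewrite IH.
    change (sumR ?f (S J)) with (sumR f J + f J); cbv beta.
    unfold wcoef, gq; rewrite S_INR; simpl pow.
    pose proof (pow_bounds_01 q J Hq).
    assert (0 < q * q ^ J) by (apply Rmult_lt_0_compat; lra).
    assert (0 < q * (q * q ^ J)) by (apply Rmult_lt_0_compat; lra).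
    field; repeat split; lra.
Qed.

(** Since [4 q ^ n / (1 + q ^ n) ^ 2 = 1 / cosh^2 (kappa n)], the bracket is the bilateral sum
    folded at 0. *)
Lemma wcurv_lambert (q : R) : 0 < q < 1 ->
  wcurv q = 2 * (1 + 2 * Series (fun n => (-1) ^ S n * (4 * q ^ S n / (1 + q ^ S n) ^ 2))).
Proof.
  intros Hq.
  set (f := fun i => (-1) ^ i * (INR i * q ^ i / (1 + q ^ i))).
  assert (Hden : forall n x, 0 <= x -> Rabs (x * (q ^ n / (1 + q ^ n))) <= x * q ^ n).
  { intros n x Hx; pose proof (pow_bounds_01 q n Hq) as Hn.
    assert (0 <= q ^ n / (1 + q ^ n)) by (apply Rdiv_le_0_compat; lra).
    rewrite Rabs_pos_eq by (apply Rmult_le_pos; assumption).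
    apply Rmult_le_compat_l; [exact Hx|].
    apply (Rmult_le_reg_r (1 + q ^ n)); [lra|].
    unfold Rdiv; rewrite Rmult_assoc, Rinv_l by lra; nra. }
  assert (Hf : ex_series f).
  { apply (ex_series_abs_le _ (fun n => INR (S n) ^ 1 * q ^ n));
      [|apply ex_series_poly_geom, Hq].
    intros n; unfold f; rewrite Rabs_mult, pow_1_abs, Rmult_1_l.
    replace (INR n * q ^ n / (1 + q ^ n)) with (INR n * (q ^ n / (1 + q ^ n)))
      by (unfold Rdiv; ring).
    apply Rle_trans with (1 := Hden n (INR n) (pos_INR n)).
    rewrite pow_1, S_INR; pose proof (pow_bounds_01 q n Hq); nra. }
  assert (Hz : forall u : nat -> R, (forall n, 0 <= u n <= 2 * INR (S n) ^ 2) ->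
    is_lim_seq (fun n => u n * (q ^ n / (1 + q ^ n))) 0).
  { intros u Hu; apply (is_lim_seq_abs_le_0 _ (fun n => 2 * (INR (S n) ^ 2 * q ^ n))).
    - intros n; apply Rle_trans with (1 := Hden n (u n) (proj1 (Hu n))).
      pose proof (pow_bounds_01 q n Hq); pose proof (Hu n); nra.
    - replace (Finite 0) with (Finite (2 * 0)) by (f_equal; ring).
      apply is_lim_seq_mult'; [apply is_lim_seq_const|].
      apply (ex_series_lim_0 _ (ex_series_poly_geom q 2 Hq)). }
  assert (HS : is_series (fun j => INR j ^ 2 * wcoef q j) (- (1 + 8 * Series f) + 0)).
  { apply is_series_sumR, is_lim_seq_incr_1.
    eapply is_lim_seq_ext; [intros J; symmetry; apply wcoef_second_moment_partial, Hq|].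
    apply is_lim_seq_plus'.
    - apply (is_lim_seq_opp _ (1 + 8 * Series f)), is_lim_seq_plus';
        [apply is_lim_seq_const|apply is_lim_seq_mult'; [apply is_lim_seq_const|]].
      apply is_lim_seq_incr_1.
      apply (is_lim_seq_ext (sum_n f)); [intros N; apply sum_n_sumR|].
      apply (Series_correct f Hf).
    - apply is_lim_seq_sign_mult.
      replace (Finite 0) with (Finite (0 - 0)) by (f_equal; ring).
      apply is_lim_seq_minus'.
      + apply (Hz (fun n => 2 * (INR n - 1) ^ 2)).
        intros n; cbv beta; rewrite S_INR; pose proof (pos_INR n).
        pose proof (pow2_ge_0 (INR n - 1)); split; simpl in *; lra.
      + apply (is_lim_seq_ext (fun n => 2 * INR (pred (S n)) ^ 2 * (q ^ S n / (1 + q ^ S n))));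
          [reflexivity|].
        apply (is_lim_seq_incr_1 (fun n => 2 * INR (pred n) ^ 2 * (q ^ n / (1 + q ^ n)))).
        apply (Hz (fun n => 2 * INR (pred n) ^ 2)).
        intros n; cbv beta; pose proof (pos_INR (pred n)).
        split; [pose proof (pow2_ge_0 (INR (pred n))); lra|].
        apply Rmult_le_compat_l; [lra|]; apply pow_incr; split; [assumption|].
        apply le_INR; lia. }
  unfold wcurv; rewrite (is_series_unique _ _ HS).
  rewrite (Series_incr_1 f Hf); unfold f; rewrite lambert_exchange by exact Hq.
  rewrite (Series_ext (fun n => (-1) ^ S n * (4 * q ^ S n / (1 + q ^ S n) ^ 2))
    (fun n => 4 * ((-1) ^ S n * (q ^ S n / (1 + q ^ S n) ^ 2))))
    by (intros n; unfold Rdiv; ring).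
  rewrite Series_scal_l; simpl (INR 0); unfold Rdiv; ring.
Qed.

(* Half of the bilateral sum of a finite form of Jacobi's identity. *)
Definition jacobi_half_sum (q : R) (N J : nat) : R :=
  acoef q N ^ 2 * (acoef q N ^ 2 / 2 +
    sumR (fun i => (-1) ^ S i * (4 * q ^ S i / (1 + q ^ S i) ^ 2)
                   * (acoef q (N + S i) * acoef q (N - S i))) J).

Lemma jacobi_half_sum_S (q : R) (M J : nat) :
  jacobi_half_sum q M (S J) = jacobi_half_sum q M J
    + acoef q M ^ 2 * ((-1) ^ S J * (4 * q ^ S J / (1 + q ^ S J) ^ 2)
        * (acoef q (M + S J) * acoef q (M - S J))).
Proof.
  unfold jacobi_half_sum; change (sumR ?f (S J)) with (sumR f J + f J); cbv beta; ring.
Qed.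

(* The WZ certificate of [jacobi_finite]. *)
Lemma jacobi_half_sum_step (q : R) (N J : nat) : 0 < q < 1 -> (J <= N)%nat ->
  jacobi_half_sum q (S N) J - jacobi_half_sum q N J
  = (-1) ^ J * (acoef q N ^ 2 * (4 * q ^ S N * (1 + (q ^ S N) ^ 2)
       / ((1 - q ^ S N) ^ 2 * (1 - (q ^ S N) ^ 2)))
     * (acoef q (S N + J) * acoef q (N - J))).
Proof.
  intros Hq.
  pose proof (pow_bounds_01 q (S N) Hq) as HQ; pose proof (pow_lt_1 q (S N) Hq ltac:(lia)) as HQ1.
  induction J as [|J IH]; intros HJ.
  - unfold jacobi_half_sum; simpl sumR; rewrite Nat.add_0_r, Nat.sub_0_r.
    rewrite acoef_S by exact Hq.
    change (q * q ^ N) with (q ^ S N); set (Q := q ^ S N) in *.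
    rewrite pow_O; field; split; nra.
  - specialize (IH ltac:(lia)).
    rewrite !jacobi_half_sum_S.
    transitivity ((jacobi_half_sum q (S N) J - jacobi_half_sum q N J)
      + (acoef q (S N) ^ 2 * ((-1) ^ S J * (4 * q ^ S J / (1 + q ^ S J) ^ 2)
          * (acoef q (S N + S J) * acoef q (S N - S J)))
        - acoef q N ^ 2 * ((-1) ^ S J * (4 * q ^ S J / (1 + q ^ S J) ^ 2)
          * (acoef q (N + S J) * acoef q (N - S J))))); [ring|rewrite IH; clear IH].
    set (d := (N - S J)%nat).
    replace (S N - S J)%nat with (S d) by (unfold d; lia).
    replace (N - J)%nat with (S d) by (unfold d; lia).
    replace (S N + S J)%nat with (S (N + S J)) by lia.
    replace (S N + J)%nat with (N + S J)%nat by lia.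
    rewrite (acoef_S q N Hq), (acoef_S q (N + S J) Hq), (acoef_S q d Hq).
    pose proof (pow_bounds_01 q (S J) Hq) as HX.
    pose proof (pow_lt_1 q (S d) Hq ltac:(lia)) as Hd1.
    pose proof (pow_bounds_01 q (S d) Hq) as Hd2.
    assert (Hd : q * q ^ d = q ^ S N / q ^ S J).
    { apply (Rmult_eq_reg_r (q ^ S J)); [|lra].
      unfold Rdiv; rewrite (Rmult_assoc (q ^ S N)), Rinv_l, Rmult_1_r by lra.
      change (q * q ^ d) with (q ^ S d); rewrite <- pow_add; f_equal; unfold d; lia. }
    change (q ^ S d) with (q * q ^ d) in Hd1, Hd2; rewrite Hd in *.
    replace (q * q ^ (N + S J)) with (q ^ S N * q ^ S J) by (rewrite pow_add; simpl; ring).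
    change (q * q ^ N) with (q ^ S N).
    replace ((-1) ^ S J) with (- (-1) ^ J) by (simpl; ring).
    (* All powers are now expressed by [Q] and [X], and the certificate is a rational identity in
       these two variables. *)
    set (Q := q ^ S N) in *; set (X := q ^ S J) in *.
    assert (HXQ : X - Q <> 0).
    { intros Eq; replace X with Q in Hd1 by lra; unfold Rdiv in Hd1; rewrite Rinv_r in Hd1; lra. }
    field; repeat split; nra.
Qed.

(** Passing from [N] to [S N] changes the old terms by the certificate at [J = N] and adds one new
    term; the two cancel. *)
Lemma jacobi_finite (q : R) (N : nat) : 0 < q < 1 -> 2 * jacobi_half_sum q N N = 1.
Proof.
  intros Hq; induction N as [|N IH].
  - unfold jacobi_half_sum; simpl; rewrite acoef_0; field.
  - rewrite <- IH; f_equal.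
    pose proof (jacobi_half_sum_step q N N Hq (le_n N)) as E.
    rewrite jacobi_half_sum_S.
    replace (jacobi_half_sum q (S N) N) with (jacobi_half_sum q N N +
      (jacobi_half_sum q (S N) N - jacobi_half_sum q N N)) by ring.
    rewrite E, !Nat.sub_diag, acoef_0.
    replace (S N + S N)%nat with (S (S N + N)) by lia.
    rewrite (acoef_S q (S N + N) Hq), (acoef_S q N Hq).
    replace (q * q ^ (S N + N)) with (q ^ S N * q ^ S N) 
      by (rewrite <- pow_add; change (q ^ (S N + S N) = q ^ S (S N + N)); f_equal; lia).
    change (q * q ^ N) with (q ^ S N).
    pose proof (pow_bounds_01 q (S N) Hq) as HQ; pose proof (pow_lt_1 q (S N) Hq ltac:(lia)) as HQ1.
    replace ((-1) ^ S N) with (- (-1) ^ N) by (simpl; ring).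
    set (Q := q ^ S N) in *; field; repeat split; nra.
Qed.

Lemma acoef_cauchy (q : R) : 0 < q < 1 ->
  exists A K, 0 <= A /\ 0 <= K /\ (forall n, acoef q n <= A) /\
    forall n i, 0 <= acoef q (n + i) - acoef q n <= K * q ^ n.
Proof.
  intros Hq; destruct (acoef_bounded q Hq) as [A HA].
  assert (HA0 : 0 < A) by (pose proof (acoef_ge_1 q 0 Hq); pose proof (HA O); lra).
  set (c := A * (2 / (1 - q))).
  assert (Hc : 0 < c) by (apply Rmult_lt_0_compat; [|apply Rdiv_lt_0_compat]; lra).
  exists A, (c / (1 - q)); split; [lra|split; [apply Rdiv_le_0_compat; lra|split; [exact HA|]]].
  intros n i.
  pose proof (pow_bounds_01 q n Hq) as Hn.
  assert (H : 0 <= acoef q (n + i) - acoef q n <= c / (1 - q) * q ^ n * (1 - q ^ i)).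
  { induction i as [|i IH]; [rewrite Nat.add_0_r; simpl; lra|].
    pose proof (acoef_increment q (n + i) Hq) as HI; rewrite Nat.add_succ_r.
    assert (acoef q (n + i) * (2 / (1 - q) * q ^ (n + i)) <= c * (q ^ n * q ^ i)).
    { rewrite pow_add; unfold c; rewrite (Rmult_assoc A).
      pose proof (pow_bounds_01 q i Hq); pose proof (acoef_pos q (n + i) Hq).
      apply Rmult_le_compat_r; [|apply HA].
      apply Rmult_le_pos; [apply Rdiv_le_0_compat; lra|nra]. }
    replace (c / (1 - q) * q ^ n * (1 - q ^ S i))
      with (c / (1 - q) * q ^ n * (1 - q ^ i) + c * (q ^ n * q ^ i)) by (simpl; field; lra).
    lra. }
  split; [apply H|apply Rle_trans with (1 := proj2 H)].
  pose proof (pow_bounds_01 q i Hq).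
  assert (0 <= c / (1 - q) * q ^ n)
    by (apply Rmult_le_pos; [apply Rdiv_le_0_compat|]; lra).
  nra.
Qed.

(** Divide the finite identity by the fourth power of [acoef q N]. The ratio in term [S i] differs
    from 1 by a multiple of [q ^ (N - S i)], while the term itself carries [q ^ S i]; the total
    error is of order [N q ^ N]. *)
Lemma jacobi_limit (q : R) : 0 < q < 1 ->
  is_lim_seq (fun N => (/ acoef q N) ^ 4)
    (1 + 2 * Series (fun n => (-1) ^ S n * (4 * q ^ S n / (1 + q ^ S n) ^ 2))).
Proof.
  intros Hq.
  set (f := fun n => (-1) ^ S n * (4 * q ^ S n / (1 + q ^ S n) ^ 2)).
  assert (Hf : forall n, Rabs (f n) <= 4 * q ^ S n).
  { intros n; pose proof (pow_bounds_01 q (S n) Hq) as Hn.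
    unfold f; rewrite Rabs_mult, pow_1_abs, Rmult_1_l.
    rewrite Rabs_pos_eq by (apply Rdiv_le_0_compat; [lra|apply pow_lt; lra]).
    apply (Rmult_le_reg_r ((1 + q ^ S n) ^ 2)); [apply pow_lt; lra|].
    unfold Rdiv; rewrite Rmult_assoc, Rinv_l by (apply pow_nonzero; lra).
    assert (1 <= (1 + q ^ S n) ^ 2) by nra; nra. }
  assert (Hex : ex_series f).
  { apply (ex_series_abs_le _ (fun n => 4 * q * q ^ n)).
    - intros n; apply Rle_trans with (1 := Hf n); right; simpl; ring.
    - apply (ex_series_scal (4 * q) (fun n => q ^ n)).
      eexists; apply is_series_geom; rewrite Rabs_pos_eq; lra. }
  destruct (acoef_cauchy q Hq) as [A [K [HA0 [HK0 [HA HK]]]]].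
  assert (Hdiff : forall N, Rabs ((/ acoef q N) ^ 4 - (1 + 2 * sumR f N))
    <= 2 * (INR N * (8 * A * K * q ^ N))).
  { intros N.
    pose proof (acoef_ge_1 q N Hq) as Ha.
    assert (E : (/ acoef q N) ^ 4 - (1 + 2 * sumR f N)
      = 2 * sumR (fun i => f i * ((acoef q (N + S i) * acoef q (N - S i) - acoef q N ^ 2)
                                  * (/ acoef q N) ^ 2)) N).
    { pose proof (jacobi_finite q N Hq) as J; unfold jacobi_half_sum in J.
      fold f in J.
      rewrite (sumR_ext (fun i => f i * ((acoef q (N + S i) * acoef q (N - S i) - acoef q N ^ 2)
          * (/ acoef q N) ^ 2))
        (fun i => (/ acoef q N) ^ 2 * (f i * (acoef q (N + S i) * acoef q (N - S i))) + -1 * f i))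
        by (intros i _; field; lra).
      rewrite sumR_plus, !sumR_scal_l.
      rewrite (sumR_ext _ (fun i => f i * (acoef q (N + S i) * acoef q (N - S i)))) in J
        by (intros i _; unfold f; ring).
      set (s := sumR (fun i => f i * (acoef q (N + S i) * acoef q (N - S i))) N) in *.
      assert (Hs : s = (/ acoef q N ^ 2 - acoef q N ^ 2) / 2).
      { apply (Rmult_eq_reg_l (2 * acoef q N ^ 2)); [|nra].
        transitivity (1 - acoef q N ^ 4); [rewrite <- J at 1; field|field; lra]. }
      rewrite Hs; field; lra. }
    rewrite E, Rabs_mult, Rabs_pos_eq by lra.
    apply Rmult_le_compat_l; [lra|].
    apply sumR_abs_le; intros i Hi.
    pose proof (HK N (S i)) as H1; pose proof (HK (N - S i)%nat (S i)) as H2.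
    replace (N - S i + S i)%nat with N in H2 by lia.
    pose proof (HA (N + S i)%nat) as H3; pose proof (HA N) as H4.
    pose proof (acoef_pos q (N + S i) Hq) as H5.
    pose proof (pow_bounds_01 q (N - S i) Hq) as P1; pose proof (pow_bounds_01 q (S i) Hq) as P2.
    assert (Hpow : q ^ N = q ^ (N - S i) * q ^ S i) by (rewrite <- pow_add; f_equal; lia).
    rewrite Hpow in *.
    set (x := q ^ (N - S i)) in *; set (y := q ^ S i) in *.
    assert (Hxy : K * (x * y) <= K * x) by (apply Rmult_le_compat_l; nra).
    assert (HX : Rabs (acoef q (N + S i) * acoef q (N - S i) - acoef q N ^ 2) <= 2 * A * (K * x)).
    { replace (acoef q (N + S i) * acoef q (N - S i) - acoef q N ^ 2)
        with (acoef q N * (acoef q (N + S i) - acoef q N)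
              - acoef q (N + S i) * (acoef q N - acoef q (N - S i))) by ring.
      assert (0 <= acoef q N * (acoef q (N + S i) - acoef q N) <= A * (K * x))
        by (split; [apply Rmult_le_pos|apply Rmult_le_compat]; lra).
      assert (0 <= acoef q (N + S i) * (acoef q N - acoef q (N - S i)) <= A * (K * x))
        by (split; [apply Rmult_le_pos|apply Rmult_le_compat]; lra).
      apply Rabs_le; split; lra. }
    rewrite !Rabs_mult.
    assert (Hinv : Rabs ((/ acoef q N) ^ 2) <= 1).
    { rewrite Rabs_pos_eq by apply pow2_ge_0.
      assert (0 < / acoef q N <= 1).
      { split; [apply Rinv_0_lt_compat; lra|]; rewrite <- Rinv_1; apply Rinv_le_contravar; lra. }
      simpl; nra. }
    apply Rle_trans with ((4 * y) * (2 * A * (K * x) * 1)); [|right; ring].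
    apply Rmult_le_compat; [apply Rabs_pos|apply Rmult_le_pos; apply Rabs_pos|apply Hf|].
    apply Rmult_le_compat; try apply Rabs_pos; assumption. }
  assert (H0 : is_lim_seq (fun N => 16 * A * K * (INR (S N) ^ 1 * q ^ N)) (16 * A * K * 0)).
  { apply is_lim_seq_mult'; [apply is_lim_seq_const|].
    apply (ex_series_lim_0 _ (ex_series_poly_geom q 1 Hq)). }
  rewrite Rmult_0_r in H0.
  assert (H1 : is_lim_seq (fun N => (/ acoef q N) ^ 4 - (1 + 2 * sumR f N)) 0).
  { apply is_lim_seq_abs_le_0 with (2 := H0).
    intros N; apply Rle_trans with (1 := Hdiff N).
    pose proof (pow_bounds_01 q N Hq).
    assert (0 <= A * K * q ^ N) by (apply Rmult_le_pos; [apply Rmult_le_pos|]; lra).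
    rewrite pow_1, S_INR; nra. }
  apply (is_lim_seq_ext (fun N => ((/ acoef q N) ^ 4 - (1 + 2 * sumR f N)) + (1 + 2 * sumR f N)));
    [intros N; ring|].
  replace (Finite (1 + 2 * Series f)) with (Finite (0 + (1 + 2 * Series f))) by (f_equal; ring).
  apply is_lim_seq_plus'; [exact H1|].
  apply is_lim_seq_plus'; [apply is_lim_seq_const|].
  apply is_lim_seq_mult'; [apply is_lim_seq_const|].
  apply is_lim_seq_incr_1.
  apply (is_lim_seq_ext (sum_n f)); [intros N; apply sum_n_sumR|apply (Series_correct f Hex)].
Qed.

(** [qpoch_inf] is the real part of a limit in the extended reals, so finiteness must be shown. One
    product decreases and is positive, the other increases and is bounded through [acoef]; its limit
    is at least 1, so the quotient makes sense. *)
Lemma qpoch_inf_quotient_lim (q : R) : 0 < q < 1 ->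
  is_lim_seq (fun N => / acoef q N) (qpoch_inf q q / qpoch_inf (- q) q).
Proof.
  intros Hq.
  assert (H1 : ex_finite_lim_seq (qpoch q q)).
  { apply (ex_finite_lim_seq_decr _ 0); [|intros n; apply Rlt_le, qpoch_q_pos, Hq].
    intros n; simpl; pose proof (qpoch_q_pos q n Hq); pose proof (pow_bounds_01 q (S n) Hq) as P.
    simpl in P; nra. }
  assert (Hle : forall n, qpoch q q n <= 1).
  { induction n as [|n IH]; simpl; [lra|].
    pose proof (qpoch_q_pos q n Hq); pose proof (pow_bounds_01 q (S n) Hq) as P.
    simpl in P; nra. }
  assert (Hincr : forall n, qpoch (- q) q n <= qpoch (- q) q (S n)).
  { intros n; simpl; pose proof (qpoch_mq_pos q n Hq).
    pose proof (pow_bounds_01 q (S n) Hq) as P; simpl in P; nra. }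
  assert (H2 : ex_finite_lim_seq (qpoch (- q) q)).
  { destruct (acoef_bounded q Hq) as [A HA].
    apply (ex_finite_lim_seq_incr _ A); [exact Hincr|].
    intros n; pose proof (qpoch_q_pos q n Hq); pose proof (acoef_pos q n Hq).
    replace (qpoch (- q) q n) with (acoef q n * qpoch q q n) by (unfold acoef; field; lra).
    pose proof (HA n); pose proof (Hle n); nra. }
  destruct H1 as [l1 L1]; destruct H2 as [l2 L2]; unfold qpoch_inf.
  change (fun n => qpoch q q n) with (qpoch q q).
  change (fun n => qpoch (- q) q n) with (qpoch (- q) q).
  rewrite (is_lim_seq_unique _ _ L1), (is_lim_seq_unique _ _ L2); simpl.
  apply (is_lim_seq_ext (fun n => qpoch q q n / qpoch (- q) q n)).
  { intros n; unfold acoef; pose proof (qpoch_q_pos q n Hq); pose proof (qpoch_mq_pos q n Hq).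
    field; lra. }
  apply is_lim_seq_div'; [exact L1|exact L2|].
  assert (1 <= l2); [|lra].
  apply (is_lim_seq_le (fun _ => 1) (qpoch (- q) q) 1 l2); [|apply is_lim_seq_const|exact L2].
  induction n as [|n IH]; [simpl; lra|apply Rle_trans with (1 := IH), Hincr].
Qed.

Lemma wcurv_product (q : R) : 0 < q < 1 ->
  wcurv q = 2 * (qpoch_inf q q / qpoch_inf (- q) q) ^ 4.
Proof.
  intros Hq; rewrite wcurv_lambert by exact Hq; f_equal.
  pose proof (jacobi_limit q Hq) as H1; pose proof (qpoch_inf_quotient_lim q Hq) as H2.
  set (l := qpoch_inf q q / qpoch_inf (- q) q) in *.
  assert (H3 : is_lim_seq (fun N => (/ acoef q N) ^ 4) (l ^ 4)).
  { simpl; repeat (apply is_lim_seq_mult'; [exact H2|]); apply is_lim_seq_const. }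
  apply is_lim_seq_unique in H1, H3; rewrite H1 in H3; injection H3; auto.
Qed.

(** * Gaussian moments *)

Lemma RInt_abs_le_RInt (f g : R -> R) (a b : R) :
  (forall x, continuous f x) -> (forall x, continuous g x) -> a <= b ->
  (forall x, a <= x <= b -> Rabs (f x) <= g x) -> Rabs (RInt f a b) <= RInt g a b.
Proof.
  intros Hf Hg Hab H.
  apply Rle_trans with (1 := abs_RInt_le f a b Hab (ex_RInt_cont f a b Hf)).
  apply RInt_le; [exact Hab| |apply ex_RInt_cont, Hg|intros x Hx; apply H; lra].
  apply ex_RInt_cont; intros x.
  apply (continuous_comp f Rabs); [apply Hf|apply continuous_Rabs].
Qed.

Lemma RInt_scal_cont (f : R -> R) (a b c : R) :
  (forall x, continuous f x) -> RInt (fun x => c * f x) a b = c * RInt f a b.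
Proof.
  intros H; apply (RInt_scal (V := RCV)), ex_RInt_cont, H.
Qed.

Definition gauss (x : R) : R := RInt (fun t => exp (- t ^ 2)) 0 x.

(** The companion in the elementary evaluation of the Gaussian integral: [gauss ^ 2 + gauss_dual]
    has zero derivative and equals [atan 1] at 0. *)
Definition gauss_dual (x : R) : R := RInt (fun t => exp (- x ^ 2 * (1 + t ^ 2)) / (1 + t ^ 2)) 0 1.

Lemma one_plus_sqr_pos (t : R) : 0 < 1 + t ^ 2.
Proof. pose proof (pow2_ge_0 t); lra. Qed.

Lemma is_derive_gauss (x : R) : is_derive gauss x (exp (- x ^ 2)).
Proof.
  apply (is_derive_RInt (fun t => exp (- t ^ 2)) gauss 0 x).
  - exists (mkposreal 1 Rlt_0_1); intros y _.
    apply is_RInt_cont; intros z.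
    smooth.
  - smooth.
Qed.

Lemma is_derive_gauss_dual (x : R) :
  is_derive gauss_dual x (- (2 * exp (- x ^ 2) * gauss x)).
Proof.
  assert (Hd : forall t u, is_derive (fun u => exp (- u ^ 2 * (1 + t ^ 2)) / (1 + t ^ 2)) u
    (- 2 * u * exp (- u ^ 2 * (1 + t ^ 2)))).
  { intros t u; pose proof (one_plus_sqr_pos t); auto_derive; [trivial|].
    simpl; field; simpl in *; lra. }
  replace (- (2 * exp (- x ^ 2) * gauss x))
    with (RInt (fun t => Derive (fun u => exp (- u ^ 2 * (1 + t ^ 2)) / (1 + t ^ 2)) x) 0 1).
  - apply (is_derive_RInt_param (fun u t => exp (- u ^ 2 * (1 + t ^ 2)) / (1 + t ^ 2))).
    + exists (mkposreal 1 Rlt_0_1); intros u _ t _; eexists; apply Hd.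
    + intros t _.
      apply (continuity_2d_pt_ext (fun u v => - 2 * u * exp (- u ^ 2 * (1 + v ^ 2)))).
      { intros u v; symmetry; apply is_derive_unique, Hd. }
      assert (Hu : forall f : R -> R, (forall y, continuous f y) ->
        continuity_2d_pt (fun u _ => f u) x t).
      { intros f Hf; apply (continuity_1d_2d_pt_comp f (fun u _ => u)).
        - apply continuity_pt_filterlim, Hf.
        - apply continuity_2d_pt_id1. }
      apply continuity_2d_pt_mult.
      * apply (Hu (fun u => - 2 * u)); intros y.
        smooth.
      * apply (continuity_1d_2d_pt_comp exp (fun u v => - u ^ 2 * (1 + v ^ 2))).
        { apply continuity_pt_filterlim, continuous_exp. }
        apply continuity_2d_pt_mult.
        { apply (Hu (fun u => - u ^ 2)); intros y.
          smooth. }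
        { apply (continuity_2d_pt_of_continuous_snd (fun v => 1 + v ^ 2)).
          smooth. }
    + exists (mkposreal 1 Rlt_0_1); intros u _; apply ex_RInt_cont; intros t.
      apply (ex_derive_continuous (V := RV)); auto_derive.
      pose proof (one_plus_sqr_pos t); simpl in *; lra.
  (* The substitution [t = x y], written with an offset 0 to match the affine change of
     variables. *)
  - assert (E : RInt (fun y => x * exp (- (x * y + 0) ^ 2)) 0 1 = gauss x).
    { transitivity (RInt (fun t => exp (- t ^ 2)) (x * 0 + 0) (x * 1 + 0)).
      - apply (RInt_comp_lin (V := RCV) (fun t => exp (- t ^ 2)) x 0 0 1).
        apply ex_RInt_cont; intros z.
        smooth.
      - unfold gauss; f_equal; ring. }
    rewrite <- E.
    transitivity (RInt (fun y => (- 2 * exp (- x ^ 2)) * (x * exp (- (x * y + 0) ^ 2))) 0 1).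
    + apply RInt_eq; intros t; etransitivity; [apply is_derive_unique, Hd|].
      replace (- x ^ 2 * (1 + t ^ 2)) with (- x ^ 2 + - (x * t + 0) ^ 2) by ring.
      rewrite exp_plus; ring.
    + rewrite RInt_scal_cont; [simpl; ring|].
      intros z; smooth.
Qed.

Lemma gauss_sqr (x : R) : gauss x ^ 2 + gauss_dual x = PI / 4.
Proof.
  assert (Hd : forall y, is_derive (fun y => gauss y ^ 2 + gauss_dual y) y 0).
  { intros y.
    replace 0 with (INR 2 * exp (- y ^ 2) * gauss y ^ 1 + - (2 * exp (- y ^ 2) * gauss y))
      by (simpl; ring).
    apply (is_derive_plus (fun y => gauss y ^ 2) gauss_dual).
    - apply (is_derive_pow gauss 2 y), is_derive_gauss.
    - apply is_derive_gauss_dual. }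
  assert (H0 : gauss 0 ^ 2 + gauss_dual 0 = PI / 4).
  { unfold gauss; rewrite RInt_point.
    assert (E : gauss_dual 0 = atan 1).
    { transitivity (RInt (fun t => / (1 + t ^ 2)) 0 1).
      - apply RInt_eq; intros t; replace (- 0 ^ 2 * (1 + t ^ 2)) with 0 by ring.
        rewrite exp_0; unfold Rdiv; ring.
      - apply is_RInt_unique.
        replace (atan 1) with (minus (atan 1) (atan 0))
          by (rewrite atan_0; unfold minus, plus, opp; simpl; ring).
        apply (is_RInt_derive atan (fun t => / (1 + t ^ 2))).
        + intros t _; pose proof (is_derive_atan t) as H.
          replace (/ (1 + t ^ 2)) with (/ (1 + t²)) by (unfold Rsqr; f_equal; ring).
          exact H.
        + intros t _; apply (ex_derive_continuous (V := RV)); auto_derive.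
          pose proof (one_plus_sqr_pos t); simpl in *; lra. }
    rewrite E, atan_1; unfold zero; simpl; ring. }
  destruct (MVT_gen (fun y => gauss y ^ 2 + gauss_dual y) 0 x (fun _ => 0)) as [c [_ E]].
  - intros y _; apply Hd.
  - intros y _; apply continuity_pt_filterlim.
    apply (ex_derive_continuous (V := RV) (fun y => gauss y ^ 2 + gauss_dual y)).
    eexists; apply Hd.
  - lra.
Qed.

Lemma gauss_dual_bounds (x : R) : 0 <= gauss_dual x <= exp (- x ^ 2).
Proof.
  assert (Hc : forall t, continuous (fun t => exp (- x ^ 2 * (1 + t ^ 2)) / (1 + t ^ 2)) t).
  { intros t; apply (ex_derive_continuous (V := RV)); auto_derive.
    pose proof (one_plus_sqr_pos t); simpl in *; lra. }
  assert (Hp : forall t, 0 <= exp (- x ^ 2 * (1 + t ^ 2)) / (1 + t ^ 2)).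
  { intros t; apply Rdiv_le_0_compat; [apply Rlt_le, exp_pos|apply one_plus_sqr_pos]. }
  split.
  - apply RInt_ge_0; [lra|apply ex_RInt_cont, Hc|intros; apply Hp].
  - apply Rle_trans with (1 := Rle_abs _).
    apply Rle_trans with ((1 - 0) * exp (- x ^ 2)); [|lra].
    apply abs_RInt_le_const; [lra|apply ex_RInt_cont, Hc|].
    intros t _; rewrite Rabs_pos_eq by apply Hp.
    pose proof (pow2_ge_0 t); pose proof (pow2_ge_0 x).
    apply (Rmult_le_reg_r (1 + t ^ 2)); [lra|].
    unfold Rdiv; rewrite Rmult_assoc, Rinv_l, Rmult_1_r by lra.
    apply Rle_trans with (exp (- x ^ 2)); [apply exp_monotone; nra|].
    pose proof (exp_pos (- x ^ 2)); nra.
Qed.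

(** From [(g - s / 2) (g + s / 2) = - gauss_dual x] with [s = sqrt PI >= 1]: the second factor is at
    least [1 / 2], whence the constant 2. *)
Lemma gauss_bounds (x : R) : 0 <= x ->
  0 <= gauss x <= 1 /\ Rabs (gauss x - sqrt PI / 2) <= 2 * exp (- x ^ 2).
Proof.
  intros Hx.
  assert (H0 : 0 <= gauss x).
  { apply RInt_ge_0; [exact Hx| |intros; apply Rlt_le, exp_pos].
    apply ex_RInt_cont; intros z.
    smooth. }
  pose proof (gauss_sqr x) as H1; pose proof (gauss_dual_bounds x) as H2.
  pose proof PI_4 as P4; pose proof PI2_1 as P2.
  assert (Hs : sqrt PI * sqrt PI = PI) by (apply sqrt_sqrt; lra).
  assert (Hs1 : 1 <= sqrt PI) by (rewrite <- sqrt_1; apply sqrt_le_1; lra).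
  split; [split; [exact H0|nra]|].
  set (g := gauss x) in *; set (e := exp (- x ^ 2)) in *; set (s := sqrt PI) in *.
  assert (E : (g - s / 2) * (g + s / 2) = - gauss_dual x) by nra.
  apply Rabs_le; split; nra.
Qed.

(** Moments over the actual range [[0, PI]], which avoids improper integrals at the price of
    exponentially small boundary terms. *)
Definition gmom (b : R) (p : nat) : R := RInt (fun x => exp (- b * x ^ 2) * x ^ (2 * p)) 0 PI.

Lemma continuous_gmom_integrand (b x : R) (p : nat) :
  continuous (fun x => exp (- b * x ^ 2) * x ^ p) x.
Proof. smooth. Qed.

Lemma gmom_0 (b : R) : 0 < b -> gmom b 0 = gauss (sqrt b * PI) / sqrt b.
Proof.
  intros Hb; pose proof (sqrt_lt_R0 b Hb) as Hs.
  assert (E : RInt (fun y => sqrt b * exp (- (sqrt b * y + 0) ^ 2)) 0 PI = gauss (sqrt b * PI)).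
  { transitivity (RInt (fun t => exp (- t ^ 2)) (sqrt b * 0 + 0) (sqrt b * PI + 0)).
    - apply (RInt_comp_lin (V := RCV) (fun t => exp (- t ^ 2))).
      apply ex_RInt_cont; intros z.
      smooth.
    - unfold gauss; f_equal; ring. }
  rewrite <- E; unfold gmom.
  unfold Rdiv; rewrite Rmult_comm, <- RInt_scal_cont.
  2:{ intros z; smooth. }
  apply RInt_eq; intros y; simpl (y ^ (2 * 0)).
  replace (- (sqrt b * y + 0) ^ 2) with (- (sqrt b * sqrt b) * y ^ 2) by ring.
  rewrite sqrt_sqrt by lra; field; lra.
Qed.

(** Integration by parts: integrate the derivative of [exp (- b x^2) x^(2 p + 1)]. *)
Lemma gmom_S (b : R) (p : nat) :
  2 * b * gmom b (S p) = (2 * INR p + 1) * gmom b p - exp (- b * PI ^ 2) * PI ^ (2 * p + 1).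
Proof.
  assert (H1 : is_RInt (fun x => (2 * INR p + 1) * (exp (- b * x ^ 2) * x ^ (2 * p))
      - 2 * b * (exp (- b * x ^ 2) * x ^ (2 * S p))) 0 PI
    ((2 * INR p + 1) * gmom b p - 2 * b * gmom b (S p))).
  { apply (is_RInt_minus (V := RV));
      apply (is_RInt_scal (V := RV)), is_RInt_cont;
      intros x; apply continuous_gmom_integrand. }
  assert (H2 : is_RInt (fun x => (2 * INR p + 1) * (exp (- b * x ^ 2) * x ^ (2 * p))
      - 2 * b * (exp (- b * x ^ 2) * x ^ (2 * S p))) 0 PI
    (minus (exp (- b * PI ^ 2) * PI ^ (2 * p + 1)) (exp (- b * 0 ^ 2) * 0 ^ (2 * p + 1)))).
  { apply (is_RInt_derive (fun x => exp (- b * x ^ 2) * x ^ (2 * p + 1))).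
    - intros x _; auto_derive; [trivial|].
      replace (p + (p + 0) + 1)%nat with (S (2 * p)) by lia.
      rewrite S_INR, mult_INR; change (INR 2) with 2; change (pred (S (2 * p))) with (2 * p)%nat.
      replace (2 * S p)%nat with (S (S (2 * p))) by lia.
      replace (x * (x * 1)) with (x ^ 2) by ring; simpl (x ^ S _); ring.
    - intros x _; apply (continuous_minus (V := RV));
        apply (continuous_scal_r (V := RV)), continuous_gmom_integrand. }
  apply (is_RInt_unique (V := RCV)) in H1, H2.
  assert (E : (2 * INR p + 1) * gmom b p - 2 * b * gmom b (S p)
    = exp (- b * PI ^ 2) * PI ^ (2 * p + 1) - exp (- b * 0 ^ 2) * 0 ^ (2 * p + 1))
    by (transitivity (RInt (fun x => (2 * INR p + 1) * (exp (- b * x ^ 2) * x ^ (2 * p))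
      - 2 * b * (exp (- b * x ^ 2) * x ^ (2 * S p))) 0 PI); [symmetry; exact H1|exact H2]).
  rewrite (pow_i (2 * p + 1)) in E by lia; lra.
Qed.

(** This is [Gamma (p + 1/2) / sqrt PI = (2 p - 1)!! / 2^p]. *)
Fixpoint odd_half_fact (p : nat) : R :=
  match p with O => 1 | S r => (2 * INR r + 1) / 2 * odd_half_fact r end.

Lemma gmom_bounds (b : R) (p : nat) : 0 < b ->
  0 <= gmom b p <= odd_half_fact p / (b ^ p * sqrt b).
Proof.
  intros Hb; pose proof (sqrt_lt_R0 b Hb) as Hs; pose proof PI_RGT_0 as HPI.
  split.
  - apply RInt_ge_0; [lra|apply ex_RInt_cont; intros; apply continuous_gmom_integrand|].
    intros x Hx; apply Rmult_le_pos; [apply Rlt_le, exp_pos|apply pow_le; lra].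
  - induction p as [|p IH].
    + rewrite gmom_0 by exact Hb; simpl; rewrite Rmult_1_l.
      apply Rmult_le_compat_r; [apply Rlt_le, Rinv_0_lt_compat, Hs|].
      apply (gauss_bounds (sqrt b * PI)); apply Rmult_le_pos; lra.
    + pose proof (gmom_S b p) as E.
      pose proof (exp_pos (- b * PI ^ 2)); pose proof (pow_lt PI (2 * p + 1) HPI).
      pose proof (pos_INR p); pose proof (pow_lt b p Hb).
      apply (Rmult_le_reg_l (2 * b)); [lra|].
      apply Rle_trans with ((2 * INR p + 1) * gmom b p); [nra|].
      apply Rle_trans with ((2 * INR p + 1) * (odd_half_fact p / (b ^ p * sqrt b)));
        [apply Rmult_le_compat_l; lra|].
      right; simpl; field; lra.
Qed.

Lemma exp_neg_le_pow (b : R) (n : nat) : 0 < b -> exp (- b) <= INR (fact n) / b ^ n.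
Proof.
  intros Hb; rewrite exp_Ropp.
  pose proof (pow_div_fact_le_exp b n ltac:(lra)) as H.
  pose proof (INR_fact_lt_0 n); pose proof (pow_lt b n Hb).
  replace (INR (fact n) / b ^ n) with (/ (b ^ n / INR (fact n))) by (field; lra).
  apply Rinv_le_contravar; [apply Rdiv_lt_0_compat; lra|exact H].
Qed.

Lemma gmom_asymptotics (p : nat) : exists C, 0 <= C /\ forall b, 1 <= b ->
  Rabs (gmom b p - odd_half_fact p * (sqrt PI / 2) / (b ^ p * sqrt b)) <= C / (b ^ S p * sqrt b).
Proof.
  pose proof PI_RGT_0 as HPI; pose proof PI2_1 as HPI2.
  assert (Hexp : forall b, 1 <= b -> exp (- (b * PI ^ 2)) <= exp (- b)).
  { intros b Hb; apply exp_monotone; assert (1 <= PI ^ 2) by nra; nra. }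
  induction p as [|p [C [HC IH]]].
  - exists 2; split; [lra|]; intros b Hb.
    assert (Hs : 0 < sqrt b) by (apply sqrt_lt_R0; lra).
    rewrite gmom_0 by lra.
    replace (gauss (sqrt b * PI) / sqrt b - odd_half_fact 0 * (sqrt PI / 2) / (b ^ 0 * sqrt b))
      with ((gauss (sqrt b * PI) - sqrt PI / 2) * / sqrt b) by (simpl; field; lra).
    rewrite Rabs_mult, (Rabs_pos_eq (/ _)) by (apply Rlt_le, Rinv_0_lt_compat, Hs).
    replace (2 / (b ^ 1 * sqrt b)) with (2 / b * / sqrt b) by (field; lra).
    apply Rmult_le_compat_r; [apply Rlt_le, Rinv_0_lt_compat, Hs|].
    apply Rle_trans with (1 := proj2 (gauss_bounds (sqrt b * PI) ltac:(apply Rmult_le_pos; lra))).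
    replace ((sqrt b * PI) ^ 2) with (b * PI ^ 2)
      by (rewrite Rpow_mult_distr, pow2_sqrt by lra; reflexivity).
    apply Rmult_le_compat_l; [lra|].
    apply Rle_trans with (1 := Hexp b Hb).
    apply Rle_trans with (1 := exp_neg_le_pow b 1 ltac:(lra)); right; simpl; field; lra.
  (* The boundary term at [PI] is estimated by [exp (- b) <= (p + 2)! / b ^ (p + 2)]; since
     [sqrt b <= b], this is within the required order. *)
  - set (D := PI ^ (2 * p + 1) * INR (fact (p + 2))).
    assert (HD : 0 <= D) by (apply Rmult_le_pos; [apply pow_le; lra|apply pos_INR]).
    pose proof (pos_INR p) as Hp.
    exists ((2 * INR p + 1) / 2 * C + D); split.
    { apply Rplus_le_le_0_compat; [apply Rmult_le_pos; lra|exact HD]. }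
    intros b Hb; specialize (IH b Hb).
    assert (Hs : 0 < sqrt b) by (apply sqrt_lt_R0; lra).
    assert (Hsb : sqrt b <= b).
    { rewrite <- (sqrt_sqrt b) at 2 by lra.
      assert (1 <= sqrt b) by (rewrite <- sqrt_1; apply sqrt_le_1; lra); nra. }
    pose proof (pow_lt b p ltac:(lra)) as Hbp.
    pose proof (gmom_S b p) as E.
    assert (Ee : exp (- b * PI ^ 2) * PI ^ (2 * p + 1) <= D / (b ^ S p * sqrt b)).
    { replace (- b * PI ^ 2) with (- (b * PI ^ 2)) by ring.
      apply Rle_trans with (INR (fact (p + 2)) / b ^ (p + 2) * PI ^ (2 * p + 1)).
      - apply Rmult_le_compat_r; [apply pow_le; lra|].
        apply Rle_trans with (1 := Hexp b Hb), exp_neg_le_pow; lra.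
      - replace (INR (fact (p + 2)) / b ^ (p + 2) * PI ^ (2 * p + 1)) with (D * / b ^ (p + 2))
          by (unfold D, Rdiv; ring).
        apply Rmult_le_compat_l; [exact HD|].
        apply Rinv_le_contravar; [apply Rmult_lt_0_compat; [apply pow_lt|]; lra|].
        rewrite pow_add; simpl; rewrite Rmult_1_r.
        replace (b ^ p * (b * b)) with (b * b ^ p * b) by ring.
        apply Rmult_le_compat_l; nra. }
    set (X := odd_half_fact p * (sqrt PI / 2) / (b ^ p * sqrt b)) in *.
    replace (odd_half_fact (S p) * (sqrt PI / 2) / (b ^ S p * sqrt b))
      with ((2 * INR p + 1) / (2 * b) * X) by (unfold X; simpl; field; lra).
    replace (gmom b (S p)) with ((2 * INR p + 1) / (2 * b) * gmom b p
      - exp (- b * PI ^ 2) * PI ^ (2 * p + 1) / (2 * b)).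
    2:{ apply (Rmult_eq_reg_l (2 * b)); [|lra]; rewrite E; field; lra. }
    replace ((2 * INR p + 1) / (2 * b) * gmom b p - exp (- b * PI ^ 2) * PI ^ (2 * p + 1) / (2 * b)
        - (2 * INR p + 1) / (2 * b) * X)
      with (/ (2 * b) * ((2 * INR p + 1) * (gmom b p - X)
        - exp (- b * PI ^ 2) * PI ^ (2 * p + 1))) by (field; lra).
    set (Y := exp (- b * PI ^ 2) * PI ^ (2 * p + 1)) in *.
    assert (HY : 0 <= Y)
      by (apply Rmult_le_pos; [apply Rlt_le, exp_pos|apply pow_le; lra]).
    assert (Hib : 0 < / (2 * b)) by (apply Rinv_0_lt_compat; lra).
    rewrite Rabs_mult, (Rabs_pos_eq (/ _)) by lra.
    apply Rle_trans with (/ (2 * b) * ((2 * INR p + 1) * (C / (b ^ S p * sqrt b))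
      + D / (b ^ S p * sqrt b))).
    { apply Rmult_le_compat_l; [lra|].
      apply Rabs_le_between in IH; apply Rabs_le.
      assert (0 <= 2 * INR p + 1) by lra.
      split; nra. }
    assert (Hden : 0 < b ^ S (S p) * sqrt b)
      by (apply Rmult_lt_0_compat; [apply pow_lt; lra|exact Hs]).
    apply Rle_trans with (((2 * INR p + 1) / 2 * C + D / 2) / (b ^ S (S p) * sqrt b)).
    { right; simpl; field; lra. }
    apply Rmult_le_compat_r; [apply Rlt_le, Rinv_0_lt_compat, Hden|lra].
Qed.

(** * Large-time asymptotics *)

(** With [c = cos (x / 2) >= 0] one has [1 - cos x = 2 (1 - c) (1 + c) >= 2 (1 - c)], and Taylor's
    bound gives [1 - c >= x^2 / 12]. The constant [1 / 6] provides a Gaussian majorant on the whole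
    interval; 16 comes from [PI <= 4]. *)
Lemma one_minus_cos_bounds (x : R) : 0 <= x <= PI ->
  x ^ 2 / 6 <= 1 - cos x <= x ^ 2 / 2 /\ x ^ 2 / 2 - (1 - cos x) <= x ^ 4 / 24 /\ x ^ 2 <= 16.
Proof.
  intros Hx; pose proof PI_4 as HPI.
  destruct (cos_taylor_bounds x) as [H1 [H2 _]]; apply Rabs_le_between in H2.
  destruct (cos_taylor_bounds (x / 2)) as [_ [H3 _]]; apply Rabs_le_between in H3.
  assert (Hc : 0 <= cos (x / 2)) by (apply cos_ge_0; lra).
  assert (Hd : cos x = 2 * cos (x / 2) * cos (x / 2) - 1).
  { replace x with (2 * (x / 2)) at 1 by field; apply cos_2a_cos. }
  assert (Hx2 : x ^ 2 <= 16) by nra.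
  set (c := cos (x / 2)) in *; set (y := x ^ 2) in *.
  replace ((x / 2) ^ 2) with (y / 4) in H3 by (unfold y; field).
  replace ((x / 2) ^ 4) with (y * y / 16) in H3 by (unfold y; field).
  replace (x ^ 4) with (y * y) in * by (unfold y; ring).
  assert (Hy : 0 <= y) by apply pow2_ge_0.
  assert (Hl : y / 12 <= 1 - c) by nra.
  repeat split; nra.
Qed.

Lemma heat_factor_le (t x : R) : 0 <= t -> 0 <= x <= PI ->
  hf t x <= exp (- (t / 6) * x ^ 2).
Proof.
  intros Ht Hx; destruct (one_minus_cos_bounds x Hx) as [H _]; apply exp_monotone; nra.
Qed.

(** The difference is the heat factor times [1 - exp (- y)], at most the heat factor times [y],
    where [y = t (x^2 / 2 - (1 - cos x))]. *)
Lemma heat_factor_sub_gauss (t x : R) : 0 <= t -> 0 <= x <= PI ->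
  Rabs (hf t x - exp (- (t / 2) * x ^ 2))
  <= exp (- (t / 6) * x ^ 2) * (t * x ^ 4).
Proof.
  intros Ht Hx; destruct (one_minus_cos_bounds x Hx) as [[H1 H2] [H3 _]].
  pose proof (heat_factor_le t x Ht Hx) as Hf.
  set (y := t * (x ^ 2 / 2 - (1 - cos x))).
  assert (Hx4 : 0 <= x ^ 4) by (apply pow_le; lra).
  assert (Hy : 0 <= y <= t * x ^ 4) by (unfold y; split; nra).
  replace (- (t / 2) * x ^ 2) with (- t * (1 - cos x) + - y) by (unfold y; field).
  rewrite exp_plus.
  pose proof (exp_pos (- t * (1 - cos x))); pose proof (exp_ineq1_le (- y)).
  assert (exp (- y) <= 1) by (rewrite <- exp_0; apply exp_monotone; lra).
  rewrite Rabs_pos_eq by nra.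
  apply Rle_trans with (hf t x * y); [nra|].
  apply Rmult_le_compat; lra.
Qed.

Lemma gmom_decay (p : nat) : exists K, 0 <= K /\ forall t, 2 <= t ->
  gmom (t / 6) p <= K / (t ^ p * sqrt t).
Proof.
  assert (Hr : 0 < sqrt (/ 6)) by (apply sqrt_lt_R0; lra).
  assert (H0 : 0 <= odd_half_fact p).
  { induction p as [|p IH]; simpl; [lra|]; pose proof (pos_INR p).
    apply Rmult_le_pos; lra. }
  pose proof (pow_lt 6 p ltac:(lra)) as H6.
  exists (odd_half_fact p * 6 ^ p / sqrt (/ 6)); split.
  { apply Rdiv_le_0_compat; [apply Rmult_le_pos; lra|exact Hr]. }
  intros t Ht; apply Rle_trans with (1 := proj2 (gmom_bounds (t / 6) p ltac:(lra))).
  pose proof (pow_lt t p ltac:(lra)); pose proof (sqrt_lt_R0 t ltac:(lra)).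
  unfold Rdiv at 3; rewrite sqrt_mult by lra.
  unfold Rdiv; rewrite Rpow_mult_distr, pow_inv; right; field; lra.
Qed.

Lemma wt_quadratic_bound (q : R) : 0 < q < 1 ->
  exists B, 0 <= B /\ forall x, 0 <= x <= PI -> Rabs (wt q x) <= B * x ^ 2.
Proof.
  intros Hq; destruct (wt_expansion q Hq) as [K [HK H]].
  exists (Rabs (wcurv q) + 16 * K); split; [pose proof (Rabs_pos (wcurv q)); lra|].
  intros x Hx; specialize (H x); destruct (one_minus_cos_bounds x Hx) as [_ [_ H16]].
  pose proof (pow2_ge_0 x) as Hx2.
  replace (wt q x) with ((wt q x - wcurv q * x ^ 2) + wcurv q * x ^ 2) by ring.
  apply Rle_trans with (1 := Rabs_triang _ _).
  rewrite (Rabs_mult (wcurv q)), (Rabs_pos_eq (x ^ 2)) by exact Hx2.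
  assert (K * x ^ 4 <= K * (16 * x ^ 2)).
  { apply Rmult_le_compat_l; [exact HK|]; replace (x ^ 4) with (x ^ 2 * x ^ 2) by ring; nra. }
  lra.
Qed.

Lemma continuous_heat_mul (t : R) (phi : R -> R) (x : R) :
  (forall x, continuous phi x) -> continuous (fun x => hf t x * phi x) x.
Proof.
  intros H; apply (continuous_mult (fun x => hf t x) phi);
    [apply continuous_heat_factor|apply H].
Qed.

Lemma RInt_gmom_scal (b c : R) (p : nat) :
  RInt (fun x => c * (exp (- b * x ^ 2) * x ^ (2 * p))) 0 PI = c * gmom b p.
Proof. apply RInt_scal_cont; intros x; apply continuous_gmom_integrand. Qed.

Lemma RInt_le_gmom (f : R -> R) (b c : R) (p : nat) :
  (forall x, continuous f x) ->
  (forall x, 0 <= x <= PI -> Rabs (f x) <= c * (exp (- b * x ^ 2) * x ^ (2 * p))) ->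
  Rabs (RInt f 0 PI) <= c * gmom b p.
Proof.
  intros Hf H; rewrite <- RInt_gmom_scal.
  apply RInt_abs_le_RInt; [exact Hf| |pose proof PI_RGT_0; lra|exact H].
  intros x; apply (continuous_scal_r (V := RV)), continuous_gmom_integrand.
Qed.

(** The exact heat factor and weight are kept and only the polynomials are expanded. The
    cancellations in the determinant are then algebraic identities in these moments, for which
    leading asymptotics are enough. *)
Definition hmom (q : R) (i : nat) (t : R) : R :=
  RInt (fun x => hf t x * ((x ^ 2 / 2) ^ i * wt q x)) 0 PI.

Lemma continuous_sigma_pow (i : nat) (x : R) : continuous (fun x => (x ^ 2 / 2) ^ i) x.
Proof. smooth. Qed.

Lemma continuous_hmom_integrand (q t : R) (i : nat) (x : R) : 0 < q < 1 ->
  continuous (fun x => hf t x * ((x ^ 2 / 2) ^ i * wt q x)) x.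
Proof.
  intros Hq; apply continuous_heat_mul; intros y.
  apply (continuous_mult (fun x => (x ^ 2 / 2) ^ i) (wt q));
    [apply continuous_sigma_pow|apply continuous_wt, Hq].
Qed.

Lemma RInt_minus_cont (f g : R -> R) (a b : R) :
  (forall x, continuous f x) -> (forall x, continuous g x) ->
  RInt f a b - RInt g a b = RInt (fun x => f x - g x) a b.
Proof.
  intros Hf Hg; symmetry.
  apply (RInt_minus (V := RCV)); apply ex_RInt_cont; assumption.
Qed.

Lemma sigma_pow_le (x : R) (i : nat) : 0 <= (x ^ 2 / 2) ^ i <= x ^ (2 * i).
Proof.
  pose proof (pow2_ge_0 x); rewrite pow_mult; split; [apply pow_le|apply pow_incr]; lra.
Qed.

(** Replacing the weight by its quadratic part costs two powers of [x]; replacing the heat factor by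
    the Gaussian costs [t x^4]. On the scale [x^2 = 1 / t] both are a relative error [1 / t]. *)
Lemma hmom_gmom (q : R) (i : nat) : 0 < q < 1 -> exists K, 0 <= K /\ forall t, 2 <= t ->
  Rabs (hmom q i t - wcurv q * (/ 2) ^ i * gmom (t / 2) (S i)) <= K / (t ^ S (S i) * sqrt t).
Proof.
  intros Hq.
  destruct (wt_expansion q Hq) as [K1 [HK1 HW]].
  destruct (gmom_decay (S (S i))) as [K2 [HK2 HG2]].
  destruct (gmom_decay (S (S (S i)))) as [K3 [HK3 HG3]].
  pose proof (Rabs_pos (wcurv q)) as Hw.
  exists (K1 * K2 + Rabs (wcurv q) * K3); split; [nra|]; intros t Ht.
  specialize (HG2 t Ht); specialize (HG3 t Ht).
  assert (Hg : forall b p x, continuous (fun x => exp (- b * x ^ 2) * x ^ p) x)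
    by (intros; apply continuous_gmom_integrand).
  rewrite <- RInt_gmom_scal; unfold hmom.
  assert (C1 : forall x, continuous (fun x => hf t x *
    ((x ^ 2 / 2) ^ i * (wt q x - wcurv q * x ^ 2))) x).
  { intros x; apply continuous_heat_mul; intros y.
    apply (continuous_mult (fun x => (x ^ 2 / 2) ^ i)); [apply continuous_sigma_pow|].
    apply (continuous_minus (V := RV)); [apply continuous_wt, Hq|].
    smooth. }
  assert (C2 : forall x, continuous (fun x => (hf t x - exp (- (t / 2) * x ^ 2))
    * ((x ^ 2 / 2) ^ i * (wcurv q * x ^ 2))) x).
  { intros x; smooth. }
  rewrite RInt_minus_cont.
  2:{ intros x; apply continuous_hmom_integrand, Hq. }
  2:{ intros x; apply (continuous_scal_r (V := RV)), Hg. }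
  assert (E : RInt (fun x => hf t x * ((x ^ 2 / 2) ^ i * wt q x)
      - wcurv q * (/ 2) ^ i * (exp (- (t / 2) * x ^ 2) * x ^ (2 * S i))) 0 PI
    = RInt (fun x => hf t x * ((x ^ 2 / 2) ^ i * (wt q x - wcurv q * x ^ 2))) 0 PI
      + RInt (fun x => (hf t x - exp (- (t / 2) * x ^ 2))
          * ((x ^ 2 / 2) ^ i * (wcurv q * x ^ 2))) 0 PI).
  { etransitivity; [|apply (RInt_plus (V := RCV)); apply ex_RInt_cont;
      assumption].
    apply RInt_eq; intros x; change (@plus R_CompleteNormedModule) with Rplus.
    replace (2 * S i)%nat with (2 * i + 2)%nat by lia.
    replace ((x ^ 2 / 2) ^ i) with ((/ 2) ^ i * x ^ (2 * i))
      by (unfold Rdiv; rewrite Rpow_mult_distr, <- pow_mult; ring).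
    rewrite pow_add; unfold plus; simpl AbelianMonoid.sort; simpl; ring. }
  rewrite E; apply Rle_trans with (1 := Rabs_triang _ _).
  assert (B1 := RInt_le_gmom _ (t / 6) K1 (S (S i)) C1).
  assert (B2 := RInt_le_gmom _ (t / 6) (t * Rabs (wcurv q)) (S (S (S i))) C2).
  assert (Hs : 0 < sqrt t) by (apply sqrt_lt_R0; lra).
  pose proof (pow_lt t i ltac:(lra)) as Hti.
  apply Rle_trans with (K1 * gmom (t / 6) (S (S i)) + t * Rabs (wcurv q) * gmom (t / 6) (S (S (S i)))).
  - apply Rplus_le_compat; [apply B1|apply B2].
    + intros x Hx; rewrite !Rabs_mult, (Rabs_pos_eq (exp _)) by apply Rlt_le, exp_pos.
      pose proof (heat_factor_le t x ltac:(lra) Hx) as Hf; pose proof (sigma_pow_le x i) as Hsg.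
      rewrite (Rabs_pos_eq ((x ^ 2 / 2) ^ i)) by apply Hsg.
      replace (K1 * (exp (- (t / 6) * x ^ 2) * x ^ (2 * S (S i))))
        with (exp (- (t / 6) * x ^ 2) * (x ^ (2 * i) * (K1 * x ^ 4)))
        by (replace (2 * S (S i))%nat with (2 * i + 4)%nat by lia; rewrite pow_add; ring).
      apply Rmult_le_compat; [apply Rlt_le, exp_pos|
        apply Rmult_le_pos; [apply Hsg|apply Rabs_pos]|exact Hf|].
      apply Rmult_le_compat; [apply Hsg|apply Rabs_pos|apply Hsg|apply HW].
    + intros x Hx; rewrite !Rabs_mult.
      pose proof (heat_factor_sub_gauss t x ltac:(lra) Hx) as Hf; pose proof (sigma_pow_le x i) as Hsg.
      rewrite (Rabs_pos_eq ((x ^ 2 / 2) ^ i)) by apply Hsg.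
      rewrite (Rabs_pos_eq (x ^ 2)) by apply pow2_ge_0.
      replace (t * Rabs (wcurv q) * (exp (- (t / 6) * x ^ 2) * x ^ (2 * S (S (S i)))))
        with (exp (- (t / 6) * x ^ 2) * (t * x ^ 4) * (x ^ (2 * i) * (Rabs (wcurv q) * x ^ 2)))
        by (replace (2 * S (S (S i)))%nat with (2 * i + 4 + 2)%nat by lia; rewrite !pow_add; ring).
      assert (0 <= Rabs (wcurv q) * x ^ 2) by (apply Rmult_le_pos; [lra|apply pow2_ge_0]).
      apply Rmult_le_compat; [apply Rabs_pos|apply Rmult_le_pos; [apply Hsg|assumption]|exact Hf|].
      apply Rmult_le_compat_r; [assumption|apply Hsg].
  - apply Rle_trans with (K1 * (K2 / (t ^ S (S i) * sqrt t))
      + t * Rabs (wcurv q) * (K3 / (t ^ S (S (S i)) * sqrt t))).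
    + apply Rplus_le_compat; apply Rmult_le_compat_l; try assumption; nra.
    + right; simpl; field; lra.
Qed.

(** The powers of two cancel: [2^(-i)] from [(x^2 / 2)^i], [1 / 2] from the half-line integral, and
    [2^(i + 1) sqrt 2] from the Gaussian parameter [t / 2]. *)
Definition hmu (q : R) (i : nat) : R := wcurv q * odd_half_fact (S i) * (sqrt 2 * sqrt PI).

Lemma hmom_asymptotics (q : R) (i : nat) : 0 < q < 1 -> exists K, forall t, 2 <= t ->
  Rabs (hmom q i t - hmu q i / (t ^ S i * sqrt t)) <= K / (t ^ S (S i) * sqrt t).
Proof.
  intros Hq; destruct (hmom_gmom q i Hq) as [K1 [HK1 H1]].
  destruct (gmom_asymptotics (S i)) as [C [HC H2]].
  assert (Hr2 : 0 < sqrt 2) by (apply sqrt_lt_R0; lra).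
  assert (Hs2 : sqrt 2 * sqrt 2 = 2) by (apply sqrt_sqrt; lra).
  pose proof (pow_lt 2 i ltac:(lra)) as H2i.
  (* The factor [4 sqrt 2] is [2^(-i)] times the [2^(i + 2) sqrt 2] produced by [b = t / 2]. *)
  exists (K1 + Rabs (wcurv q) * (4 * sqrt 2 * C)); intros t Ht.
  specialize (H1 t Ht); specialize (H2 (t / 2) ltac:(lra)).
  assert (Hs : 0 < sqrt t) by (apply sqrt_lt_R0; lra).
  pose proof (pow_lt t i ltac:(lra)) as Hti.
  assert (Hst : sqrt (t / 2) = sqrt t / sqrt 2) by (apply sqrt_div; lra).
  rewrite Hst in H2.
  set (G := gmom (t / 2) (S i)) in *.
  set (X := odd_half_fact (S i) * (sqrt PI / 2) / ((t / 2) ^ S i * (sqrt t / sqrt 2))) in *.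
  assert (E : hmu q i / (t ^ S i * sqrt t) = wcurv q * (/ 2) ^ i * X).
  { unfold hmu, X, Rdiv; rewrite Rpow_mult_distr, !pow_inv; simpl (2 ^ S i).
    simpl (t ^ S i); field; lra. }
  rewrite E.
  replace (hmom q i t - wcurv q * (/ 2) ^ i * X)
    with ((hmom q i t - wcurv q * (/ 2) ^ i * G) + wcurv q * (/ 2) ^ i * (G - X)) by ring.
  apply Rle_trans with (1 := Rabs_triang _ _).
  rewrite (Rabs_mult (wcurv q * (/ 2) ^ i)), (Rabs_mult (wcurv q)).
  rewrite (Rabs_pos_eq ((/ 2) ^ i)) by (apply pow_le; lra).
  apply Rle_trans with (K1 / (t ^ S (S i) * sqrt t) + Rabs (wcurv q) * (/ 2) ^ i
    * (C / ((t / 2) ^ S (S i) * (sqrt t / sqrt 2)))).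
  - apply Rplus_le_compat; [exact H1|].
    apply Rmult_le_compat_l; [|exact H2].
    apply Rmult_le_pos; [apply Rabs_pos|apply pow_le; lra].
  - right; unfold Rdiv; rewrite Rpow_mult_distr, !pow_inv.
    simpl (2 ^ S _); simpl (t ^ S _); field; lra.
Qed.

(* Taylor coefficients at 0 of [rogers q n], in powers of [x ^ 2 / 2]. *)
Definition rc0 (q : R) (n : nat) : R := sumR (fun k => acoef q k * acoef q (n - 1 - k)) n.
Definition rc1 (q : R) (n : nat) : R :=
  sumR (fun k => acoef q k * acoef q (n - 1 - k) * - (2 * INR k - INR n + 1) ^ 2) n.
Definition rc2 (q : R) (n : nat) : R :=
  sumR (fun k => acoef q k * acoef q (n - 1 - k) * ((2 * INR k - INR n + 1) ^ 4 / 6)) n.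

Lemma sumR_cos_expansion (c f : nat -> R) (n : nat) : exists K, 0 <= K /\ forall x,
  Rabs (sumR (fun k => c k * cos (f k * x)) n
    - (sumR c n + sumR (fun k => c k * - f k ^ 2) n * (x ^ 2 / 2)
       + sumR (fun k => c k * (f k ^ 4 / 6)) n * (x ^ 2 / 2) ^ 2)) <= K * x ^ 6.
Proof.
  induction n as [|n [K [HK IH]]].
  - exists 0; split; [lra|]; intros x; simpl; rewrite Rabs_pos_eq; lra.
  - assert (Hf6 : forall y, 0 <= y ^ 6)
      by (intros y; replace (y ^ 6) with ((y ^ 3) ^ 2) by ring; apply pow2_ge_0).
    exists (K + Rabs (c n) * (f n ^ 6 / 720)); split.
    { pose proof (Rabs_pos (c n)); specialize (Hf6 (f n)).
      apply Rplus_le_le_0_compat; [exact HK|apply Rmult_le_pos; lra]. }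
    intros x; specialize (IH x).
    change (sumR ?g (S n)) with (sumR g n + g n); cbv beta.
    set (A := sumR (fun k => c k * cos (f k * x)) n) in *.
    set (B := sumR c n) in *.
    set (D := sumR (fun k => c k * - f k ^ 2) n) in *.
    set (E := sumR (fun k => c k * (f k ^ 4 / 6)) n) in *.
    replace (A + c n * cos (f n * x) - (B + c n + (D + c n * - f n ^ 2) * (x ^ 2 / 2)
        + (E + c n * (f n ^ 4 / 6)) * (x ^ 2 / 2) ^ 2))
      with ((A - (B + D * (x ^ 2 / 2) + E * (x ^ 2 / 2) ^ 2))
        + c n * (cos (f n * x) - (1 - (f n * x) ^ 2 / 2 + (f n * x) ^ 4 / 24))) by field.
    apply Rle_trans with (1 := Rabs_triang _ _); rewrite (Rabs_mult (c n)).
    pose proof (proj2 (proj2 (cos_taylor_bounds (f n * x)))) as Hc.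
    pose proof (Rmult_le_compat_l _ _ _ (Rabs_pos (c n)) Hc) as Hc'.
    replace ((K + Rabs (c n) * (f n ^ 6 / 720)) * x ^ 6)
      with (K * x ^ 6 + Rabs (c n) * ((f n * x) ^ 6 / 720)) by (rewrite Rpow_mult_distr; field).
    lra.
Qed.

Lemma rogers_expansion (q : R) (n : nat) : exists K, 0 <= K /\ forall x,
  Rabs (rogers q n x - (rc0 q n + rc1 q n * (x ^ 2 / 2) + rc2 q n * (x ^ 2 / 2) ^ 2)) <= K * x ^ 6.
Proof.
  apply (sumR_cos_expansion (fun k => acoef q k * acoef q (n - 1 - k))
    (fun k => 2 * INR k - INR n + 1) n).
Qed.

(** With Taylor polynomials [P] and [Q], the product error is [(c_m - P) c_k + P (c_k - Q)] plus the
    terms of [P Q] of degree three and four in [x^2 / 2]. *)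
Lemma rogers_mul_expansion (q : R) (m k : nat) : 0 < q < 1 -> exists K, 0 <= K /\
  forall x, 0 <= x <= PI ->
  Rabs (rogers q m x * rogers q k x
    - (rc0 q m * rc0 q k + (rc0 q m * rc1 q k + rc1 q m * rc0 q k) * (x ^ 2 / 2)
       + (rc0 q m * rc2 q k + rc1 q m * rc1 q k + rc2 q m * rc0 q k) * (x ^ 2 / 2) ^ 2))
  <= K * x ^ 6.
Proof.
  intros Hq.
  destruct (rogers_expansion q m) as [Km [HKm Hm]]; destruct (rogers_expansion q k) as [Kk [HKk Hk]].
  destruct (rogers_abs_le q Hq) as [A [HA HR]].
  set (a0 := rc0 q m) in *; set (a1 := rc1 q m) in *; set (a2 := rc2 q m) in *.
  set (b0 := rc0 q k) in *; set (b1 := rc1 q k) in *; set (b2 := rc2 q k) in *.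
  pose proof (pos_INR k) as Pk.
  (* A bound for [P] on the interval, where [s = x^2 / 2] is at most 8. *)
  set (B := Rabs a0 + Rabs a1 * 8 + Rabs a2 * 64).
  assert (HB : 0 <= B)
    by (unfold B; pose proof (Rabs_pos a0); pose proof (Rabs_pos a1); pose proof (Rabs_pos a2); lra).
  set (C1 := Rabs (a1 * b2 + a2 * b1)); set (C2 := Rabs (a2 * b2)).
  assert (HC1 : 0 <= C1) by apply Rabs_pos; assert (HC2 : 0 <= C2) by apply Rabs_pos.
  exists (Km * (A * INR k) + B * Kk + (C1 + C2 * 8)); split.
  { pose proof (Rmult_le_pos _ _ HKm (Rmult_le_pos _ _ HA Pk)).
    pose proof (Rmult_le_pos _ _ HB HKk); lra. }
  intros x Hx; specialize (Hm x); specialize (Hk x); specialize (HR k x).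
  destruct (one_minus_cos_bounds x Hx) as [_ [_ H16]].
  pose proof (pow2_ge_0 x) as Hx2.
  set (s := x ^ 2 / 2) in *.
  assert (Hs : 0 <= s <= 8) by (unfold s; lra).
  assert (Hx6 : x ^ 6 = 8 * s ^ 3) by (unfold s; field).
  assert (Hx60 : 0 <= x ^ 6) by (apply pow_le; lra).
  set (P := a0 + a1 * s + a2 * s ^ 2) in *; set (Q := b0 + b1 * s + b2 * s ^ 2) in *.
  replace (rogers q m x * rogers q k x
      - (a0 * b0 + (a0 * b1 + a1 * b0) * s + (a0 * b2 + a1 * b1 + a2 * b0) * s ^ 2))
    with ((rogers q m x - P) * rogers q k x + P * (rogers q k x - Q)
      + ((a1 * b2 + a2 * b1) * s ^ 3 + a2 * b2 * s ^ 4)) by (unfold P, Q; ring).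
  assert (HP : Rabs P <= B).
  { unfold P, B.
    apply Rle_trans with (Rabs a0 + Rabs (a1 * s) + Rabs (a2 * s ^ 2)).
    { apply Rle_trans with (1 := Rabs_triang _ _), Rplus_le_compat_r, Rabs_triang. }
    rewrite !Rabs_mult, (Rabs_pos_eq s), (Rabs_pos_eq (s ^ 2)) by (apply pow2_ge_0 || lra).
    pose proof (Rabs_pos a1); pose proof (Rabs_pos a2).
    assert (s ^ 2 <= 64) by nra; nra. }
  assert (T1 : Rabs ((rogers q m x - P) * rogers q k x) <= Km * x ^ 6 * (A * INR k))
    by (rewrite Rabs_mult; apply Rmult_le_compat; try apply Rabs_pos; assumption).
  assert (T2 : Rabs (P * (rogers q k x - Q)) <= B * (Kk * x ^ 6))
    by (rewrite Rabs_mult; apply Rmult_le_compat; try apply Rabs_pos; assumption).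
  assert (T3 : Rabs ((a1 * b2 + a2 * b1) * s ^ 3 + a2 * b2 * s ^ 4) <= (C1 + C2 * 8) * x ^ 6).
  { apply Rle_trans with (1 := Rabs_triang _ _); rewrite !(Rabs_mult _ (s ^ _)).
    assert (0 <= s ^ 3) by (apply pow_le; lra); assert (0 <= s ^ 4) by (apply pow_le; lra).
    rewrite (Rabs_pos_eq (s ^ 3)), (Rabs_pos_eq (s ^ 4)) by assumption; fold C1 C2.
    assert (s ^ 4 <= 8 * s ^ 3) by (simpl in *; nra).
    rewrite Hx6.
    assert (C1 * s ^ 3 <= C1 * (8 * s ^ 3)) by (apply Rmult_le_compat_l; lra).
    assert (C2 * s ^ 4 <= C2 * (64 * s ^ 3)) by (apply Rmult_le_compat_l; lra).
    lra. }
  apply Rle_trans with (1 := Rabs_triang _ _).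
  apply Rle_trans with (1 := Rplus_le_compat_r _ _ _ (Rabs_triang _ _)); lra.
Qed.

Definition heat_int (q : R) (m k : nat) (t : R) : R :=
  RInt (fun x => hf t x * (rogers q m x * rogers q k x * wt q x)) 0 PI.

(** A remainder [O(x^6)] against a weight [O(x^2)] is an eighth moment, of order [t^(-9/2)].
    Multiplied by the leading [t^(-3/2)] of the other entry it lands on the admissible [t^(-6)];
    hence the expansion up to [x^4]. *)
Lemma heat_int_expansion (q : R) (m k : nat) : 0 < q < 1 -> exists K, forall t, 2 <= t ->
  Rabs (heat_int q m k t
    - (rc0 q m * rc0 q k * hmom q 0 t + (rc0 q m * rc1 q k + rc1 q m * rc0 q k) * hmom q 1 t
       + (rc0 q m * rc2 q k + rc1 q m * rc1 q k + rc2 q m * rc0 q k) * hmom q 2 t))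
  <= K / (t ^ 4 * sqrt t).
Proof.
  intros Hq; destruct (rogers_mul_expansion q m k Hq) as [K [HK H]].
  destruct (wt_quadratic_bound q Hq) as [B [HB HW]]; destruct (gmom_decay 4) as [G [HG HG4]].
  set (q0 := rc0 q m * rc0 q k) in *; set (q1 := rc0 q m * rc1 q k + rc1 q m * rc0 q k) in *.
  set (q2 := rc0 q m * rc2 q k + rc1 q m * rc1 q k + rc2 q m * rc0 q k) in *.
  exists (K * B * G); intros t Ht; specialize (HG4 t Ht).
  set (rho := fun x => rogers q m x * rogers q k x
    - (q0 + q1 * (x ^ 2 / 2) + q2 * (x ^ 2 / 2) ^ 2)) in *.
  assert (Cm : forall i x, continuous (fun x => hf t x *
    ((x ^ 2 / 2) ^ i * wt q x)) x) by (intros; apply continuous_hmom_integrand, Hq).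
  assert (Cr : forall x, continuous (fun x => hf t x * (rho x * wt q x)) x).
  { intros x; apply continuous_heat_mul; intros y.
    apply (continuous_mult rho (wt q)); [|apply continuous_wt, Hq].
    apply (continuous_minus (V := RV)).
    - apply (continuous_mult (rogers q m) (rogers q k)); apply continuous_rogers.
    - smooth. }
  assert (E : heat_int q m k t = q0 * hmom q 0 t + q1 * hmom q 1 t + q2 * hmom q 2 t
    + RInt (fun x => hf t x * (rho x * wt q x)) 0 PI).
  { assert (HI : is_RInt (fun x => q0 * (hf t x * ((x ^ 2 / 2) ^ 0 * wt q x))
        + q1 * (hf t x * ((x ^ 2 / 2) ^ 1 * wt q x))
        + q2 * (hf t x * ((x ^ 2 / 2) ^ 2 * wt q x))
        + hf t x * (rho x * wt q x)) 0 PI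
      (q0 * hmom q 0 t + q1 * hmom q 1 t + q2 * hmom q 2 t
        + RInt (fun x => hf t x * (rho x * wt q x)) 0 PI)).
    { assert (Hh := fun c i => is_RInt_scal (V := RV) _ _ _ c _
        (is_RInt_cont _ 0 PI (Cm i))).
      exact (is_RInt_plus _ _ _ _ _ _ (is_RInt_plus _ _ _ _ _ _ (is_RInt_plus _ _ _ _ _ _
        (Hh q0 O) (Hh q1 1%nat)) (Hh q2 2%nat)) (is_RInt_cont _ 0 PI Cr)). }
    etransitivity; [|exact (is_RInt_unique (V := RCV) _ _ _ _ HI)].
    apply RInt_eq; intros x; unfold rho; simpl; ring. }
  rewrite E.
  rewrite Rplus_minus_l.
  apply Rle_trans with (K * B * gmom (t / 6) 4).
  - apply RInt_le_gmom; [exact Cr|]; intros x Hx.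
    rewrite !Rabs_mult, (Rabs_pos_eq (exp _)) by apply Rlt_le, exp_pos.
    replace (K * B * (exp (- (t / 6) * x ^ 2) * x ^ (2 * 4)))
      with (exp (- (t / 6) * x ^ 2) * (K * x ^ 6 * (B * x ^ 2)))
      by (change (2 * 4)%nat with (6 + 2)%nat; rewrite pow_add; ring).
    apply Rmult_le_compat; [apply Rlt_le, exp_pos|apply Rmult_le_pos; apply Rabs_pos
      |apply heat_factor_le; lra|].
    apply Rmult_le_compat; try apply Rabs_pos; [apply H|apply HW]; exact Hx.
  - apply Rle_trans with (K * B * (G / (t ^ 4 * sqrt t))); [|right; unfold Rdiv; ring].
    apply Rmult_le_compat_l; [nra|exact HG4].
Qed.

(** Closed under sums and products, so a remainder built from bounded pieces is bounded by
    inspection of its syntax. *)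
Definition eventually_bounded (f : R -> R) : Prop :=
  exists K, forall t, 2 <= t -> Rabs (f t) <= K.

Lemma eventually_bounded_const (c : R) : eventually_bounded (fun _ => c).
Proof. exists (Rabs c); intros; lra. Qed.

Lemma eventually_bounded_inv : eventually_bounded (fun t => / t).
Proof.
  exists 1; intros t Ht; rewrite Rabs_pos_eq by (apply Rlt_le, Rinv_0_lt_compat; lra).
  rewrite <- Rinv_1; apply Rinv_le_contravar; lra.
Qed.

Lemma eventually_bounded_plus (f g : R -> R) :
  eventually_bounded f -> eventually_bounded g -> eventually_bounded (fun t => f t + g t).
Proof.
  intros [K1 H1] [K2 H2]; exists (K1 + K2); intros t Ht.
  apply Rle_trans with (1 := Rabs_triang _ _); specialize (H1 t Ht); specialize (H2 t Ht); lra.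
Qed.

Lemma eventually_bounded_mult (f g : R -> R) :
  eventually_bounded f -> eventually_bounded g -> eventually_bounded (fun t => f t * g t).
Proof.
  intros [K1 H1] [K2 H2]; exists (K1 * K2); intros t Ht; rewrite Rabs_mult.
  apply Rmult_le_compat; try apply Rabs_pos; auto.
Qed.

Lemma eventually_bounded_of_le_div (f : R -> R) (K : R) (p : nat) :
  (forall t, 2 <= t -> Rabs (f t) <= K / (t ^ p * sqrt t)) ->
  eventually_bounded (fun t => f t * (t ^ p * sqrt t)).
Proof.
  intros H; exists K; intros t Ht; specialize (H t Ht).
  assert (Hp : 0 < t ^ p * sqrt t)
    by (apply Rmult_lt_0_compat; [apply pow_lt; lra|apply sqrt_lt_R0; lra]).
  rewrite Rabs_mult, (Rabs_pos_eq (t ^ p * sqrt t)) by lra.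
  apply (Rmult_le_compat_r (t ^ p * sqrt t)) in H; [|lra].
  unfold Rdiv in H; rewrite Rmult_assoc, Rinv_l, Rmult_1_r in H; lra.
Qed.

Definition rdet (q : R) (m n : nat) : R := rc0 q m * rc1 q n - rc1 q m * rc0 q n.

(* After antisymmetrization, the contributions of [hmom i * hmom j] with [i + j < 2] cancel, and
   those with [i + j = 2] combine into a product of two [2 x 2] determinants. *)
Lemma heat_int_det_asymptotics (q : R) (k l m n : nat) : 0 < q < 1 ->
  eventually_bounded (fun t =>
    (heat_int q m k t * heat_int q n l t - heat_int q m l t * heat_int q n k t) * t ^ 6
    - rdet q m n * rdet q k l * (hmu q 0 * hmu q 2 - hmu q 1 ^ 2) * t).
Proof.
  intros Hq.
  (* [z i] is the error of a moment and, below, [e a b] that of an integral, both rescaled to order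
     one; [y i] is the rescaled moment itself. *)
  set (z := fun i t => (hmom q i t - hmu q i / (t ^ S i * sqrt t)) * (t ^ S (S i) * sqrt t)).
  assert (Hz : forall i, eventually_bounded (z i)).
  { intros i; destruct (hmom_asymptotics q i Hq) as [K HK].
    apply (eventually_bounded_of_le_div _ K (S (S i)) HK). }
  set (e := fun a b t => (heat_int q a b t
    - (rc0 q a * rc0 q b * hmom q 0 t + (rc0 q a * rc1 q b + rc1 q a * rc0 q b) * hmom q 1 t
       + (rc0 q a * rc2 q b + rc1 q a * rc1 q b + rc2 q a * rc0 q b) * hmom q 2 t))
    * (t ^ 4 * sqrt t)).
  assert (He : forall a b, eventually_bounded (e a b)).
  { intros a b; destruct (heat_int_expansion q a b Hq) as [K HK].
    apply (eventually_bounded_of_le_div _ K 4 HK). }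
  set (y := fun i t => hmu q i + z i t * / t).
  assert (Hy : forall i, eventually_bounded (y i)).
  { intros i; apply (eventually_bounded_plus (fun _ => hmu q i)).
    - apply eventually_bounded_const.
    - apply eventually_bounded_mult; [apply Hz|apply eventually_bounded_inv]. }
  set (A0 := fun a b t => rc0 q a * rc0 q b * y 0%nat t).
  set (A1 := fun a b t => (rc0 q a * rc1 q b + rc1 q a * rc0 q b) * y 1%nat t).
  set (A2 := fun a b t => (rc0 q a * rc2 q b + rc1 q a * rc1 q b + rc2 q a * rc0 q b) * y 2%nat t).
  (* What the product of two expansions leaves at order 0 and below once multiplied by [t ^ 3]. *)
  set (rem := fun a b c d t =>
    (A0 a b t * e c d t + A1 a b t * A2 c d t + A2 a b t * A1 c d t + e a b t * A0 c d t)
    + / t * (A1 a b t * e c d t + A2 a b t * A2 c d t + e a b t * A1 c d t)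
    + / t * / t * (A2 a b t * e c d t + e a b t * A2 c d t)
    + / t * / t * / t * (e a b t * e c d t)).
  (* Differences are written with the factor [-1], so that closure under sums and products covers
     the whole expression. *)
  set (Psi := fun t => rem m k n l t + -1 * rem m l n k t
    + rdet q m n * rdet q k l * (hmu q 0 * z 2%nat t + z 0%nat t * hmu q 2
        + / t * (z 0%nat t * z 2%nat t) + -1 * (2 * hmu q 1 * z 1%nat t)
        + -1 * (/ t * (z 1%nat t * z 1%nat t)))).
  assert (HPsi : eventually_bounded Psi).
  { unfold Psi, rem, A0, A1, A2.
    repeat lazymatch goal with
    | |- eventually_bounded (fun _ => ?c) => apply (eventually_bounded_const c)
    | |- eventually_bounded (fun t => / t) => apply eventually_bounded_inv
    | |- eventually_bounded (fun t => @?f t + @?g t) => apply (eventually_bounded_plus f g)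
    | |- eventually_bounded (fun t => @?f t * @?g t) => apply (eventually_bounded_mult f g)
    | |- eventually_bounded (fun t => z ?i t) => exact (Hz i)
    | |- eventually_bounded (fun t => y ?i t) => exact (Hy i)
    | |- eventually_bounded (fun t => e ?a ?b t) => exact (He a b)
    end. }
  destruct HPsi as [K HK]; exists K; intros t Ht; specialize (HK t Ht).
  replace (_ - _) with (Psi t); [exact HK|].
  assert (Hs : 0 < sqrt t) by (apply sqrt_lt_R0; lra).
  assert (Hss : sqrt t * sqrt t = t) by (apply sqrt_sqrt; lra).
  assert (Eh : forall i, hmom q i t = y i t / (t ^ S i * sqrt t)).
  { intros i; unfold y, z; pose proof (pow_lt t i ltac:(lra)); simpl; field; lra. }
  assert (EI : forall a b, heat_int q a b t =
    (A0 a b t + A1 a b t * / t + A2 a b t * / t ^ 2 + e a b t * / t ^ 3) / (t * sqrt t)).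
  { intros a b.
    replace (heat_int q a b t) with
      (rc0 q a * rc0 q b * hmom q 0 t + (rc0 q a * rc1 q b + rc1 q a * rc0 q b) * hmom q 1 t
       + (rc0 q a * rc2 q b + rc1 q a * rc1 q b + rc2 q a * rc0 q b) * hmom q 2 t
       + e a b t / (t ^ 4 * sqrt t)) by (unfold e; field; lra).
    rewrite !Eh; unfold A0, A1, A2; field; lra. }
  rewrite !EI.
  assert (Hprod : forall u v w x, (u / (t * sqrt t)) * (v / (t * sqrt t))
    - (w / (t * sqrt t)) * (x / (t * sqrt t)) = (u * v - w * x) / t ^ 3).
  { intros u v w x; replace (t ^ 3) with (t * t * (sqrt t * sqrt t)) by (rewrite Hss; ring).
    field; lra. }
  rewrite Hprod.
  assert (Hexp : forall a b c d,
    (A0 a b t + A1 a b t * / t + A2 a b t * / t ^ 2 + e a b t * / t ^ 3)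
    * (A0 c d t + A1 c d t * / t + A2 c d t * / t ^ 2 + e c d t * / t ^ 3) * t ^ 3
    = A0 a b t * A0 c d t * t ^ 3 + (A0 a b t * A1 c d t + A1 a b t * A0 c d t) * t ^ 2
      + (A0 a b t * A2 c d t + A1 a b t * A1 c d t + A2 a b t * A0 c d t) * t + rem a b c d t).
  { intros a b c d; unfold rem.
    generalize (A0 a b t) (A1 a b t) (A2 a b t) (e a b t).
    generalize (A0 c d t) (A1 c d t) (A2 c d t) (e c d t).
    intros; field; lra. }
  (* The first two cancellations hold identically in the [y i], so lower-order corrections to the
     moments cannot disturb them. At the third order the minor [y_0 y_2 - y_1^2] survives. *)
  assert (P0 : A0 m k t * A0 n l t = A0 m l t * A0 n k t) by (unfold A0; ring).
  assert (P1 : A0 m k t * A1 n l t + A1 m k t * A0 n l t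
    = A0 m l t * A1 n k t + A1 m l t * A0 n k t) by (unfold A0, A1; ring).
  assert (P2 : A0 m k t * A2 n l t + A1 m k t * A1 n l t + A2 m k t * A0 n l t
    = A0 m l t * A2 n k t + A1 m l t * A1 n k t + A2 m l t * A0 n k t
      + rdet q m n * rdet q k l * (y 0%nat t * y 2%nat t - y 1%nat t ^ 2))
    by (unfold A0, A1, A2, rdet; ring).
  assert (P3 : rdet q m n * rdet q k l * (y 0%nat t * y 2%nat t - y 1%nat t ^ 2) * t
    = rdet q m n * rdet q k l * (hmu q 0 * hmu q 2 - hmu q 1 ^ 2) * t
      + rdet q m n * rdet q k l * (hmu q 0 * z 2%nat t + z 0%nat t * hmu q 2
        + / t * (z 0%nat t * z 2%nat t) + -1 * (2 * hmu q 1 * z 1%nat t)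
        + -1 * (/ t * (z 1%nat t * z 1%nat t)))).
  { unfold y; generalize (z 0%nat t) (z 1%nat t) (z 2%nat t); intros; field; lra. }
  pose proof (Hexp m k n l) as E1; pose proof (Hexp m l n k) as E2.
  rewrite P0, P1, P2 in E1.
  set (u := _ * (A0 n l t + _ + _ + _)) in *; set (v := _ * (A0 n k t + _ + _ + _)) in *.
  replace ((u - v) / t ^ 3 * t ^ 6) with (u * t ^ 3 - v * t ^ 3) by (field; lra).
  rewrite E1, E2; unfold Psi; lra.
Qed.

(** The values of [odd_half_fact] at 1, 2, 3 are [1/2], [3/4], [15/8], and
    [(1/2) (15/8) - (3/4)^2 = 3/8]; the square roots contribute [2 PI]. *)
Lemma hmu_discriminant (q : R) :
  hmu q 0 * hmu q 2 - hmu q 1 ^ 2 = 3 * PI / 4 * wcurv q ^ 2.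
Proof.
  assert (H2 : sqrt 2 * sqrt 2 = 2) by (apply sqrt_sqrt; lra).
  assert (HP : sqrt PI * sqrt PI = PI) by (apply sqrt_sqrt; pose proof PI_RGT_0; lra).
  transitivity (wcurv q ^ 2 * (sqrt 2 * sqrt 2) * (sqrt PI * sqrt PI) * (3 / 8)).
  - unfold hmu; simpl; field.
  - rewrite H2, HP; field.
Qed.

(** * Return to the normalized polynomials and the constant *)

Lemma is_derive_sumR (f f' : nat -> R -> R) (n : nat) (x : R) :
  (forall k, is_derive (f k) x (f' k x)) ->
  is_derive (fun y => sumR (fun k => f k y) n) x (sumR (fun k => f' k x) n).
Proof.
  intros H; induction n as [|n IH]; simpl.
  - apply (is_derive_const (K := R_AbsRing) (V := RV) 0).
  - apply (is_derive_plus (fun y => sumR (fun k => f k y) n) (f n)); [exact IH|apply H].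
Qed.

Lemma Ppoly_rogers (kappa : R) (n : nat) (x : R) : 0 < kappa ->
  Ppoly kappa n x = sqrt (gam kappa 1 / gam kappa n) * rogers (qpar kappa) n x.
Proof.
  intros hk; pose proof (qpar_bounds kappa hk) as Hq; unfold Ppoly, rogers; cbv zeta; f_equal.
  apply sumR_ext; intros k Hk; unfold acoef.
  pose proof (qpoch_q_pos (qpar kappa) k Hq); pose proof (qpoch_q_pos (qpar kappa) (n - 1 - k) Hq).
  field; lra.
Qed.

Lemma Ppoly_0 (kappa : R) (n : nat) : 0 < kappa ->
  Ppoly kappa n 0 = sqrt (gam kappa 1 / gam kappa n) * rc0 (qpar kappa) n.
Proof.
  intros hk; rewrite Ppoly_rogers by exact hk; f_equal.
  apply sumR_ext; intros k _; rewrite Rmult_0_r, cos_0; ring.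
Qed.

(** Expanding in [x^2 / 2] makes the coefficient [rc1] the second derivative at 0 itself. *)
Lemma Ppoly_second_derivative_0 (kappa : R) (n : nat) : 0 < kappa ->
  Derive_n (Ppoly kappa n) 2 0 = sqrt (gam kappa 1 / gam kappa n) * rc1 (qpar kappa) n.
Proof.
  intros hk; set (s := sqrt (gam kappa 1 / gam kappa n)); set (q := qpar kappa).
  set (c := fun k => acoef q k * acoef q (n - 1 - k)).
  set (f := fun k => 2 * INR k - INR n + 1).
  assert (D1 : forall x, Derive (Ppoly kappa n) x
    = s * sumR (fun k => c k * (- f k * sin (f k * x))) n).
  { intros x; apply is_derive_unique.
    apply (is_derive_ext (fun x => s * sumR (fun k => c k * cos (f k * x)) n)).
    { intros y; symmetry; apply Ppoly_rogers, hk. }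
    apply is_derive_scal.
    apply (is_derive_sumR (fun k x => c k * cos (f k * x))
      (fun k x => c k * (- f k * sin (f k * x)))).
    intros k; auto_derive; [trivial|ring]. }
  simpl Derive_n; rewrite (Derive_ext _ (fun x => s * sumR (fun k => c k * (- f k * sin (f k * x))) n)).
  2:{ intros x; rewrite <- D1; apply Derive_ext; reflexivity. }
  apply is_derive_unique.
  replace (rc1 q n) with (sumR (fun k => c k * (- f k ^ 2 * cos (f k * 0))) n).
  2:{ apply sumR_ext; intros k _; rewrite Rmult_0_r, cos_0; unfold c, f; ring. }
  apply is_derive_scal.
  apply (is_derive_sumR (fun k x => c k * (- f k * sin (f k * x)))
    (fun k x => c k * (- f k ^ 2 * cos (f k * x)))).
  intros k; auto_derive; [trivial|simpl; ring].
Qed.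

Lemma Rmn_rdet (kappa : R) (m n : nat) : 0 < kappa ->
  Rmn kappa m n = sqrt (gam kappa 1 / gam kappa m) * sqrt (gam kappa 1 / gam kappa n)
    * rdet (qpar kappa) m n.
Proof.
  intros hk; unfold Rmn; rewrite !Ppoly_0, !Ppoly_second_derivative_0 by exact hk.
  unfold rdet; ring.
Qed.

(** The norms give [1 / (PI^2 gam_k gam_l)] and the discriminant [(3 PI / 4) (2 L^4)^2 = 3 PI L^8].
    All square roots, those in [Rmn] included, multiply to [gam_1^2 / (gam_k gam_l)], which is why
    the stated constant is divided by [gam_1^2]. *)
Lemma heat_det_asymptotics (kappa : R) (k l m n : nat) : 0 < kappa ->
  (1 <= k)%nat -> (1 <= l)%nat -> (1 <= m)%nat -> (1 <= n)%nat ->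
  exists C, forall t, 2 <= t ->
    Rabs (heat_det (qpar kappa) k l m n t
      - 3 / (PI * gam kappa 1 ^ 2)
        * (qpoch_inf (qpar kappa) (qpar kappa) ^ 8 / qpoch_inf (- qpar kappa) (qpar kappa) ^ 8)
        * sqrt (gam kappa m * gam kappa n / (gam kappa k * gam kappa l))
        * (Rmn kappa k l * Rmn kappa m n / t ^ 5)) <= C / t ^ 6.
Proof.
  intros hk Hk Hl Hm Hn; set (q := qpar kappa).
  pose proof (qpar_bounds kappa hk) as Hq; fold q in Hq.
  pose proof PI_RGT_0 as HPI.
  destruct (heat_int_det_asymptotics q k l m n Hq) as [K HK].
  rewrite hmu_discriminant, wcurv_product in HK by exact Hq.
  set (L := qpoch_inf q q / qpoch_inf (- q) q) in *.
  replace (qpoch_inf q q ^ 8 / qpoch_inf (- q) q ^ 8) with (L ^ 8)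
    by (unfold L, Rdiv; rewrite Rpow_mult_distr, pow_inv; reflexivity).
  rewrite !Rmn_rdet by exact hk; fold q.
  pose proof (gam_pos kappa 1 hk (le_n 1)) as G1.
  pose proof (gam_pos kappa k hk Hk) as Gk; pose proof (gam_pos kappa l hk Hl) as Gl.
  pose proof (gam_pos kappa m hk Hm) as Gm; pose proof (gam_pos kappa n hk Hn) as Gn.
  assert (Hsqrt : sqrt (gam kappa m * gam kappa n / (gam kappa k * gam kappa l))
    * (sqrt (gam kappa 1 / gam kappa k) * sqrt (gam kappa 1 / gam kappa l))
    * (sqrt (gam kappa 1 / gam kappa m) * sqrt (gam kappa 1 / gam kappa n))
    = gam kappa 1 ^ 2 / (gam kappa k * gam kappa l)).
  { assert (P : forall a b, 0 < a -> 0 < b -> 0 < a / b)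
      by (intros; apply Rdiv_lt_0_compat; assumption).
    rewrite <- !sqrt_mult by
      (repeat first [assumption | apply Rlt_le | apply P | apply Rmult_lt_0_compat]).
    replace (gam kappa m * gam kappa n / (gam kappa k * gam kappa l)
        * (gam kappa 1 / gam kappa k * (gam kappa 1 / gam kappa l))
        * (gam kappa 1 / gam kappa m * (gam kappa 1 / gam kappa n)))
      with ((gam kappa 1 ^ 2 / (gam kappa k * gam kappa l)) ^ 2) by (field; lra).
    apply sqrt_pow2, Rlt_le, P; [apply pow_lt|apply Rmult_lt_0_compat]; assumption. }
  set (N := / (PI ^ 2 * (gam kappa k * gam kappa l))).
  assert (HN : 0 < N).
  { apply Rinv_0_lt_compat, Rmult_lt_0_compat; [apply pow_lt; lra|].
    apply Rmult_lt_0_compat; assumption. }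
  exists (N * K); intros t Ht; specialize (HK t Ht).
  set (J := heat_int q m k t * heat_int q n l t - heat_int q m l t * heat_int q n k t) in *.
  assert (ED : heat_det q k l m n t = N * J).
  { unfold heat_det, heat, J, N; rewrite !gam_gq in *; fold q in Gk, Gl |- *.
    fold (heat_int q m k t) (heat_int q n l t) (heat_int q m l t) (heat_int q n k t).
    field; lra. }
  rewrite ED.
  set (S1 := sqrt (gam kappa m * gam kappa n / (gam kappa k * gam kappa l))) in *.
  set (S2 := sqrt (gam kappa 1 / gam kappa k) * sqrt (gam kappa 1 / gam kappa l)) in *.
  set (S3 := sqrt (gam kappa 1 / gam kappa m) * sqrt (gam kappa 1 / gam kappa n)) in *.
  replace (N * J - 3 / (PI * gam kappa 1 ^ 2) * L ^ 8 * S1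
      * (S2 * rdet q k l * (S3 * rdet q m n) / t ^ 5))
    with (N * (J * t ^ 6 - rdet q m n * rdet q k l
      * (3 * PI / 4 * (2 * L ^ 4) ^ 2) * t) / t ^ 6).
  2:{ transitivity (N * J - 3 / (PI * gam kappa 1 ^ 2) * L ^ 8 * (S1 * S2 * S3)
        * (rdet q k l * rdet q m n / t ^ 5)); [rewrite Hsqrt; unfold N|]; field; lra. }
  assert (Ht6 : 0 < t ^ 6) by (apply pow_lt; lra).
  unfold Rdiv at 1; rewrite !Rabs_mult, (Rabs_pos_eq N) by lra.
  rewrite (Rabs_pos_eq (/ t ^ 6)) by (apply Rlt_le, Rinv_0_lt_compat, Ht6).
  apply Rmult_le_compat_r; [apply Rlt_le, Rinv_0_lt_compat, Ht6|].
  apply Rmult_le_compat_l; [lra|exact HK].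
Qed.

(** * Subtraction of the stationary solution and conclusion *)

Lemma lattice_eq_minus (kappa : R) (a b : nat -> nat -> R -> R) :
  lattice_eq kappa a -> lattice_eq kappa b ->
  lattice_eq kappa (fun m n t => a m n t - b m n t).
Proof.
  intros [[L1 G1] [D1 [B1 [C1 S1]]]] [[L2 G2] [D2 [B2 [C2 S2]]]].
  refine (conj (conj _ _) (conj _ (conj _ (conj _ _)))).
  - intros m n; apply at_right_minus; [apply L1|apply L2].
  - intros T HT; destruct (G1 T HT) as [M1 H1]; destruct (G2 T HT) as [M2 H2].
    exists (M1 + M2); intros m n t Ht; specialize (H1 m n t Ht); specialize (H2 m n t Ht).
    unfold Rminus; apply Rle_trans with (1 := Rabs_triang _ _); rewrite Rabs_Ropp; lra.
  - intros m n t Hm Hn Hmn Ht.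
    rewrite rhs_minus.
    apply (is_derive_minus (a m n) (b m n)); [apply D1|apply D2]; auto.
  - intros m t Ht; rewrite B1, B2 by exact Ht; ring.
  - intros n t Ht; rewrite C1, C2 by exact Ht; ring.
  - intros m n t Ht; rewrite (S1 m n), (S2 m n) by exact Ht; reflexivity.
Qed.

Lemma stationary_lattice_eq (kappa : R) (rho : nat -> nat -> R) :
  0 < kappa -> stationary kappa rho -> lattice_eq kappa (fun m n _ => rho m n).
Proof.
  intros hk Hrho; pose proof (stationary_sym kappa rho hk Hrho) as Hs.
  destruct Hrho as [[M HM] [Hh [H1 [H2 H3]]]].
  refine (conj (conj _ _) (conj _ (conj _ (conj _ _)))); auto.
  - intros m n; apply filterlim_const.
  - intros T _; exists M; auto.
  - intros m n t Hm Hn Hmn _; rewrite Hh by assumption.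
    apply (is_derive_const (K := R_AbsRing) (V := RV) (rho m n)).
Qed.

(** [solves] fixes the diagonal for positive times only; at time 0 its value comes from the initial
    data, and at index 0 from the boundary condition. *)
Lemma solves_diag (kappa : R) (r0 : nat -> nat -> R) (r : nat -> nat -> R -> R) :
  init_data r0 -> solves kappa r0 r ->
  forall m t, 0 <= t -> r m m t = if Nat.eqb m 0 then 0 else 1.
Proof.
  intros [_ [_ H1]] [[_ [_ [HB _]]] [Hd Hi]] m t Ht.
  destruct m as [|m]; [apply HB, Ht|].
  destruct (Req_dec t 0) as [->|]; [rewrite Hi, H1 by lia; reflexivity|].
  apply Hd; [lia|lra].
Qed.

Theorem theorem3p2 (kappa : R) (hk : 0 < kappa)
  (rho : nat -> nat -> R) (hrho : stationary kappa rho)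
  (r0 : nat -> nat -> R) (hr0 : init_data r0) :
  (* existence and uniqueness (on t >= 0) for the main problem *)
  (exists r, solves kappa r0 r) /\
  (forall r1 r2, solves kappa r0 r1 -> solves kappa r0 r2 ->
     forall m n t, 0 <= t -> r1 m n t = r2 m n t) /\
  (* existence and uniqueness of r^{(k,l)} *)
  (forall k l, (1 <= l)%nat -> (l < k)%nat -> exists f, solves_kl kappa k l f) /\
  (forall k l f1 f2, (1 <= l)%nat -> (l < k)%nat ->
     solves_kl kappa k l f1 -> solves_kl kappa k l f2 ->
     forall m n t, 0 <= t -> f1 m n t = f2 m n t) /\
  (forall F : nat -> nat -> nat -> nat -> R -> R,
     (forall k l, (1 <= l)%nat -> (l < k)%nat -> solves_kl kappa k l (F k l)) ->
     (* representation formula: sum over k > l >= 1 (absolutely convergent) *)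
     (forall r, solves kappa r0 r ->
        forall m n t, (1 <= m)%nat -> (1 <= n)%nat -> 0 <= t ->
          let term := fun k l => F k l m n t * (r0 k l - rho k l) in
          ex_series (fun k => sumR (fun j => Rabs (term k (S j))) (k - 1)) /\
          r m n t = rho m n + Series (fun k => sumR (fun j => term k (S j)) (k - 1))) /\
     (* large-time asymptotics *)
     (forall k l m n, (1 <= l)%nat -> (l < k)%nat -> (1 <= n)%nat -> (n <= m)%nat ->
        let q := qpar kappa in
        let g := gam kappa in
        exists C T, 0 < T /\ forall t, T <= t ->
          Rabs (F k l m n t
                - 3 / (PI * g 1%nat ^ 2)
                  * (qpoch_inf q q ^ 8 / qpoch_inf (- q) q ^ 8)
                  * sqrt (g m * g n / (g k * g l))
                  * (Rmn kappa k l * Rmn kappa m n / t ^ 5))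
          <= C / t ^ 6)).
Proof.
  pose proof (stationary_lattice_eq kappa rho hk hrho) as Lrho.
  pose proof (stationary_sym kappa rho hk hrho) as Srho.
  destruct hrho as [[M HM] [_ [H1 [H2 H3]]]].
  pose proof hr0 as [Hb [Hs Hd]].
  assert (HM0 : 0 <= M) by (apply Rle_trans with (2 := HM O O), Rabs_pos).
  assert (Hbd : forall k l, (1 <= l)%nat -> (l < k)%nat -> Rabs (r0 k l - rho k l) <= 1 + M).
  { intros k l Hl Hk; specialize (Hb k l ltac:(lia) Hl); specialize (HM k l).
    apply Rabs_le_between in HM; apply Rabs_le; lra. }
  split; [|split; [|split; [|split]]].
  (* Existence: [rho] minus the semigroup applied to [rho - r0], with the data put to 0 on the axes,
     where [r0] is unconstrained. *)
  - set (a := fun m n => if (Nat.eqb m 0 || Nat.eqb n 0 || Nat.eqb m n)%bool then 0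
                         else rho m n - r0 m n).
    assert (Ha0 : off_boundary a).
    { intros m n H; unfold a.
      destruct (Nat.eqb_spec m 0), (Nat.eqb_spec n 0), (Nat.eqb_spec m n); simpl;
        try reflexivity; lia. }
    assert (HaM : forall m n, Rabs (a m n) <= 1 + M).
    { intros m n; unfold a.
      destruct (Nat.eqb_spec m 0), (Nat.eqb_spec n 0), (Nat.eqb_spec m n); simpl;
        try (rewrite Rabs_R0; lra).
      specialize (Hb m n ltac:(lia) ltac:(lia)); specialize (HM m n).
      apply Rabs_le_between in HM; apply Rabs_le; lra. }
    assert (Has : forall m n, a m n = a n m).
    { intros m n; unfold a; rewrite (Srho m n).
      destruct (Nat.eqb_spec m 0), (Nat.eqb_spec n 0), (Nat.eqb_spec m n), (Nat.eqb_spec n m);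
        simpl; try reflexivity; try lia.
      rewrite (Hs m n) by lia; reflexivity. }
    exists (fun m n t => rho m n - semigroup kappa a m n t); split; [|split].
    + apply (lattice_eq_minus kappa (fun m n _ => rho m n)); [exact Lrho|].
      apply (semigroup_lattice_eq kappa a (1 + M)); assumption.
    + intros m t Hm _; rewrite H1, semigroup_boundary by auto; ring.
    + intros m n Hm Hn; rewrite semigroup_0; unfold a.
      destruct (Nat.eqb_spec m 0), (Nat.eqb_spec n 0), (Nat.eqb_spec m n); simpl; try lia; [|ring].
      subst n; rewrite H1, Hd by assumption; ring.
  - intros r1 r2 Hr1 Hr2 m n t Ht; apply Rminus_diag_uniq.
    apply (growth_flow_zero kappa (fun m n t => r1 m n t - r2 m n t) hk); [| |exact Ht].
    + apply lattice_eq_growth_flow; [apply lattice_eq_minus; [apply Hr1|apply Hr2]|].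
      intros i s Hs'; rewrite (solves_diag kappa r0 r1 hr0 Hr1), (solves_diag kappa r0 r2 hr0 Hr2)
        by exact Hs'; ring.
    + intros i j.
      destruct Hr1 as [[_ [_ [B1 [C1 _]]]] [_ I1]]; destruct Hr2 as [[_ [_ [B2 [C2 _]]]] [_ I2]].
      destruct i as [|i]; [rewrite C1, C2 by lra; ring|].
      destruct j as [|j]; [rewrite B1, B2 by lra; ring|].
      rewrite I1, I2 by lia; ring.
  - intros k l Hl Hk.
    (* [truncate] symmetrizes this delta function; the cut-off [S k] is the first one that retains
       row [k]. *)
    set (b := fun i j => if (Nat.eqb i k && Nat.eqb j l)%bool then 1 else 0).
    assert (Hb1 : forall m n, Rabs (truncate b (S k) m n) <= 1).
    { intros m n; apply truncate_abs_le; [lra|]; intros i j _ _; unfold b.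
      destruct (_ && _)%bool; [rewrite Rabs_R1|rewrite Rabs_R0]; lra. }
    exists (semigroup kappa (truncate b (S k))); split; [|split].
    + apply (semigroup_lattice_eq kappa _ 1); auto using truncate_boundary, truncate_sym.
    + intros; apply semigroup_boundary; auto using truncate_boundary.
    + intros m n Hn Hm; rewrite semigroup_0; unfold truncate, b.
      rewrite Nat.max_l, Nat.min_r by lia.
      destruct (Nat.eqb_spec m 0), (Nat.eqb_spec n 0), (Nat.eqb_spec m n); try lia.
      destruct (Nat.leb_spec (S k) m); simpl orb; [|reflexivity].
      destruct (Nat.eqb_spec m k); [lia|reflexivity].
  - intros k l f1 f2 Hl Hk Hf1 Hf2.
    (* The initial condition is prescribed for [m > n] only; there both solutions equal the
       determinant, and symmetry supplies the other half. *)
    assert (Hle : forall m n t, (n <= m)%nat -> 0 <= t -> f1 m n t = f2 m n t).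
    { intros m n t Hmn Ht; rewrite (solves_kl_heat_det kappa k l f1),
        (solves_kl_heat_det kappa k l f2) by assumption; reflexivity. }
    intros m n t Ht; destruct (le_lt_dec n m) as [H|H]; [apply Hle; assumption|].
    destruct Hf1 as [[_ [_ [_ [_ S1]]]] _]; destruct Hf2 as [[_ [_ [_ [_ S2]]]] _].
    rewrite S1, S2 by exact Ht; apply Hle; [lia|exact Ht].
  - intros F HF; split.
    + intros r Hr m n t Hm Hn Ht; cbv zeta.
      set (b := fun k l => r0 k l - rho k l).
      split.
      { apply (kl_series_abs_conv kappa F b (1 + M)); (assumption || lra). }
      (* Subtracting [rho] turns the diagonal value 1 into 0, so superposition applies to
         [r - rho]. *)
      assert (HS : is_series (fun k => sumR (fun j => F k (S j) m n t * b k (S j)) (k - 1))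
        (r m n t - rho m n)).
      { apply (kl_series_solution kappa F b (fun m n t => r m n t - rho m n) (1 + M));
          try assumption; try lra.
        - apply lattice_eq_growth_flow.
          + apply (lattice_eq_minus kappa r (fun m n _ => rho m n)); [apply Hr|exact Lrho].
          + intros i s Hs'; rewrite (solves_diag kappa r0 r hr0 Hr) by exact Hs'.
            destruct i as [|i]; simpl; [rewrite H2|rewrite H1 by lia]; ring.
        - intros i j s Hs'; destruct Hr as [[_ [_ [_ [_ S1]]]] _].
          rewrite S1, (Srho i j) by exact Hs'; reflexivity.
        - intros k l Hl Hk; destruct Hr as [_ [_ I1]]; rewrite I1 by lia; reflexivity. }
      change (r m n t = rho m n
        + Series (fun k => sumR (fun j => F k (S j) m n t * b k (S j)) (k - 1))).
      rewrite (is_series_unique _ _ HS); ring.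
    + intros k l m n Hl Hk Hn Hmn; cbv zeta.
      destruct (heat_det_asymptotics kappa k l m n hk ltac:(lia) Hl ltac:(lia) Hn) as [C HC].
      exists C, 2; split; [lra|]; intros t Ht.
      rewrite (solves_kl_heat_det kappa k l (F k l)) by (auto; lra).
      apply HC, Ht.
Qed.
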